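(* Let $G=\mathbb{T}\times\mathbb{R}^n\times V\times H<G_{aWH}$ be a nonunimodular translation complete subgroup, and let $\mathcal{H}_U\subset L^2(\mathbb{R}^n)$ be a closed $G$-invariant subspace, with $U\subset\widehat{\mathbb{R}^n}$ a $V\rtimes H^T$-invariant Borel set. Then $G$ is admissible for $\mathcal{H}_U$ if and only if $G$ is weakly admissible for $\mathcal{H}_U$.
   Context: The dual group $\widehat{\mathbb{R}^n}$ is identified with $\mathbb{R}^n$ (column vectors) by associating to $\xi$ the character $x\mapsto e^{2\pi i\langle x,\xi\rangle}$; $\widehat f(\gamma)=\int f(x)e^{-2\pi i\langle\gamma,x\rangle}dx$. The affine Weyl-Heisenberg group is $G_{aWH}=\mathbb{T}\times\mathbb{R}^n\times\widehat{\mathbb{R}^n}\times\mathrm{GL}(n,\mathbb{R})$ with the product topology and group law $(z_1,x_1,\xi_1,h_1)(z_2,x_2,\xi_2,h_2)=(z_1z_2e^{2\pi i\langle\xi_1,h_1x_2\rangle},\,x_1+h_1x_2,\,\xi_1+h_1^{-T}\xi_2,\,h_1h_2)$, where $h^{-T}=(h^{-1})^T$. Its quasi-regular representation on $L^2(\mathbb{R}^n)$ is $\pi(z,x,\xi,h)=zT_xM_\xi D_h$, where $T_xf(y)=f(y-x)$, $M_\xi f(y)=e^{2\pi i\langle y,\xi\rangle}f(y)$, $D_hf(y)=|\det h|^{-1/2}f(h^{-1}y)$. A translation complete subgroup is a subgroup $G=\mathbb{T}\times\mathbb{R}^n\times V\times H$, where $V\subset\widehat{\mathbb{R}^n}$ is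 a linear subspace, $H$ is a closed subgroup of $\mathrm{GL}(n,\mathbb{R})$, and $h^TV\subset V$ for all $h\in H$; $L^2(G)$ is taken with respect to left Haar measure. The group $V\rtimes H^T$ is the set $V\times H$ with law $(\xi_1,h_1)(\xi_2,h_2)=(\xi_1+h_1^{-T}\xi_2,h_1h_2)$; it acts on $\widehat{\mathbb{R}^n}$ from the right by the dual action $\gamma.(\xi,h)=h^T(\gamma-\xi)$. For a Borel set $U\subset\widehat{\mathbb{R}^n}$, $\mathcal{H}_U=\{f\in L^2(\mathbb{R}^n):\widehat f=0\text{ a.e. outside }U\}$. For $\psi\in\mathcal{H}_U$ let $V_\psi f(\mathbf{x})=\langle f,\pi(\mathbf{x})\psi\rangle$, $\mathbf{x}\in G$. $\psi$ is weakly admissible for $\mathcal{H}_U$ if $V_\psi:\mathcal{H}_U\to L^2(G)$ is bounded and injective, and admissible for $\mathcal{H}_U$ if $V_\psi:\mathcal{H}_U\to L^2(G)$ is a nonzero scalar multiple of an isometry. $G$ is (weakly) admissible for $\mathcal{H}_U$ if there exists at least one (weakly) admissible vector $\psi\in\mathcal{H}_U$. *)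

(* Defs.v *)
From HB Require Import structures.
From mathcomp Require Import all_boot all_order all_algebra.
From mathcomp Require Import all_classical all_reals all_analysis.
From mathcomp Require Import measurable_realfun complex.

Set Implicit Arguments.
Unset Strict Implicit.
Unset Printing Implicit Defensive.

Import Order.TTheory GRing.Theory Num.Theory.
Import numFieldNormedType.Exports.

Local Open Scope classical_set_scope.
Local Open Scope ring_scope.

Notation borel T := (g_sigma_algebraType (@open T%type)).

Definition consv (R : realType) n (t : R) (x : 'cV[R]_n) : 'cV[R]_n.+1 :=
  col_mx (t%:M : 'cV[R]_1) x.

(* Lebesgue measure on R^n, as an iterated integral: splitting off the first
   coordinate, leb A is the integral over t of leb {x | (t, x) \in A}. *)
Fixpoint leb (R : realType) (n : nat) : set (borel 'cV[R]_n) -> \bar R :=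
  match n with
  | 0 => fun A => (@dirac _ (borel 'cV[R]_0) (0 : 'cV[R]_0) R A)
  | n'.+1 => fun A => (\int[@lebesgue_measure R]_t
      @leb R n' [set x | A (consv t x)])%E
  end.

Section leb_measure.
Variable R : realType.

Lemma consv_ball n (t : R) (x : 'cV[R]_n) s y r :
  ball (consv t x) r (consv s y) <-> ball t r s /\ ball x r y.
Proof.
split.
  move=> [r0 b]; split.
    have := b (lshift n (ord0 : 'I_1)) 0.
    by rewrite /consv !(@col_mxEu _ 1 n) !mxE eqxx !mulr1n.
  by split=> // i j; have := b (rshift 1 i) j; rewrite /consv !(@col_mxEd _ 1 n).
move=> [bt [r0 bx]]; split => // i j.
rewrite -(@splitK 1 n i); case: (fintype.split (i : 'I_(1 + n))) => k /=.
  by rewrite /consv !(@col_mxEu _ 1 n) !mxE !ord1 eqxx !mulr1n.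
by rewrite /consv !(@col_mxEd _ 1 n).
Qed.

Lemma consvP n (z : 'cV[R]_n.+1) : exists t x, z = consv t x.
Proof.
exists (z 0 0), (dsubmx (z : 'cV[R]_(1 + n))).
rewrite -[LHS](@vsubmxK _ 1 n); congr (@col_mx _ 1 n 1 _ _).
by apply/matrixP => i j; rewrite !ord1 !mxE eqxx mulr1n; congr (z _ _); exact/val_inj.
Qed.

Lemma measurable_ball_cV n (x : 'cV[R]_n) r :
  measurable (ball x r : set (borel 'cV[R]_n)).
Proof. by apply: sub_sigma_algebra; exact: ball_open. Qed.

Let qball n (p : rat * ('cV[rat]_n)) : set 'cV[R]_n :=
  ball (map_mx ratr p.2 : 'cV[R]_n) (ratr p.1).

Let qball_basis n (O : set 'cV[R]_n) : open O ->
  O = \bigcup_(p in [set p | @qball n p `<=` O]) @qball n p.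
Proof.
move=> oO; apply/seteqP; split => [x Ox|x [p /= pO px]]; last exact: pO.
have /nbhs_ballP[e /= e0 eO] : nbhs x O by exact: open_nbhs_nbhs.
have /rat_in_itvoo[q /itvP qe] : 0 < e / 2 by rewrite divr_gt0.
have q0 : 0 < ratr q :> R by rewrite qe.
have /choice[c0 c0P] : forall i, exists s : rat,
    ball (x i 0) (ratr q : R) (ratr s).
  move=> i; have /rat_in_itvoo[s /itvP sq] : x i 0 < x i 0 + ratr q.
    by rewrite ltrDl.
  exists s; rewrite /ball/= distrC ger0_norm ?subr_ge0 ?sq//.
  by rewrite ltrBlDl sq.
pose c : 'cV[rat]_n := \col_i c0 i.
have xc : ball x (ratr q) (map_mx ratr c : 'cV[R]_n).
  by split => // i j; rewrite ord1 !mxE.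
exists (q, c) => /=; last exact: ball_sym.
move=> y cy; apply: eO; rewrite -ball_normE/=.
have := ball_triangle xc cy; rewrite -ball_normE/= => /lt_trans; apply.
by rewrite [ltRHS]splitr ltrD// qe.
Qed.

Let glue n (p : measurableTypeR R * borel 'cV[R]_n) : borel 'cV[R]_n.+1 :=
  consv p.1 p.2.

Let glue_ballE n t (x : 'cV[R]_n) r :
  @glue n @^-1` ball (consv t x) r = ball t r `*` ball x r.
Proof. by apply/seteqP; split => -[s y] /consv_ball. Qed.

Let glue_ball n (c : 'cV[R]_n.+1) r :
  measurable (@glue n @^-1` (ball c r : set (borel 'cV[R]_n.+1))).
Proof.
have [t [x ->]] := consvP c.
rewrite glue_ballE.
by apply: measurableX; [apply: open_measurable; exact: ball_open|exact: measurable_ball_cV].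
Qed.

Let measurable_glue n : measurable_fun setT (@glue n).
Proof.
apply: (@measurability _ _ _ _ setT (@glue n) (@open 'cV[R]_n.+1) erefl).
move=> _ /= [A oA <-]; rewrite setTI (qball_basis oA) preimage_bigcup.
rewrite bigcup_mkcond; apply: countable_bigcupT_measurable => // p.
by case: ifPn => // _; exact: glue_ball.
Qed.

Let leb_step n (m : {sigma_finite_measure set (borel 'cV[R]_n) -> \bar R}) :
  @leb R n = m ->
  @leb R n.+1 = pushforward (@lebesgue_measure R \x m)%E (@glue n).
Proof.
move=> lebE; apply/funext => A; rewrite /= lebE.
apply: eq_integral => t _; congr (m _).
by apply/seteqP; split => x; rewrite /xsection /= inE.
Qed.

Let ball_cover n :
  \bigcup_k (ball (0 : 'cV[R]_n) k%:R) = [set: 'cV[R]_n].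
Proof.
apply/seteqP; split => // x _; exists (Num.bound `|x|) => //=.
by rewrite -ball_normE/= sub0r normrN archi_boundP.
Qed.

Let leb_exists n :
  exists m : {sigma_finite_measure set (borel 'cV[R]_n) -> \bar R},
    @leb R n = m /\ forall r : R, (m (ball (0%R : 'cV[R]_n) r) < +oo)%E.
Proof.
elim: n => [|n [m [lebE moo]]].
  exists (@dirac _ (borel 'cV[R]_0) (0 : 'cV[R]_0) R); split => // r /=.
  by rewrite diracE ltry.
pose mu := pushforward (@lebesgue_measure R \x m)%E (@glue n).
have mu0 : mu set0 = 0%E by rewrite /mu /pushforward preimage_set0 measure0.
have mu_ge0 A : (0 <= mu A)%E by exact: measure_ge0.
have mu_add : semi_sigma_additive mu.
  move=> F mF tF mUF; rewrite /mu /pushforward preimage_bigcup.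
  have mgF i : measurable (@glue n @^-1` F i).
    by rewrite -[X in measurable X]setTI; exact: measurable_glue.
  apply: measure_semi_sigma_additive => //; last exact: bigcup_measurable.
  apply/trivIsetP => /= i j _ _ ij; rewrite -preimage_setI.
  by move/trivIsetP : tF => /(_ _ _ _ _ ij) ->//; rewrite preimage_set0.
have mu_ball r : (mu (ball (0%R : 'cV[R]_n.+1) r) < +oo)%E.
  have -> : (0 : 'cV[R]_n.+1) = consv (0 : R) (0 : 'cV[R]_n).
    by apply/matrixP => i j; rewrite /consv raddf0 (@col_mx0 _ 1 n).
  rewrite /mu /pushforward glue_ballE product_measure1E//; last 2 first.
  - by apply: open_measurable; exact: ball_open.
  - exact: measurable_ball_cV.
  have [r0|r0] := leP r 0; first by rewrite (ball0 _ _).2// measure0 mul0e ltry.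
  have lr : @lebesgue_measure R (ball (0 : R) r) = (r *+ 2)%:E.
    by apply: lebesgue_measure_ball; exact: ltW.
  apply: lte_mul_pinfty; [exact: measure_ge0| |exact: moo].
  by apply: (eq_ind_r (fun x : \bar R => x \is a fin_num) _ lr).
have lebS : @leb R n.+1 = mu by exact: leb_step.
clearbody mu.
pose mu1 : {measure set (borel 'cV[R]_n.+1) -> \bar R} :=
  HB.pack mu (isMeasure.Build _ _ _ mu mu0 mu_ge0 mu_add).
have mu_sf : sigma_finite setT mu1.
  exists (fun k => ball (0 : 'cV[R]_n.+1) k%:R : set (borel _)); first by rewrite ball_cover.
  by move=> k; split; [exact: measurable_ball_cV|exact: mu_ball].
pose mu2 : {sigma_finite_measure set (borel 'cV[R]_n.+1) -> \bar R} :=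
  HB.pack mu (isMeasure.Build _ _ _ mu mu0 mu_ge0 mu_add)
    (Measure_isSigmaFinite.Build _ _ _ mu1 mu_sf).
by exists mu2; split.
Qed.

Let leb0 n : @leb R n set0 = 0%E.
Proof. by have [m [-> _]] := leb_exists n; rewrite measure0. Qed.

Let leb_ge0 n A : (0 <= @leb R n A)%E.
Proof. by have [m [-> _]] := leb_exists n; exact: measure_ge0. Qed.

Let leb_sigma_additive n : semi_sigma_additive (@leb R n).
Proof.
by have [m [-> _]] := leb_exists n; exact: measure_semi_sigma_additive.
Qed.

HB.instance Definition _ n := isMeasure.Build _ _ _ (@leb R n)
  (leb0 n) (@leb_ge0 n) (@leb_sigma_additive n).

Let leb_sigma_finite n : sigma_finite setT (@leb R n).
Proof. by have [m [-> _]] := leb_exists n; exact: sigma_finiteT. Qed.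

HB.instance Definition _ n := Measure_isSigmaFinite.Build _ _ _ (@leb R n)
  (@leb_sigma_finite n).

Lemma leb_ball_fin n r : (leb (ball (0%R : 'cV[R]_n) r) < +oo)%E.
Proof. by have [m [-> moo]] := leb_exists n; exact: moo. Qed.

End leb_measure.

(* Complex-valued functions on a subset D of a measure space; functions are
   total, and only their values on D matter. *)
Section complex_L2.
Context d (T : measurableType d) (R : realType).
Variables (mu : {measure set T -> \bar R}) (D : set T).
Implicit Types f g : T -> R[i].

Definition cmeasurable f :=
  measurable_fun D (fun x => complex.Re (f x)) /\
  measurable_fun D (fun x => complex.Im (f x)).

Definition cintegral f : R[i] :=
  Complex (Rintegral mu D (fun x => complex.Re (f x)))
          (Rintegral mu D (fun x => complex.Im (f x))).

Definition L1 f :=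
  mu.-integrable D (fun x => (complex.Re (f x))%:E) /\
  mu.-integrable D (fun x => (complex.Im (f x))%:E).

Definition L2norm f : \bar R :=
  'N[mu]_2%:E[(fun x => (Normc.normc (f x))%:E) \_ D].

Definition L2 f := cmeasurable f /\ (L2norm f < +oo)%E.

Definition inner f g : R[i] := cintegral (fun x => f x * conjc (g x)).

Definition ae_eq_on f g := {ae mu, forall x, D x -> f x = g x}.

End complex_L2.

Section operators.
Context d1 (T1 : measurableType d1) d2 (T2 : measurableType d2) (R : realType).
Variables (mu1 : {measure set T1 -> \bar R}) (mu2 : {measure set T2 -> \bar R}).
Variables (D2 : set T2) (S : set (T1 -> R[i])).
Implicit Types A J : (T1 -> R[i]) -> (T2 -> R[i]).

Definition into_L2 A := forall f, S f -> L2 mu2 D2 (A f).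

Definition bounded_op A := exists C : R, forall f, S f ->
  (L2norm mu2 D2 (A f) <= C%:E * L2norm mu1 setT f)%E.

Definition injective_op A := forall f g, S f -> S g ->
  ae_eq_on mu2 D2 (A f) (A g) -> ae_eq_on mu1 setT f g.

(* Distance preserving on S; this forces J to respect a.e. equality. *)
Definition isometry_op J := into_L2 J /\ forall f g, S f -> S g ->
  L2norm mu2 D2 (fun x => J f x - J g x) =
  L2norm mu1 setT (fun x => f x - g x).

Definition multiple_of_isometry A := exists c : R[i], c != 0 /\
  exists J, isometry_op J /\
    forall f, S f -> ae_eq_on mu2 D2 (A f) (fun x => c * J f x).

Definition closed_subspace := [/\ S `<=` L2 mu1 setT, S (fun=> 0),
  forall (a : R[i]) f g, S f -> S g -> S (fun x => a * f x + g x) &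
  forall (fk : nat -> T1 -> R[i]) f, (forall k, S (fk k)) -> L2 mu1 setT f ->
    (fun k => L2norm mu1 setT (fun x => fk k x - f x)) @ \oo --> 0%E -> S f].

End operators.

Section fourier.
Variables (R : realType) (n : nat).
Local Notation Rn := (borel 'cV[R]_n).
Implicit Types (f g : Rn -> R[i]) (x xi : 'cV[R]_n).

Definition dot x xi : R := \sum_i x i 0 * xi i 0.

Definition expi (t : R) : R[i] := Complex (cos t) (sin t).

Definition chi x xi : R[i] := expi (2 * pi * dot x xi).

Definition fourier1 f : Rn -> R[i] := fun gamma =>
  cintegral (@leb R n) setT (fun x => f x * expi (- (2 * pi * dot gamma x))).

(* g is the Fourier transform of f in L2, defined by continuous extension of
   fourier1 from the intersection of L1 and L2. *)
Definition is_fourier f g := [/\ L2 (@leb R n) setT f, L2 (@leb R n) setT g &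
  exists fk : nat -> Rn -> R[i],
    [/\ forall k, L1 (@leb R n) setT (fk k) /\ L2 (@leb R n) setT (fk k),
      (fun k => L2norm (@leb R n) setT (fun x => fk k x - f x)) @ \oo --> 0%E &
      (fun k => L2norm (@leb R n) setT (fun x => fourier1 (fk k) x - g x))
        @ \oo --> 0%E]].

Definition bandlimited (U : set Rn) : set (Rn -> R[i]) := [set f |
  exists2 g, is_fourier f g & {ae @leb R n, forall gamma, ~ U gamma -> g gamma = 0}].

End fourier.

(* Elements (z, x, xi, h); the affine Weyl-Heisenberg group is the subset
   `|z| = 1, h invertible. *)
Definition aWH_type (R : realType) (n : nat) : Type :=
  (R[i]^o * 'cV[R]_n * 'cV[R]_n * 'M[R]_n)%type.

Section aWH.
Variables (R : realType) (n : nat).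
Local Notation Rn := (borel 'cV[R]_n).
Local Notation E := (aWH_type R n).

Definition aWH_mul (g1 g2 : E) : E :=
  let: (z1, x1, xi1, h1) := g1 in let: (z2, x2, xi2, h2) := g2 in
  (z1 * z2 * chi xi1 (h1 *m x2), x1 + h1 *m x2,
   xi1 + (invmx h1)^T *m xi2, h1 *m h2).

Definition translation x (f : Rn -> R[i]) : Rn -> R[i] := fun y => f (y - x).

Definition modulation xi (f : Rn -> R[i]) : Rn -> R[i] := fun y => chi y xi * f y.

Definition dilation (h : 'M[R]_n) (f : Rn -> R[i]) : Rn -> R[i] :=
  fun y => real_complex R (Num.sqrt `|\det h|)^-1 * f (invmx h *m y).

Definition quasireg (g : E) (f : Rn -> R[i]) : Rn -> R[i] :=
  let: (z, x, xi, h) := g in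
  fun y => z * translation x (modulation xi (dilation h f)) y.

(* Closed in GL(n, R), not necessarily in the space of all matrices. *)
Record closed_subgroup_GL (H : set 'M[R]_n) : Prop := {
  sub_GL : forall h, H h -> h \in unitmx;
  sub_GL1 : H 1%:M;
  sub_GLM : forall h1 h2, H h1 -> H h2 -> H (h1 *m h2);
  sub_GLV : forall h, H h -> H (invmx h);
  closed_in_GL : forall h, h \in unitmx -> closure H h -> H h }.

Definition translation_complete (V : {vspace 'cV[R]_n}) (H : set 'M[R]_n) :=
  closed_subgroup_GL H /\
  forall h xi, H h -> xi \in V -> h^T *m xi \in V.

Definition tc_group (V : {vspace 'cV[R]_n}) (H : set 'M[R]_n) : set E :=
  [set g | let: (z, _, xi, h) := g in [/\ `|z| = 1, xi \in V & H h]].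

(* Borel measures on G are viewed as Borel measures on the ambient space
   vanishing off G. As G is locally compact and second countable, a Borel
   measure finite on compact sets is automatically Radon. *)
Record left_haar (G : set E) (mu : {measure set (borel E) -> \bar R}) : Prop := {
  haar_supp : mu (~` G) = 0%E;
  haar_neq0 : (0 < mu G)%E;
  haar_compact : forall K, compact K -> K `<=` G -> (mu K < +oo)%E;
  haar_left : forall (g : E) (A : set (borel E)), G g -> measurable A ->
    A `<=` G -> mu [set aWH_mul g a | a in A] = mu A }.

Definition right_invariant (G : set E) (mu : {measure set (borel E) -> \bar R}) :=
  forall (g : E) (A : set (borel E)), G g -> measurable A ->
    A `<=` G -> mu [set aWH_mul a g | a in A] = mu A.

(* Some (equivalently, by uniqueness up to scaling, every) left Haar measure is
   also right invariant, i.e. the modular function is 1. *)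
Definition unimodular (G : set E) :=
  exists mu, left_haar G mu /\ right_invariant G mu.

Definition dual_action (gamma : 'cV[R]_n) (p : 'cV[R]_n * 'M[R]_n) : 'cV[R]_n :=
  p.2^T *m (gamma - p.1).

(* As (xi, h) ranges over a group, inclusion for every element is the same as
   equality. *)
Definition dual_invariant (V : {vspace 'cV[R]_n}) (H : set 'M[R]_n)
    (U : set 'cV[R]_n) :=
  forall gamma xi h, U gamma -> xi \in V -> H h -> U (dual_action gamma (xi, h)).

Definition invariant_under (G : set E) (S : set (Rn -> R[i])) :=
  forall g f, G g -> S f -> S (quasireg g f).

Definition voice (psi f : Rn -> R[i]) : borel E -> R[i] :=
  fun g => inner (@leb R n) setT f (quasireg g psi).

Variables (G : set E) (mu : {measure set (borel E) -> \bar R}).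
Variable (S : set (Rn -> R[i])).

Definition weakly_admissible_vector psi := [/\ S psi,
  into_L2 mu G S (voice psi), bounded_op (@leb R n) mu G S (voice psi) &
  injective_op (@leb R n) mu G S (voice psi)].

Definition admissible_vector psi := [/\ S psi,
  into_L2 mu G S (voice psi) &
  multiple_of_isometry (@leb R n) mu G S (voice psi)].

Definition weakly_admissible := exists psi, weakly_admissible_vector psi.

Definition admissible := exists psi, admissible_vector psi.

End aWH.

(* Main.v *)
(* Let psi be weakly admissible and let S be the operator V_psi^* V_psi, a bounded positive
   operator, injective on H_U, which commutes with the representation pi. Spectral
   calculus gives operators B_k in the bicommutant of S with B_k B_l = 0 for k <> l and
   sum_k <S B_k f, B_k f> = |f|^2 for f in H_U. The forms
   (f, f') |-> <V_{pi(g) psi} f, V_{pi(g') psi} f'> are given by operators commuting with i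
   and with translations. On L^2(R^n) such operators form a commutative algebra, so they
   commute with S, hence with the B_k. Therefore V_{pi(g) B_k psi} f and
   V_{pi(g') B_l psi} f are orthogonal for k <> l, whatever g and g'.
   Right translation by g multiplies left Haar measure by a factor c(g), which is
   unbounded as G is not unimodular. Choose g_k with c(g_k) so large that
   psi' = sum_k c(g_k)^(-1/2) pi(g_k) B_k psi converges; then
   |V_psi' f|^2 = sum_k |V_psi B_k f|^2 = sum_k <S B_k f, B_k f> = |f|^2 on H_U. *)

From HB Require Import structures.
Require Import Defs.
From mathcomp Require Import all_boot all_order all_algebra.
From mathcomp Require Import all_classical all_reals all_analysis.
From mathcomp Require Import measurable_realfun complex ring lra.

Set Implicit Arguments.
Unset Strict Implicit.
Unset Printing Implicit Defensive.

Import Order.TTheory GRing.Theory Num.Theory.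
Import numFieldNormedType.Exports.

Local Open Scope classical_set_scope.
Local Open Scope ring_scope.

(** * Real Hilbert spaces *)

(** S^(-1/2) psi would be admissible, but S^(-1/2) is unbounded in general and psi need not be in
    its domain; cutting it into the bounded pieces B_k is what forces a series. The freedom in g_k
    comes from two norms that react differently: pi(g) preserves the norm of B_k psi, while the
    squared norm of the voice transform is multiplied by c(g). Scaling by c(g_k)^(-1/2) thus
    restores the voice transform and makes the vector as short as wanted. B_k B_l = 0 alone does not
    keep the pieces orthogonal once they carry different translates g_k and g_l; this is the
    obstacle that the commutativity of the commutant of translations removes. That fact is obtained
    without the Fourier transform, from convolutions with indicator functions. Boundedness and
    injectivity are given on H_U only. The projection on H_U fixes psi and commutes with pi, which
    extends the bound to all of L^2(R^n). The transform of psi' is not known to be bounded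
    beforehand, so the passage to the limit uses Fatou's lemma. Complex spaces are treated as real
    Hilbert spaces with a distinguished operator, multiplication by i. *)

Section hilbert_defs.
Variables (R : realType) (X : lmodType R) (ip : X -> X -> R).

Definition hnorm (x : X) : R := Num.sqrt (ip x x).

Definition hlim (u : nat -> X) (l : X) := hnorm (u k - l) @[k --> \oo] --> (0 : R).

(** Completeness is phrased with an explicit null sequence bounding the tails: each application
    exhibits one, and the Riesz-Fischer theorem below is proved in the same form. *)
Record hilbert : Prop := {
  hipC : forall x y, ip x y = ip y x;
  hipDl : forall x y z, ip (x + y) z = ip x z + ip y z;
  hipZl : forall a x z, ip (a *: x) z = a * ip x z;
  hip_ge0 : forall x, 0 <= ip x x;
  hip_eq0 : forall x, ip x x = 0 -> x = 0;
  hip_complete : forall (u : nat -> X) (a : nat -> R), a k @[k --> \oo] --> (0 : R) ->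
    (forall m n, (m <= n)%N -> hnorm (u n - u m) <= a m) -> exists l, hlim u l }.

(* Bounded R-linear operators; on complex spaces, complex linearity is
   expressed as commutation with multiplication by i. *)
Record bounded_linear (A : X -> X) : Prop := {
  blP : forall (a : R) x y, A (a *: x + y) = a *: A x + A y;
  bl_bound : exists C, forall x, hnorm (A x) <= C * hnorm x }.

Definition adjoint_pair (A A' : X -> X) := forall x y, ip (A x) y = ip x (A' y).

Definition commuting (A B : X -> X) := forall x, A (B x) = B (A x).

(** T is tested together with its adjoint because commutation with an orthogonal projection is
    obtained from invariance of its range under both. For selfadjoint S, [adjoint_commuting] shows
    that T' commutes with S as soon as T does. *)
Definition in_bicommutant (S B : X -> X) := forall T T', bounded_linear T ->
  bounded_linear T' -> adjoint_pair T T' -> commuting T S -> commuting T B.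

End hilbert_defs.

Section hilbert_theory.
Variables (R : realType) (X : lmodType R) (ip : X -> X -> R).
Hypothesis hX : hilbert ip.
Local Notation nrm := (hnorm ip).
Local Notation hlim := (hlim ip).
Local Notation bl := (bounded_linear ip).
Local Notation selfadj A := (adjoint_pair ip A A).
Local Notation bicomm := (in_bicommutant ip).

Lemma hipDr x y z : ip z (x + y) = ip z x + ip z y.
Proof. by rewrite (hipC hX) hipDl// !(hipC hX z). Qed.

Lemma hipZr a x z : ip z (a *: x) = a * ip z x.
Proof. by rewrite (hipC hX) hipZl// (hipC hX z). Qed.

Lemma hipNl x z : ip (- x) z = - ip x z.
Proof. by rewrite -scaleN1r hipZl// mulN1r. Qed.

Lemma hipNr x z : ip z (- x) = - ip z x.
Proof. by rewrite -scaleN1r hipZr mulN1r. Qed.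

Lemma hip0l z : ip 0 z = 0.
Proof. by rewrite -(scale0r (0 : X)) hipZl// mul0r. Qed.

Lemma hip0r z : ip z 0 = 0.
Proof. by rewrite (hipC hX) hip0l. Qed.

Definition hipE := (hipDl hX, hipDr, hipNl, hipNr, hipZl hX, hipZr, hip0l, hip0r).

Lemma hip_suml (I : Type) (r : seq I) (P : pred I) (F : I -> X) y :
  ip (\sum_(i <- r | P i) F i) y = \sum_(i <- r | P i) ip (F i) y.
Proof.
by apply: (big_morph (fun x => ip x y)) => [u v|]; rewrite ?hipE.
Qed.

Lemma hnorm_ge0 x : 0 <= nrm x. Proof. exact: sqrtr_ge0. Qed.

Lemma hnorm_sqr x : nrm x ^+ 2 = ip x x.
Proof. by rewrite sqr_sqrtr// hip_ge0. Qed.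

Lemma hnorm0 : nrm 0 = 0. Proof. by rewrite /hnorm hipE sqrtr0. Qed.

Lemma hnorm_eq0 x : nrm x = 0 -> x = 0.
Proof. by move=> x0; apply: (hip_eq0 hX); rewrite -hnorm_sqr x0 expr0n. Qed.

Lemma hnormZ a x : nrm (a *: x) = `|a| * nrm x.
Proof.
by rewrite /hnorm !hipE mulrA -expr2 sqrtrM ?sqr_ge0// sqrtr_sqr.
Qed.

Lemma hnormN x : nrm (- x) = nrm x.
Proof. by rewrite -scaleN1r hnormZ normrN1 mul1r. Qed.

Lemma hnormBC x y : nrm (x - y) = nrm (y - x).
Proof. by rewrite -hnormN opprB. Qed.

Lemma hcauchy_schwarz x y : `|ip x y| <= nrm x * nrm y.
Proof.
have [y0|y0] := eqVneq (ip y y) 0.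
  by rewrite (hip_eq0 hX y0) hip0r normr0 mulr_ge0// hnorm_ge0.
have yp : 0 < ip y y by rewrite lt_neqAle eq_sym y0 hip_ge0.
rewrite -(@ler_pXn2r _ 2) ?nnegrE ?mulr_ge0 ?hnorm_ge0//.
rewrite exprMn !hnorm_sqr real_normK ?num_real//.
have := hip_ge0 hX (ip y y *: x - ip x y *: y).
rewrite !hipE (hipC hX y x).
rewrite (_ : _ + _ = ip y y * (ip x x * ip y y - ip x y ^+ 2)); last by ring.
by rewrite pmulr_rge0// subr_ge0.
Qed.

Lemma hip_le x y : ip x y <= nrm x * nrm y.
Proof. by rewrite (le_trans (ler_norm _))// hcauchy_schwarz. Qed.

Lemma hnormD x y : nrm (x + y) <= nrm x + nrm y.
Proof.
rewrite -(@ler_pXn2r _ 2)// ?nnegrE ?addr_ge0 ?hnorm_ge0//.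
rewrite sqrrD !hnorm_sqr !hipE (hipC hX y x).
have := hip_le x y; lra.
Qed.

Lemma hnormB_trans x y z : nrm (x - z) <= nrm (x - y) + nrm (y - z).
Proof. by rewrite (le_trans _ (hnormD _ _))// addrA subrK. Qed.

Lemma hlim_near u l v : (forall k, nrm (v k) <= nrm (u k - l)) -> hlim u l ->
  nrm (v k) @[k --> \oo] --> (0 : R).
Proof.
move=> vu ul; apply: (@squeeze_cvgr _ _ _ _ (fun=> 0) (fun k => nrm (u k - l))) => //.
  by apply: nearW => k; rewrite hnorm_ge0 vu.
exact: cvg_cst.
Qed.

Lemma hlim_cst x : hlim (fun=> x) x.
Proof.
rewrite (_ : hlim _ _ = (hnorm ip (x - x) @[_ --> \oo] --> 0))// subrr hnorm0.
exact: cvg_cst.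
Qed.

Lemma eq_hlim u v l : u =1 v -> hlim u l -> hlim v l.
Proof. by move=> /funext ->. Qed.

Lemma hlim_shift u l : hlim u l -> hlim (fun n => u n.+1) l.
Proof. by move=> ul; have := ul; rewrite (_ : hlim u l = (nrm (u k - l) @[k --> \oo] --> (0 : R)))// -(cvg_shiftS (fun n => nrm (u n - l))). Qed.

Lemma hlimD u v l m : hlim u l -> hlim v m -> hlim (fun k => u k + v k) (l + m).
Proof.
move=> ul vm; apply: (@squeeze_cvgr _ _ _ _ (fun=> 0) (fun k => nrm (u k - l) + nrm (v k - m))).
- apply: nearW => k; rewrite hnorm_ge0/=.
  by rewrite opprD addrACA hnormD.
- exact: cvg_cst.
- by rewrite -[X in _ --> X](addr0 0); exact: cvgD.
Qed.

Lemma hlim_bl A u l : bl A -> hlim u l -> hlim (A \o u) (A l).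
Proof.
move=> [lA [C AC]] ul.
have Ab x y : A (x - y) = A x - A y.
  have -> : x - y = (-1) *: y + x by rewrite scaleN1r addrC.
  by rewrite lA scaleN1r addrC.
apply: (@squeeze_cvgr _ _ _ _ (fun=> 0) (fun k => C * nrm (u k - l))).
- by apply: nearW => k; rewrite hnorm_ge0/= -Ab AC.
- exact: cvg_cst.
- by rewrite -[X in _ --> X](mulr0 C); apply: cvgMr; exact: ul.
Qed.

Lemma hlim_unique u l m : hlim u l -> hlim u m -> l = m.
Proof.
move=> ul um; apply/eqP; rewrite -subr_eq0; apply/eqP/hnorm_eq0/le_anti.
rewrite hnorm_ge0 andbT.
have h : nrm (u k - l) + nrm (u k - m) @[k --> \oo] --> (0 : R).
  by rewrite -[X in _ --> X](addr0 0); exact: cvgD.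
apply: (cvgr_to_ge h); apply: nearW => k.
by rewrite (le_trans (hnormB_trans _ (u k) _))// hnormBC.
Qed.

Lemma hlim_ip u l y : hlim u l -> ip (u k) y @[k --> \oo] --> ip l y.
Proof.
move=> ul; apply/cvgrPdist_le => e e0.
have : nrm (u k - l) * nrm y @[k --> \oo] --> (0 : R).
  by rewrite -[X in _ --> X](mul0r (nrm y)); apply: cvgMl; exact: ul.
move=> /cvgr_dist_le /(_ e e0); apply: filterS => k.
rewrite sub0r normrN ger0_norm ?mulr_ge0 ?hnorm_ge0//; apply: le_trans.
by rewrite -hipNl -(hipDl hX) -hnormBC hcauchy_schwarz.
Qed.

Lemma hlim_norm u l : hlim u l -> nrm (u k) @[k --> \oo] --> nrm l.
Proof.
move=> ul; apply/cvgrPdist_le => e e0.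
have /cvgr_dist_le /(_ e e0) := ul; apply: filterS => k.
rewrite sub0r normrN ger0_norm ?hnorm_ge0//; apply: le_trans.
rewrite ler_norml; apply/andP; split.
  by rewrite lerNl opprB lerBlDr -{1}[u k](subrK l) hnormD.
by rewrite lerBlDr hnormBC -{1}[l](subrK (u k)) hnormD.
Qed.

Lemma hlim_norm2 u l : hlim u l -> ip (u k) (u k) @[k --> \oo] --> ip l l.
Proof.
move=> /hlim_norm ul; rewrite -hnorm_sqr expr2.
by under eq_fun do rewrite -hnorm_sqr expr2; exact: cvgM.
Qed.

Lemma hlim_le u l C : hlim u l -> (forall k, nrm (u k) <= C) -> nrm l <= C.
Proof.
move=> /hlim_norm ul uC; have := @cvgr_to_le _ _ _ _ _ _ _ ul; apply.
exact: nearW.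
Qed.

Section bounded_linear.
Variables (A : X -> X) (bA : bl A).

Lemma blD x y : A (x + y) = A x + A y.
Proof. by have := blP bA 1 x y; rewrite !scale1r. Qed.

Lemma bl0 : A 0 = 0.
Proof. by apply: (@addrI _ (A 0)); rewrite -blD !addr0. Qed.

Lemma blZ a x : A (a *: x) = a *: A x.
Proof. by rewrite -[a *: x]addr0 (blP bA) bl0 addr0. Qed.

Lemma blN x : A (- x) = - A x.
Proof. by rewrite -scaleN1r blZ scaleN1r. Qed.

Lemma blB x y : A (x - y) = A x - A y.
Proof. by rewrite blD blN. Qed.

Lemma bl_pos : exists2 C, 0 < C & forall x, nrm (A x) <= C * nrm x.
Proof.
have [C AC] := bl_bound bA; exists (`|C| + 1); first by rewrite ltr_wpDl.
move=> x; rewrite (le_trans (AC x))// ler_wpM2r// ?hnorm_ge0//.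
by rewrite (le_trans (ler_norm C))// lerDl.
Qed.

End bounded_linear.

Lemma bl_id : bl id.
Proof. by split=> //; exists 1 => x; rewrite mul1r. Qed.

Lemma bl_comp A B : bl A -> bl B -> bl (A \o B).
Proof.
move=> bA bB; split=> [a x y/=|]; first by rewrite (blP bB) (blP bA).
have [C C0 AC] := bl_pos bA; have [D D0 BD] := bl_pos bB.
exists (C * D) => x /=; rewrite (le_trans (AC _))// -mulrA ler_wpM2l//.
exact: ltW.
Qed.

Lemma bl_add A B : bl A -> bl B -> bl (fun x => A x + B x).
Proof.
move=> bA bB; split=> [a x y/=|].
  by rewrite (blP bB) (blP bA) scalerDr addrACA.
have [C C0 AC] := bl_pos bA; have [D D0 BD] := bl_pos bB.
exists (C + D) => x /=; rewrite (le_trans (hnormD _ _))// mulrDl.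
by rewrite lerD.
Qed.

Lemma bl_scale c A : bl A -> bl (fun x => c *: A x).
Proof.
move=> bA; split=> [a x y/=|].
  by rewrite (blP bA) scalerDr !scalerA mulrC.
have [C C0 AC] := bl_pos bA.
by exists (`|c| * C) => x /=; rewrite hnormZ -mulrA ler_wpM2l.
Qed.

Lemma bl_sub A B : bl A -> bl B -> bl (fun x => A x - B x).
Proof.
move=> bA bB; have := bl_add bA (bl_scale (-1) bB).
by congr bl; apply/funext => x; rewrite scaleN1r.
Qed.

Lemma hsummable (u : nat -> X) (a : nat -> R) :
  (forall k, nrm (u k) <= a k) -> cvgn (series a) ->
  exists l, hlim (fun n => \sum_(k < n) u k) l.
Proof.
move=> ua ca.
have a0 k : 0 <= a k by exact: le_trans (hnorm_ge0 _) (ua k).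
have sle m : series a m <= limn (series a).
  apply: nondecreasing_cvgn_le => //; exact: nondecreasing_series.
apply: (@hip_complete _ _ _ hX _ (fun m => limn (series a) - series a m)).
  by rewrite -[X in _ --> X](subrr (limn (series a))); apply: cvgB => //; exact: cvg_cst.
move=> m n mn; apply: (@le_trans _ _ (series a n - series a m)); last by rewrite lerD2r.
rewrite -(subnK mn); elim: (n - m)%N => [|k ih].
  by rewrite add0n !subrr hnorm0.
rewrite addSn big_ord_recr/= addrAC (le_trans (hnormD _ _))//.
rewrite /series/= big_nat_recr//= addrAC lerD//.
Qed.

(** * Riesz representation, adjoints and orthogonal projections *)

Definition closed_subspace_of (W : set X) := [/\ W 0,
  forall (a : R) x y, W x -> W y -> W (a *: x + y) &
  forall u l, (forall k : nat, W (u k)) -> hlim u l -> W l].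

(* The minimizer of |x|^2 - 2 phi x on W. *)
Lemma riesz_subspace (W : set X) (phi : X -> R) : closed_subspace_of W ->
  (forall (a : R) x y, phi (a *: x + y) = a * phi x + phi y) ->
  (exists C, forall x, `|phi x| <= C * nrm x) ->
  exists2 w, W w & forall x, W x -> ip w x = phi x.
Proof.
move=> [W0 WZD Wlim] phiL [C phiC].
have phi0 : phi 0 = 0.
  by apply: (@addrI _ (phi 0)); have := phiL 1 0 0; rewrite scaler0 mul1r !addr0 => <-.
pose J x := ip x x - 2 * phi x.
have Jlb x : - C ^+ 2 <= J x.
  have h := phiC x; have := ler_norm (phi x); rewrite /J -hnorm_sqr => h'.
  have : 0 <= (nrm x - C) ^+ 2 by exact: sqr_ge0.
  rewrite sqrrB; lra.
have infJ : has_inf (J @` W).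
  by split; [exists (J 0), 0|exists (- C ^+ 2) => _ [x _ <-]].
set m := inf (J @` W).
have mJ x : W x -> m <= J x by move=> Wx; apply: ge_inf; [exact: infJ.2|exists x].
have : forall k : nat, exists x, W x /\ J x < m + k.+1%:R^-1.
  move=> k; have [|_ [x Wx <-] xm] := @inf_adherent _ _ k.+1%:R^-1 _ infJ.
    by rewrite invr_gt0.
  by exists x.
move=> /choice[u /all_and2[Wu uJ]].
(* By the parallelogram law |u_i - u_j|^2 = 2 J(u_i) + 2 J(u_j) - 4 J((u_i + u_j) / 2). The midpoint
   lies in W, so for i <= j this is at most 4 / (i + 1). *)
have [] := @hip_complete _ _ _ hX u (fun k => Num.sqrt (4 * k.+1%:R^-1)).
- have h : (4 * k.+1%:R^-1 : R) @[k --> \oo] --> (4 * 0 : R).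
    by apply: cvgMr; exact: cvg_harmonic.
  have h2 := @continuous_cvg _ _ _ _ _ _ _ (4 * 0 : R) (@sqrt_continuous R _) h.
  by rewrite mulr0 sqrtr0 in h2; exact: h2.
- move=> i j ij; rewrite /hnorm ler_sqrt ?mulr_ge0//.
  have Wm : W (2^-1 *: (u i + u j)).
    rewrite scalerDr; have -> : 2^-1 *: u j = 2^-1 *: u j + 0 by rewrite addr0.
    by apply: (WZD) => //; exact: WZD.
  have phiD x y : phi (x + y) = phi x + phi y by have := phiL 1 x y; rewrite scale1r mul1r.
  have phiZ a x : phi (a *: x) = a * phi x by have := phiL a x 0; rewrite phi0 !addr0.
  have := mJ _ Wm; have := uJ i; have := uJ j.
  rewrite /J !hipE phiZ phiD (hipC hX (u j) (u i)).
  have : (j.+1%:R^-1 : R) <= i.+1%:R^-1 by rewrite lef_pV2 ?posrE// ler_nat.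
  by move: (i.+1%:R^-1) (j.+1%:R^-1) => a b; lra.
move=> w uw; have Ww : W w by exact: Wlim uw.
exists w => // x Wx.
have Jw : J w <= m.
  have h : J (u k) @[k --> \oo] --> J w.
    apply: cvgB; first exact: hlim_norm2.
    apply: cvgMr; apply/cvgrPdist_le => e e0.
    have : C * nrm (u k - w) @[k --> \oo] --> (0 : R).
      by rewrite -[X in _ --> X](mulr0 C); apply: cvgMr.
    move=> /cvgr_dist_le /(_ e e0); apply: filterS => k.
    rewrite sub0r normrN => /(le_trans (ler_norm _)); apply: le_trans.
    rewrite hnormBC; apply: le_trans (phiC _).
    have := phiL (-1) (u k) w; rewrite scaleN1r addrC => ->.
    by rewrite mulN1r addrC.
  have h' : m + k.+1%:R^-1 @[k --> \oo] --> m.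
    by rewrite -[X in _ --> X](addr0 m); apply: cvgD; [exact: cvg_cst|exact: cvg_harmonic].
  have := ler_cvg_to h h'; apply; apply: nearW => k; exact: ltW.
(* Minimality of w along the line w + t x. A nonnegative quadratic in t without constant term has no
   linear term either; the two values of t below treat a zero and a positive leading coefficient. *)
have JL t : 0 <= t ^+ 2 * ip x x + 2 * t * (ip w x - phi x).
  have := mJ _ (WZD t x w Wx Ww).
  rewrite /J !hipE phiL (hipC hX x w); move: Jw; rewrite /J; lra.
apply/eqP; rewrite -subr_eq0; apply/eqP.
set d := ip w x - phi x in JL *.
have [x0|x0] := eqVneq (ip x x) 0.
  have := JL (- d); rewrite x0 mulr0 add0r => h.
  by apply/eqP; rewrite -sqrf_eq0 eq_le sqr_ge0 andbT; nra.
have xp : 0 < ip x x by rewrite lt_neqAle eq_sym x0 hip_ge0.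
have := JL (- d / ip x x).
rewrite (_ : _ + _ = - (d ^+ 2 / ip x x)); last by field.
rewrite oppr_ge0 pmulr_lle0 ?invr_gt0// => h.
by apply/eqP; rewrite -sqrf_eq0 eq_le sqr_ge0 andbT.
Qed.

Lemma riesz (phi : X -> R) :
  (forall (a : R) x y, phi (a *: x + y) = a * phi x + phi y) ->
  (exists C, forall x, `|phi x| <= C * nrm x) ->
  exists w, forall x, ip w x = phi x.
Proof.
move=> phiL phiC; have [|w _ wP] := @riesz_subspace setT phi _ phiL phiC; first by split.
by exists w => x; exact: wP.
Qed.

Lemma hip_ext x y : (forall z, ip x z = ip y z) -> x = y.
Proof.
move=> xy; apply/eqP; rewrite -subr_eq0; apply/eqP/(hip_eq0 hX).
by rewrite (hipDl hX) hipNl xy subrr.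
Qed.

(** Adjoints, convolutions and the products of a voice transform with an adjoint one are all built
    from their bilinear forms by this lemma. *)
Lemma form_operator (B : X -> X -> R) :
  (forall (a : R) x y z, B (a *: x + y) z = a * B x z + B y z) ->
  (forall (a : R) x y z, B z (a *: x + y) = a * B z x + B z y) ->
  (exists C, forall x y, `|B x y| <= C * (nrm x * nrm y)) ->
  exists2 T, bl T & forall x y, ip (T x) y = B x y.
Proof.
move=> Bl Br [C BC].
have /choice[T TP] : forall x, exists w, forall y, ip w y = B x y.
  move=> x; apply: riesz => //; exists (C * nrm x) => y; by rewrite -mulrA BC.
exists T => //; split=> [a x y|].
  by apply: hip_ext => z; rewrite TP Bl (hipDl hX) (hipZl hX) !TP.
exists `|C| => x; have := BC x (T x); rewrite -TP -hnorm_sqr.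
have [->|n0] := eqVneq (nrm (T x)) 0; first by rewrite mulr_ge0// hnorm_ge0.
have np : 0 < nrm (T x) by rewrite lt_neqAle eq_sym n0 hnorm_ge0.
rewrite ger0_norm ?sqr_ge0// expr2 mulrA ler_pM2r// => /le_trans; apply.
by rewrite ler_wpM2r ?hnorm_ge0// ler_norm.
Qed.

Lemma has_adjoint T : bl T -> exists2 T', bl T' & adjoint_pair ip T T'.
Proof.
move=> bT; have [|||T' bT' TP] := @form_operator (fun x y => ip x (T y)).
- by move=> a x y z; rewrite !hipE.
- by move=> a x y z; rewrite (blP bT) !hipE.
- have [C C0 TC] := bl_pos bT; exists C => x y.
  rewrite (le_trans (hcauchy_schwarz _ _))// mulrCA ler_wpM2l ?hnorm_ge0//.
by exists T' => // x y; rewrite (hipC hX x) TP (hipC hX).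
Qed.

Lemma adjoint_sym T T' : adjoint_pair ip T T' -> adjoint_pair ip T' T.
Proof. by move=> TT' x y; rewrite (hipC hX) -TT' (hipC hX). Qed.

Lemma adjoint_commuting T T' A : adjoint_pair ip T T' -> selfadj A ->
  commuting T A -> commuting T' A.
Proof.
move=> TT' sA TA x; apply: hip_ext => y.
by rewrite (adjoint_sym TT') sA -TA [RHS]sA (adjoint_sym TT').
Qed.

(** The last clause holds because W reduces T: T (P x) is in W, and its product with y in W is that
    of x with T' y, hence that of T x with y. It is how P enters bicommutants. *)
Lemma projection (W : set X) : closed_subspace_of W -> exists P,
  [/\ bl P, selfadj P, forall x, W (P x), forall x, W x -> P x = x &
   forall T T', bl T -> bl T' -> adjoint_pair ip T T' ->
    (forall x, W x -> W (T x)) -> (forall x, W x -> W (T' x)) -> commuting T P].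
Proof.
move=> cW; have [W0 WZD Wlim] := cW.
have WD x y : W x -> W y -> W (x + y).
  by move=> Wx Wy; rewrite -[x]scale1r; exact: WZD.
have WB x y : W x -> W y -> W (x - y).
  by move=> Wx Wy; rewrite addrC -scaleN1r; exact: WZD.
have /choice[P] : forall x, exists w, W w /\ forall y, W y -> ip w y = ip x y.
  move=> x; have [||w] := @riesz_subspace W (ip x) cW; last by move=> *; exists w.
  - by move=> a y z; rewrite !hipE.
  - by exists (nrm x) => y; exact: hcauchy_schwarz.
move=> /all_and2[WP PP].
have uniqP x w : W w -> (forall y, W y -> ip w y = ip x y) -> P x = w.
  move=> Ww wP; apply/eqP; rewrite -subr_eq0; apply/eqP/(hip_eq0 hX).
  have Wd := WB _ _ (WP x) Ww.
  by rewrite (hipDl hX) hipNl PP// wP// subrr.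
exists P; split=> //.
- split=> [a x y|].
    apply: uniqP; first exact: WZD.
    by move=> z Wz; rewrite !hipE !PP.
  exists 1 => x; rewrite mul1r.
  have [->|n0] := eqVneq (nrm (P x)) 0; first exact: hnorm_ge0.
  have np : 0 < nrm (P x) by rewrite lt_neqAle eq_sym n0 hnorm_ge0.
  by rewrite -(ler_pM2r np) -expr2 hnorm_sqr PP// hip_le.
- by move=> x y; rewrite (hipC hX (P x) y) -PP// (hipC hX) PP.
- by move=> x Wx; apply: uniqP.
move=> T T' bT bT' TT' WT WT' x; symmetry; apply: uniqP; first exact: WT.
by move=> y Wy; rewrite TT' PP ?TT'//; exact: WT'.
Qed.

(** A convergent numerical majorant of the increments gives a strong limit. Whatever commutes with
    all F n commutes with that limit, so limits of polynomials in an operator stay in its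
    bicommutant. *)
Lemma operator_limit (F : nat -> X -> X) (s : nat -> R) :
  (forall n, bl (F n)) -> (forall n, selfadj (F n)) ->
  (forall n x, nrm (F n.+1 x - F n x) <= (s n.+1 - s n) * nrm x) ->
  nondecreasing_seq s -> cvgn s -> exists2 F', bl F' /\ selfadj F' &
    (forall x, hlim (F ^~ x) (F' x)) /\
    forall T, bl T -> (forall n, commuting T (F n)) -> commuting T F'.
Proof.
move=> bF sF FF ds cs.
have /choice[F' lF] : forall x, exists y, hlim (F ^~ x) y.
  move=> x; have [||y] := @hsummable (fun k => F k.+1 x - F k x)
    (fun k => (s k.+1 - s k) * nrm x); [by []| |].
    rewrite (_ : series _ = fun n => (s n - s 0%N) * nrm x); last first.
      apply/funext => n; rewrite /series/= -mulr_suml; congr (_ * _).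
      by rewrite telescope_sumr.
    apply: is_cvgMl => //; apply: is_cvgB => //; exact: is_cvg_cst.
  move=> h; exists (y + F 0%N x).
  apply: (eq_hlim _ (hlimD h (hlim_cst (F 0%N x)))) => n.
  rewrite -(big_mkord xpredT (fun k => F k.+1 x - F k x)) telescope_sumr//.
  by rewrite subrK.
exists F'; split.
- split=> [a x y|].
    apply: (hlim_unique (lF _)).
    apply: (@eq_hlim (fun n => a *: F n x + F n y)) => [n|]; first by rewrite (blP (bF _)).
    apply: hlimD (lF y); exact: (hlim_bl (bl_scale a bl_id) (lF x)).
  have [C0 C00 FC] := bl_pos (bF 0%N).
  exists (C0 + (limn s - s 0%N)) => x.
  apply: (hlim_le (lF x)) => n.
  have sle : s n <= limn s by exact: nondecreasing_cvgn_le.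
  apply: (@le_trans _ _ ((C0 + (s n - s 0%N)) * nrm x)); last first.
    by rewrite ler_wpM2r ?hnorm_ge0// lerD2l lerD2r.
  elim: n {sle} => [|n ih]; first by rewrite subrr addr0.
  rewrite -[F n.+1 x](subrK (F n x)) (le_trans (hnormD _ _))//.
  have := FF n x; lra.
- move=> x y; have h1 := hlim_ip (y := y) (lF x); have h2 := hlim_ip (y := x) (lF y).
  have e : (fun n => ip (F n x) y) = (fun n => ip (F n y) x).
    by apply/funext => n; rewrite sF (hipC hX).
  by rewrite e in h1; rewrite (hipC hX x); exact: (cvg_unique _ h1 h2).
- by [].
- move=> T bT TF x; apply: (hlim_unique (hlim_bl bT (lF x))).
  by apply: (eq_hlim _ (lF (T x))) => n; rewrite /= TF.
Qed.

(* The increments of the recursion y_(n+1) = (1 + y_n^2) / 2 dominate those of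
   Y_(n+1) = (1 - A + Y_n^2) / 2, whose limit Y satisfies (1 - Y)^2 = A. *)
Fixpoint sqrt_iter_bound (n : nat) : R :=
  if n is n'.+1 then (1 + sqrt_iter_bound n' ^+ 2) / 2 else 0.

Fixpoint sqrt_iter (A : X -> X) (n : nat) : X -> X :=
  if n is n'.+1 then fun x => 2^-1 *: ((x - A x) + sqrt_iter A n' (sqrt_iter A n' x))
  else fun=> 0.

Lemma sqrt_iter_bound01 n : 0 <= sqrt_iter_bound n <= 1.
Proof.
elim: n => [|n /andP[h0 h1]] /=; first by rewrite lexx ler01.
have : sqrt_iter_bound n ^+ 2 <= 1 by rewrite expr_le1.
have := sqr_ge0 (sqrt_iter_bound n); lra.
Qed.

Lemma sqrt_iter_bound_nd : nondecreasing_seq sqrt_iter_bound.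
Proof.
apply/nondecreasing_seqP => n /=.
have := sqr_ge0 (1 - sqrt_iter_bound n); rewrite sqrrB; lra.
Qed.

Lemma operator_sqrt A : bl A -> selfadj A -> (forall x, nrm (x - A x) <= nrm x) ->
  exists2 Q, [/\ bl Q, selfadj Q & bicomm A Q] &
    (forall x, Q (Q x) = A x) /\ forall x, 0 <= ip (Q x) x.
Proof.
move=> bA sA A1; pose Y := sqrt_iter A; pose y := sqrt_iter_bound.
have bY n : bl (Y n).
  elim: n => [|n ih].
    by split=> [*|]; [rewrite /= scaler0 addr0|exists 0 => x; rewrite hnorm0 mul0r].
  by apply: bl_scale; apply: bl_add; [exact: (bl_sub bl_id)|exact: bl_comp].
have sY n : selfadj (Y n).
  elim: n => [|n ih] u v /=; first by rewrite !hipE.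
  by rewrite !hipE sA !ih.
have cY T : bl T -> commuting T A -> forall n, commuting T (Y n).
  move=> bT TA; elim=> [|n ih] x /=; first by rewrite (bl0 bT).
  by rewrite (blZ bT) (blD bT) (blB bT) TA !ih.
have nY n x : nrm (Y n x) <= y n * nrm x.
  elim: n x => [|n ih] x /=; first by rewrite hnorm0 mul0r.
  have /andP[y0 y1] := sqrt_iter_bound01 n.
  rewrite hnormZ ger0_norm ?invr_ge0// [leRHS]mulrAC [leRHS]mulrC ler_wpM2l ?invr_ge0//.
  rewrite (le_trans (hnormD _ _))// mulrDl mul1r lerD//.
  by rewrite (le_trans (ih _))// expr2 -mulrA ler_wpM2l.
have dY n x : nrm (Y n.+1 x - Y n x) <= (y n.+1 - y n) * nrm x.
  elim: n x => [|n ih] x.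
    rewrite /Y /y /= subr0 addr0 expr0n/= addr0 subr0 mul1r hnormZ.
    by rewrite ger0_norm ?invr_ge0// ler_wpM2l ?invr_ge0.
  (* The identity a^2 - b^2 = a (a - b) + (a - b) b needs no commutation. The same identity for the
     numbers y n yields the bound term by term. *)
  have -> : Y n.+2 x - Y n.+1 x = 2^-1 *: (Y n.+1 (Y n.+1 x - Y n x) +
      (Y n.+1 (Y n x) - Y n (Y n x))).
    rewrite (blB (bY _)) addrA subrK /= -/Y -scalerBr.
    by congr (_ *: _); rewrite opprD addrACA subrr add0r.
  have -> : y n.+2 - y n.+1 = 2^-1 * (y n.+1 * (y n.+1 - y n) + (y n.+1 - y n) * y n).
    by rewrite [y n.+2]/= [X in _ - X]/= -/y [y n.+1]/= -/y; field.
  rewrite hnormZ ger0_norm ?invr_ge0// -mulrA ler_wpM2l ?invr_ge0//.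
  rewrite (le_trans (hnormD _ _))// mulrDl lerD//.
    by rewrite (le_trans (nY _ _))// -mulrA ler_wpM2l//; case/andP: (sqrt_iter_bound01 n.+1).
  rewrite (le_trans (ih _))// -mulrA ler_wpM2l//.
  by rewrite subr_ge0; exact: sqrt_iter_bound_nd.
have cy : cvgn y.
  apply: nondecreasing_is_cvgn; first exact: sqrt_iter_bound_nd.
  by exists 1 => _ [n _ <-]; case/andP: (sqrt_iter_bound01 n).
have [Z [bZ sZ] [lZ cZ]] := operator_limit bY sY dY sqrt_iter_bound_nd cy.
have Z1 x : nrm (Z x) <= nrm x.
  apply: (hlim_le (lZ x)) => n; rewrite (le_trans (nY _ _))// ler_piMl ?hnorm_ge0//.
  by case/andP: (sqrt_iter_bound01 n).
have ZE x : Z x = 2^-1 *: ((x - A x) + Z (Z x)).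
  have l1 := hlim_shift (lZ x).
  apply: (hlim_unique l1).
  apply: (@hlim_bl _ (fun n => x - A x + Y n (Y n x)) _ (bl_scale 2^-1 bl_id)).
  apply: hlimD; first exact: hlim_cst.
  have l2 := hlim_bl bZ (lZ x).
  (* The square of a strongly convergent sequence: the first summand tends to 0 because the Y n are
     contractions. *)
  apply: (@eq_hlim (fun n => Y n (Y n x - Z x) + Y n (Z x))).
    by move=> n; rewrite (blB (bY n)) subrK.
  rewrite -[X in hlim _ X]add0r; apply: hlimD; last exact: lZ.
  apply: (@hlim_near (fun n => Y n x) (Z x) _ _ (lZ x)) => n.
  rewrite subr0 (le_trans (nY _ _))// ler_piMl ?hnorm_ge0//.
  by case/andP: (sqrt_iter_bound01 n).
exists (fun x => x - Z x); split.
- exact: bl_sub bl_id bZ.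
- by move=> u v; rewrite !hipE sZ.
- move=> T T' bT bT' _ TA x; rewrite (blB bT); congr (_ - _).
  by apply: cZ => // n; exact: cY.
- move=> x; rewrite (blB bZ).
  have /(congr1 (fun u => 2 *: u)) := ZE x.
  rewrite scalerA divff// scale1r => h.
  apply: hip_ext => z; have := congr1 (ip ^~ z) h; rewrite !hipE/=; lra.
- move=> x; rewrite (hipDl hX) hipNl -hnorm_sqr expr2 subr_ge0.
  by rewrite (le_trans (hip_le _ _))// ler_wpM2r ?hnorm_ge0.
Qed.

(** Neumann series: [F n] is the sum of the powers of 1 - A of exponent below n, with increments
    dominated by r^n. *)
Lemma operator_inv A (r : R) : bl A -> selfadj A -> 0 <= r < 1 ->
  (forall x, nrm (x - A x) <= r * nrm x) ->
  exists2 I, [/\ bl I, selfadj I & bicomm A I] &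
    (forall x, A (I x) = x) /\ (forall x, I (A x) = x).
Proof.
move=> bA sA /andP[r0 r1] Ar.
pose F := fix F n := if n is n'.+1 then fun x => x + (F n' x - A (F n' x)) else fun=> 0.
have bF n : bl (F n).
  elim: n => [|n ih].
    by split=> [*|]; [rewrite /= scaler0 addr0|exists 0 => x; rewrite hnorm0 mul0r].
  by apply: bl_add bl_id _; apply: bl_sub => //; exact: bl_comp.
have cF T : bl T -> commuting T A -> forall n, commuting T (F n).
  move=> bT TA; elim=> [|n ih] x /=; first by rewrite (bl0 bT).
  by rewrite (blD bT) (blB bT) TA !ih.
have sF n : selfadj (F n).
  elim: n => [|n ih] u v /=; first by rewrite !hipE.
  rewrite !hipE sA !ih; congr (_ + (_ - ip u _)).
  by rewrite -(cF A bA (fun=> erefl)).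
pose s := series (geometric 1 r).
have dF n x : nrm (F n.+1 x - F n x) <= (s n.+1 - s n) * nrm x.
  have -> : s n.+1 - s n = r ^+ n.
    by rewrite /s /series/= big_nat_recr//= addrAC subrr add0r mul1r.
  elim: n x => [|n ih] x; first by rewrite /= (bl0 bA) !subr0 addr0 expr0 mul1r.
  rewrite [F n.+2 x]/= [X in _ - X]/= -/F -!/(F n.+1 x).
  have -> : x + (F n.+1 x - A (F n.+1 x)) - (x + (F n x - A (F n x))) =
     (F n.+1 x - F n x) - A (F n.+1 x - F n x).
    rewrite (blB bA) opprD addrACA subrr add0r opprD !opprK !opprD ?opprK.
    by rewrite addrACA.
  by rewrite (le_trans (Ar _))// exprS -mulrA ler_wpM2l.
have ds : nondecreasing_seq s.
  by apply: nondecreasing_series => n _ _; rewrite /geometric/= mul1r exprn_ge0.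
have cs : cvgn s by apply: is_cvg_geometric_series; rewrite ger0_norm.
have [I [bI sI] [lI cI]] := operator_limit bF sF dF ds cs.
have AI x : A (I x) = x.
  have l1 := hlim_shift (lI x).
  have l2 : hlim (fun n => F n.+1 x) (x + (I x - A (I x))).
    apply: hlimD; first exact: hlim_cst.
    by have := hlim_bl (bl_sub bl_id bA) (lI x).
  have h := hlim_unique l1 l2; apply: hip_ext => z.
  have := congr1 (ip ^~ z) h; rewrite !hipE/=; lra.
exists I; split=> //.
  move=> T T' bT bT' _ TA x; apply: cI => // n; exact: cF.
move=> x; rewrite -[RHS]AI; symmetry; apply: cI => // n; exact: cF.
Qed.

Lemma coercive_scaling A (c : R) : bl A -> 0 < c ->
  (forall x, c * ip x x <= ip (A x) x) ->
  exists2 t : R, 0 < t & exists2 r, 0 <= r < 1 &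
    forall x, nrm (x - t *: A x) <= r * nrm x.
Proof.
move=> bA c0 Ac; have [C C0 AC] := bl_pos bA.
(* One has |x - t A x|^2 <= (1 - 2 t c + t^2 C^2) |x|^2, and for t = c / D the factor is at most 1 -
   c^2 / D. The summand c^2 of D keeps this number nonnegative without comparing c with C. *)
pose D := C ^+ 2 + c ^+ 2; have D0 : 0 < D by rewrite addr_gt0// exprn_gt0.
pose r2 := 1 - c ^+ 2 / D.
have r201 : 0 <= r2 < 1.
  rewrite subr_ge0 ler_pdivrMr// mul1r lerDr sqr_ge0/=.
  by rewrite ltrBlDr ltrDl divr_gt0// exprn_gt0.
exists (c / D); first by rewrite divr_gt0.
exists (Num.sqrt r2).
  rewrite sqrtr_ge0/= -[ltRHS]sqrtr1 ltr_sqrt//; lra.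
move=> x; rewrite -(@ler_pXn2r _ 2) ?nnegrE ?mulr_ge0 ?hnorm_ge0 ?sqrtr_ge0//.
rewrite exprMn (@sqr_sqrtr _ r2); last by case/andP: r201.
rewrite !hnorm_sqr !hipE (hipC hX x (A x)).
have h1 : ip (A x) (A x) <= C ^+ 2 * ip x x.
  rewrite -!hnorm_sqr -exprMn ler_pXn2r ?nnegrE ?mulr_ge0 ?hnorm_ge0//; exact: ltW.
have h2 := Ac x; set a := ip (A x) (A x) in h1 *; set b := ip (A x) x in h2 *.
set e := ip x x in h1 h2 *.
have e0 : 0 <= e by exact: hip_ge0.
have t0 : 0 < c / D by rewrite divr_gt0.
have : 2 * (c / D) * (c * e) <= 2 * (c / D) * b by rewrite ler_pM2l// mulr_gt0.
have : (c / D) ^+ 2 * a <= (c / D) ^+ 2 * (D * e).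
  rewrite ler_wpM2l ?sqr_ge0// (le_trans h1)// ler_wpM2r// /D lerDl sqr_ge0//.
rewrite /r2 (_ : (c / D) ^+ 2 * (D * e) = c ^+ 2 / D * e); last by field; rewrite gt_eqF.
rewrite (_ : 2 * (c / D) * (c * e) = 2 * (c ^+ 2 / D * e)); last by field; rewrite gt_eqF.
lra.
Qed.

Lemma operator_inv_sqrt A (c : R) : bl A -> selfadj A -> 0 < c ->
  (forall x, c * ip x x <= ip (A x) x) ->
  exists2 B, [/\ bl B, selfadj B & bicomm A B] & forall x, A (B (B x)) = x.
Proof.
move=> bA sA c0 Ac.
have [t t0 [r r01 Ar]] := coercive_scaling bA c0 Ac.
have stA : selfadj (fun x => t *: A x) by move=> u v; rewrite !hipE sA.
have [I [bI sI cI] [AI IA]] := operator_inv (bl_scale t bA) stA r01 Ar.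
have [C C0 AC] := bl_pos bA.
(* The inverse inherits coercivity: for x = t A w, <I x, x> = <w, t A w> >= t c |w|^2, and |w| >=
   |x| / (t C). *)
have Ic x : (t / (t * C) ^+ 2 * c) * ip x x <= ip (I x) x.
  have key w : (t / (t * C) ^+ 2 * c) * ip (t *: A w) (t *: A w) <= ip w (t *: A w).
    have h1 : ip (A w) (A w) <= C ^+ 2 * ip w w.
      rewrite -!hnorm_sqr -exprMn ler_pXn2r ?nnegrE ?mulr_ge0 ?hnorm_ge0//; exact: ltW.
    have h2 := Ac w; rewrite !hipE (hipC hX w).
    set a := ip (A w) (A w) in h1 *; set b := ip (A w) w in h2 *.
    have -> : t / (t * C) ^+ 2 * c * (t * (t * a)) = t * (c * (a / C ^+ 2)).
      by field; rewrite !gt_eqF.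
    rewrite ler_pM2l// (le_trans _ h2)// ler_pM2l//.
    by rewrite ler_pdivrMr ?exprn_gt0// mulrC.
  by have := key (I x); rewrite AI.
have c'0 : 0 < t / (t * C) ^+ 2 * c by rewrite !mulr_gt0// invr_gt0 exprn_gt0// mulr_gt0.
have [u u0 [q /andP[q0 q1] Iq]] := coercive_scaling bI c'0 Ic.
have suI : selfadj (fun x => u *: I x) by move=> v w; rewrite !hipE sI.
have [|Q [bQ sQ cQ] [QQ _]] := operator_sqrt (bl_scale u bI) suI.
  by move=> x; rewrite (le_trans (Iq x))// ler_piMl ?hnorm_ge0 ?ltW.
(* Since Q^2 = u I and t A I = 1, the operator A (d Q)^2 is multiplication by d^2 u / t. *)
pose d := Num.sqrt (t / u).
exists (fun x => d *: Q x); first split.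
- exact: bl_scale.
- by move=> v w; rewrite !hipE sQ.
- move=> T T' bT bT' TT' TA x; rewrite (blZ bT); congr (_ *: _).
  apply: (cQ T T') => // z; rewrite (blZ bT); congr (_ *: _).
  by apply: (cI T T') => // w; rewrite (blZ bT) TA.
move=> x; have dd : d * d = t / u by rewrite -expr2 sqr_sqrtr// divr_ge0 ?ltW.
by rewrite (blZ bQ) QQ !(blZ bA) !scalerA dd -[in RHS](AI x) mulrAC -mulrA mulfV ?mulr1 ?gt_eqF.
Qed.

(** A substitute for the spectral projection of S on the values at least [lam], obtained from the
    square root of (S - lam)^2 alone. The two inequalities are what the resolution below uses of
    it. *)
Lemma spectral_projection S (lam : R) : bl S -> selfadj S ->
  exists2 E, [/\ bl E, selfadj E & bicomm S E] &
    [/\ forall x, E (E x) = E x, forall x, lam * ip (E x) (E x) <= ip (S (E x)) (E x) &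
        forall x, E x = 0 -> ip (S x) x <= lam * ip x x].
Proof.
move=> bS sS; have [M ME] : exists M : X -> X, forall x, M x = S x - lam *: x by exists (fun x => S x - lam *: x).
have bM : bl M by rewrite (funext ME); apply: bl_sub => //; exact: bl_scale bl_id.
have sM : selfadj M by move=> u v; rewrite !ME !hipE sS.
have [C C0 MC] := bl_pos bM; pose t := (C ^+ 2)^-1.
have t0 : 0 < t by rewrite invr_gt0 exprn_gt0.
have sMM : selfadj (fun x => t *: M (M x)) by move=> u v; rewrite !hipE !sM.
have [|Q [bQ sQ cQ] [QQ Q0]] :=
    operator_sqrt (bl_scale t (bl_comp bM bM)) sMM.
  move=> x; rewrite -(@ler_pXn2r _ 2) ?nnegrE ?hnorm_ge0// !hnorm_sqr/= !hipE.
  have e1 : ip (M (M x)) x = ip (M x) (M x) by rewrite sM.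
  have e2 : ip (M (M x)) (M (M x)) <= C ^+ 2 * ip (M x) (M x).
    by rewrite -!hnorm_sqr -exprMn ler_pXn2r ?nnegrE ?mulr_ge0 ?hnorm_ge0 ?(ltW C0).
  have := hip_ge0 hX (M x); set a := ip (M x) (M x) in e1 e2 *.
  rewrite (hipC hX x) e1 => a0.
  have : t * (t * ip (M (M x)) (M (M x))) <= t * a.
    by rewrite ler_pM2l// /t mulrC ler_pdivrMr ?exprn_gt0// mulrC.
  have : 0 <= t * a by rewrite mulr_ge0// ltW.
  lra.
(* Q is |S - lam| up to the positive factor u, so E is the projection on the
   kernel of the negative part of S - lam. *)
pose u := C^-1.
have u0 : 0 < u by rewrite invr_gt0.
have utE : u * u = t by rewrite /u /t expr2 invfM.
pose W : set X := [set x | Q x = u *: M x].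
have cW : closed_subspace_of W.
  split.
  - by rewrite /W/= (bl0 bQ) (bl0 bM) scaler0.
  - move=> a x y; rewrite /W/= => Wx Wy.
    by rewrite (blP bQ) (blP bM) Wx Wy scalerDr !scalerA mulrC.
  - move=> v l Wv vl; have l1 := hlim_bl bQ vl.
    have l2 := hlim_bl (bl_scale u bM) vl.
    by apply: (hlim_unique l1); apply: eq_hlim l2 => k /=; rewrite Wv.
have [E [bE sE WE EW cE]] := projection cW.
have MQ : commuting M Q.
  apply: (cQ M M) => // x; by rewrite (blZ bM).
(* Q commutes with M and Q^2 = u^2 M^2, so Q (Q + u M) = u M (Q + u M): up to a factor, the positive
   part of M takes its values in W. *)
have Erange x : W (Q x + u *: M x).
  rewrite /W/= (blD bQ) (blZ bQ) (blD bM) (blZ bM) QQ MQ scalerDr scalerA utE.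
  by rewrite addrC.
exists E; first split => //.
  move=> T T' bT bT' TT' TS.
  have TM A : bl A -> commuting A S -> commuting A M.
    by move=> bA AS x; rewrite !ME (blB bA) (blZ bA) AS.
  have T'S := adjoint_commuting TT' sS TS.
  have TQ A A' : bl A -> bl A' -> adjoint_pair ip A A' -> commuting A S -> commuting A Q.
    move=> bA bA' AA' AS; apply: (cQ A A') => // x.
    by rewrite (blZ bA) /= (TM A bA AS) (TM A bA AS).
  apply: (cE T T') => // x; rewrite /W/= => Wx.
    by rewrite -(TQ T T')// Wx (blZ bT) TM.
  by rewrite -(TQ T' T bT' bT (adjoint_sym TT') T'S) Wx (blZ bT') TM.
split.
- by move=> x; apply: EW.
- move=> x; have := Q0 (E x); have := WE x; rewrite {1}/W/= => -> .
  rewrite ME !hipE pmulr_rge0//; lra.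
- move=> x Ex0.
  (* x is orthogonal to W, and Q + u M is selfadjoint with range in W, so (Q + u M) x is orthogonal
     to itself. Then u <M x, x> = - <Q x, x> <= 0. *)
  have : Q x + u *: M x = 0.
    apply: (hip_eq0 hX).
    have := sE x (Q x + u *: M x); rewrite Ex0 hip0l EW// => h.
    rewrite (hipDl hX) sQ (hipZl hX) sM.
    have Wz := Erange (Q x + u *: M x).
    set z := Q x + u *: M x in h Wz *.
    have := sE x (Q z + u *: M z); rewrite Ex0 hip0l EW// hipDr hipZr => ->.
    by [].
  move=> /(congr1 (ip ^~ x)); rewrite /= ME !hipE => h.
  have := Q0 x; have := h; nra.
Qed.

(* E k projects on the part of S above 1 / (k + 1), and F k is the product of the
   1 - E j for j < k; the ranges of Pk k = E k F k are orthogonal, S^(-1/2) is bounded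
   on each of them, and B k is the resulting operator S^(-1/2) Pk k. *)
Lemma spectral_resolution S P : bl S -> selfadj S -> (forall x, 0 <= ip (S x) x) ->
  bl P -> selfadj P -> commuting P S ->
  (forall x, P x = x -> ip (S x) x = 0 -> x = 0) ->
  exists B : nat -> X -> X,
    [/\ forall k, [/\ bl (B k), selfadj (B k) & bicomm S (B k)],
        forall k l x, k != l -> B k (B l x) = 0 &
        forall x, P x = x ->
          \sum_(k < n) ip (S (B k x)) (B k x) @[n --> \oo] --> ip x x].
Proof.
move=> bS sS S0 bP sP PS S_inj; pose lam (k : nat) : R := k.+1%:R^-1.
have /choice[E /all_and2[]] : forall k, exists E,
    [/\ bl E, selfadj E & bicomm S E] /\
    [/\ forall x, E (E x) = E x, forall x, lam k * ip (E x) (E x) <= ip (S (E x)) (E x) &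
        forall x, E x = 0 -> ip (S x) x <= lam k * ip x x].
  by move=> k; have [E h1 h2] := spectral_projection (lam k) bS sS; exists E.
move=> /all_and3[bE sE cE] /all_and3[EE Elo Ehi].
have SS : commuting S S by [].
have ES k : commuting (E k) S by move=> x; rewrite (cE k S S).
have EEc k l : commuting (E k) (E l) by apply: (cE l (E k) (E k)).
pose F := fix F n : X -> X := if n is n'.+1 then fun x => F n' x - E n' (F n' x) else id.
have bF n : bl (F n).
  by elim: n => [|n ih]; [exact: bl_id|apply: bl_sub => //; exact: bl_comp].
have cF T T' : bl T -> bl T' -> adjoint_pair ip T T' -> commuting T S ->
    forall n, commuting T (F n).
  move=> bT bT' TT' TS; elim=> [//|n ih] x /=.
  by rewrite (blB bT) ih (cE n T T') ?ih.
have FE n k : commuting (E k) (F n) by apply: (cF (E k) (E k)).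
have sF n : selfadj (F n).
  elim: n => [//|n ih] u v /=; rewrite !hipE sE !ih; congr (_ + - ip u _).
  by rewrite FE.
have FF n x : F n (F n x) = F n x.
  elim: n x => [//|n ih] x /=.
  by rewrite (blB (bF n)) ih -FE ih (blB (bE n)) EE subrr subr0.
have EF k n x : (k < n)%N -> E k (F n x) = 0.
  elim: n => [//|n ih] /=; rewrite ltnS leq_eqVlt => /orP[/eqP->|kn].
    by rewrite (blB (bE n)) EE subrr.
  by rewrite (blB (bE k)) EEc (ih kn) (bl0 (bE n)) subrr.
pose Pk k x := E k (F k x).
have PkPl k l x : k != l -> Pk k (Pk l x) = 0.
  rewrite /Pk neq_ltn => /orP[kl|lk].
    by rewrite -(FE k l) EEc (FE k k (F l x)) (EF k l x kl) (bl0 (bF k)) (bl0 (bE l)).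
  by rewrite -(FE k l) EF// (bl0 (bE k)).
have PkPk k x : Pk k (Pk k x) = Pk k x by rewrite /Pk -(FE k k) EE FF.
have bPk k : bl (Pk k) by exact: bl_comp.
have sPk k : selfadj (Pk k) by move=> u v; rewrite /Pk sE sF FE.
have cPk k : bicomm S (Pk k).
  by move=> T T' bT bT' TT' TS x; rewrite /Pk (cE k T T')// (cF T T').
(* S is replaced by the identity off the range of [Pk k], which makes it coercive on the whole
   space; since [lam k] <= 1, it is a lower bound for both parts. *)
pose A k x := S (Pk k x) + (x - Pk k x).
have lam0 k : 0 < lam k by rewrite invr_gt0.
have lam1 k : lam k <= 1 by rewrite invf_le1// ler1n.
have bA k : bl (A k).
  by apply: bl_add; [exact: bl_comp|exact: bl_sub bl_id _].
have PkS k : commuting (Pk k) S by move=> x; rewrite (cPk k S S).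
have sA k : selfadj (A k).
  by move=> u v; rewrite /A !hipE sS !sPk -PkS.
have Ac k x : lam k * ip x x <= ip (A k x) x.
  have e1 : ip (Pk k x) x = ip (Pk k x) (Pk k x) by rewrite -{1}PkPk sPk.
  have e2 : ip (S (Pk k x)) x = ip (S (Pk k x)) (Pk k x).
    by rewrite -{1}PkPk -PkS sPk.
  rewrite /A !hipE e1 e2.
  have := Elo k (F k x); rewrite -/(Pk k x).
  have := hip_ge0 hX (x - Pk k x); rewrite !hipE (hipC hX x) e1.
  have := lam1 k; have := lam0 k; have := hip_ge0 hX (Pk k x).
  set a := ip (Pk _ _) _; set b := ip (S _) _; set c := ip x x; nra.
have /choice[D /all_and2[/all_and3[bD sD cD] AD]] : forall k, exists D,
    [/\ bl D, selfadj D & bicomm (A k) D] /\ forall x, A k (D (D x)) = x.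
  by move=> k; have [D h1 h2] := operator_inv_sqrt (bA k) (sA k) (lam0 k) (Ac k); exists D.
have cAD T T' : bl T -> bl T' -> adjoint_pair ip T T' -> commuting T S ->
    forall k, commuting T (D k).
  move=> bT bT' TT' TS k; apply: (cD k T T') => // x.
  by rewrite /A (blD bT) (blB bT) TS (cPk k T T').
have PkD k l : commuting (Pk k) (D l) by apply: (cAD (Pk k) (Pk k)).
exists (fun k x => D k (Pk k x)); split.
- move=> k; split; first exact: bl_comp.
    by move=> u v; rewrite sD sPk PkD.
  by move=> T T' bT bT' TT' TS x; rewrite (cAD T T')// (cPk k T T').
- by move=> k l x kl; rewrite PkD PkPl// !(bl0 (bD _)).
move=> x Px.
(* [D k] preserves the range of [Pk k], where [A k] is S, so S (D k)^2 is the identity there. The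
   sum of these terms then telescopes to <x, x> - <F n x, x>. *)
have BE k : ip (S (D k (Pk k x))) (D k (Pk k x)) = ip (Pk k x) x.
  have -> : S (D k (Pk k x)) = A k (D k (Pk k x)).
    by rewrite /A (PkD k k) PkPk subrr addr0.
  rewrite -sD -(cD k (A k) (A k))// AD.
  by rewrite -sPk PkPk.
have sumE n : \sum_(k < n) ip (Pk k x) x = ip x x - ip (F n x) x.
  elim: n => [|n ih]; first by rewrite big_ord0 subrr.
  by rewrite big_ord_recr/= ih /Pk !hipE; lra.
rewrite (_ : (fun n => \sum_(k < n) _) = (fun n => ip x x - ip (F n x) x)); last first.
  by apply/funext => n; rewrite -sumE; apply: eq_bigr => k _; rewrite BE.
have FnE n : ip (F n x) x = ip (F n x) (F n x) by rewrite -{1}FF sF.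
rewrite -[X in _ --> X](subr0 (ip x x)); apply: cvgB; first exact: cvg_cst.
have Fnd n : ip (F n.+1 x) x <= ip (F n x) x.
  rewrite /= (hipDl hX) hipNl gerDl oppr_le0 -[E n (F n x)]/(Pk n x).
  by rewrite -PkPk sPk hip_ge0.
have Fnd' : nonincreasing_seq (fun n => ip (F n x) x).
  exact/nonincreasing_seqP.
have Flb : has_lbound (range (fun n => ip (F n x) x)).
  by exists 0 => _ [n _ <-]; rewrite FnE hip_ge0.
have cvF := nonincreasing_is_cvgn Fnd' Flb.
set L := limn (fun n => ip (F n x) x) in cvF.
have Lle n : L <= ip (F n x) x by exact: nonincreasing_cvgn_ge.
(* The F n are decreasing projections, so |F n x - F m x|^2 is the decrement of <F n x, x> from m to
   n. *)
have [] := @hip_complete _ _ _ hX (fun n => F n x) (fun n => Num.sqrt (ip (F n x) x - L)).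
- have h : ip (F n x) x - L @[n --> \oo] --> L - L by apply: cvgB => //; exact: cvg_cst.
  have h2 := @continuous_cvg _ _ _ _ _ _ _ (L - L) (@sqrt_continuous R _) h.
  by rewrite subrr sqrtr0 in h2; exact: h2.
- move=> m n mn; rewrite /hnorm ler_sqrt ?subr_ge0//.
  have -> : ip (F n x - F m x) (F n x - F m x) = ip (F m x) x - ip (F n x) x.
    have FnFm : F n (F m x) = F n x.
      rewrite -(subnK mn); elim: (n - m)%N => [|d ih]; first by rewrite add0n FF.
      by rewrite addSn /= ih.
    rewrite !hipE -!FnE.
    have e : ip (F n x) (F m x) = ip (F n x) x by rewrite sF FnFm (hipC hX).
    by rewrite (hipC hX (F m x)) e; lra.
  by rewrite lerD2l lerN2.
move=> f Ff.
have Pf : P f = f.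
  apply: (hlim_unique (hlim_bl bP Ff)); apply: eq_hlim Ff => n /=.
  by rewrite (cF P P)// Px.
(* F (n + 1) x is killed by [E n], so <S F x, F x> <= |x|^2 / (n + 1) for F = F (n + 1), whence the
   index shift in the comparison. In the limit <S f, f> = 0, and f is fixed by P, so injectivity
   applies. *)
have f0 : f = 0.
  apply: S_inj => //; apply/le_anti; rewrite S0 andbT.
  have h1 : ip (S (F n x)) (F n x) @[n --> \oo] --> ip (S f) f.
    have h3 : ip (S (F n x - f)) (F n x - f) @[n --> \oo] --> (0:R).
      have [C C0 SC] := bl_pos bS.
      have h4 : C * (nrm (F n x - f) * nrm (F n x - f)) @[n --> \oo] --> (0:R).
        rewrite [X in _ --> X](_ : _ = C * (0 * 0)); last by rewrite !mulr0.
        by apply: cvgMr; apply: cvgM; exact: Ff.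
      apply: (@squeeze_cvgr _ _ _ _ (fun=> 0) _ _ _ _ _ h4); last exact: cvg_cst.
      apply: nearW => n; rewrite S0/= (le_trans (hip_le _ _))// mulrA.
      by rewrite ler_wpM2r ?hnorm_ge0.
    have h5 := hlim_ip (y := S f) Ff.
    have h6 : ip (S (F n x - f)) (F n x - f) + 2 * ip (F n x) (S f) - ip (S f) f
       @[n --> \oo] --> 0 + 2 * ip f (S f) - ip (S f) f.
      by apply: cvgB; [apply: cvgD => //; exact: cvgMr|exact: cvg_cst].
    have e : ip (S f) f = 0 + 2 * ip f (S f) - ip (S f) f.
      by rewrite (hipC hX f); lra.
    rewrite [X in _ --> X]e; apply: cvg_trans h6; apply: near_eq_cvg.
    by apply: nearW => n; rewrite (blB bS) !hipE (sS (F n x) f) (hipC hX (S f) (F n x)); lra.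
  have h2 : lam n * ip x x @[n --> \oo] --> (0 : R).
    by rewrite -(mul0r (ip x x)); apply: cvgMl; exact: cvg_harmonic.
  apply: (ler_cvg_to (cvg_comp _ _ (cvg_addnr 1) h1) h2); apply: nearW => n.
  have := Ehi n (F n.+1 x) (EF n n.+1 x (ltnSn n)).
  rewrite /= addn1 => /le_trans; apply; rewrite ler_pM2l//.
  by have := FnE n.+1; rewrite /= => <-; apply: (Fnd' 0%N n.+1).
have := hlim_norm2 Ff; rewrite f0 hip0l.
by rewrite (_ : (fun n => _) = (fun n => ip (F n x) x))//; apply/funext => n; rewrite FnE.
Qed.

End hilbert_theory.

(** * Uniqueness of Haar measure *)

(** Reduced to the measurability of [powR], with x^2 as a nonnegative base; both sides vanish at
    0. *)
Lemma measurable_invr (R : realType) : measurable_fun setT (fun x : R => x^-1).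
Proof.
have -> : (fun x : R => x^-1) = (fun x => x * (x ^+ 2) `^ (-1)).
  apply/funext => x; rewrite powR_inv1 ?sqr_ge0// expr2 invfM mulrA.
  by have [->|x0] := eqVneq x 0; [rewrite invr0 !mul0r|rewrite divff// mul1r].
apply: measurable_funM => //; apply: measurableT_comp (measurable_powR _) _.
exact: measurable_funX.
Qed.

Section haar_uniqueness.
Context d (T : measurableType d) (R : realType).
Variables (D : set T) (mul : T -> T -> T) (inv : T -> T).

(** The laws are asked on D only, while [mul] and [inv] are measurable on the whole type: a subgroup
    of the affine Weyl-Heisenberg group sits in an ambient space of tuples on which the formulas
    make sense but are not a group law. *)
Record measurable_group : Prop := {
  mg_dom : measurable D;
  mg_mul : measurable_fun setT (fun p : T * T => mul p.1 p.2);
  mg_inv : measurable_fun setT inv;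
  mg_closM : forall x y, D x -> D y -> D (mul x y);
  mg_closV : forall x, D x -> D (inv x);
  mg_mulK : forall x y, D x -> D y -> mul (inv x) (mul x y) = y;
  mg_invK : forall x, D x -> inv (inv x) = x;
  mg_invM : forall x y, D x -> D y -> inv (mul x y) = mul (inv y) (inv x) }.

Definition left_invariant (m : set T -> \bar R) := m (~` D) = 0%E /\
  forall g, D g -> forall A, measurable A -> m (mul g @^-1` A) = m A.

Hypothesis mg : measurable_group.

Local Open Scope ereal_scope.

Lemma integral_eq_on (m : {measure set T -> \bar R}) (f g : T -> \bar R) :
  m (~` D) = 0 -> measurable_fun setT f -> measurable_fun setT g ->
  (forall x, 0 <= f x) -> (forall x, 0 <= g x) -> (forall x, D x -> f x = g x) ->
  \int[m]_x f x = \int[m]_x g x.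
Proof.
move=> mD0 mf mg' f0 g0 fg; apply: ge0_ae_eq_integral => //.
exists (~` D); split => //; first by apply: measurableC; exact: mg_dom mg.
by move=> x /= h Dx; apply: h => _; exact: fg.
Qed.

Lemma measurable_mul2 d' (T' : measurableType d') (f g : T' -> T) :
  measurable_fun setT f -> measurable_fun setT g ->
  measurable_fun setT (fun x => mul (f x) (g x)).
Proof.
by move=> mf mG; exact: (measurableT_comp (mg_mul mg) (measurable_fun_pair mf mG)).
Qed.

Lemma measurable_mull x : measurable_fun setT (mul x).
Proof. by apply: (@measurable_mul2 _ _ (fun=> x) id). Qed.

Lemma integral_left_invariant (m : {measure set T -> \bar R}) g (f : T -> \bar R) :
  left_invariant m -> D g -> measurable_fun setT f -> (forall x, 0 <= f x) ->
  \int[m]_x f (mul g x) = \int[m]_x f x.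
Proof.
move=> [_ lm] Dg mf f0.
have := @ge0_integral_pushforward _ _ _ _ R (mul g) (measurable_mull g) m setT f measurableT mf (fun x _ => f0 x).
rewrite preimage_setT => <-.
by apply: eq_measure_integral => [|mm A mA _]; [exact: measurable_mull|exact: lm].
Qed.

(** Both sides are the double integral of 1_B(x) g(y^-1 x). Translating y by x in nu gives the left
    side; after Tonelli, translating x by y in mu gives the right side. On the left mu enters
    through [mu B] alone, which is what makes two Haar measures comparable. *)
Lemma haar_exchange (mu nu : {sigma_finite_measure set T -> \bar R}) B (g : T -> \bar R) :
  left_invariant mu -> left_invariant nu -> measurable B ->
  measurable_fun setT g -> (forall x, 0 <= g x) ->
  mu B * \int[nu]_y g (inv y) =
  \int[mu]_x (g x * \int[nu]_y (\1_B (mul y x))%:E).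
Proof.
move=> lmu lnu mB mG g0.
have mgi : measurable_fun setT (g \o inv) by apply: measurableT_comp => //; exact: mg_inv mg.
have mu0 := lmu.1; have nu0 := lnu.1.
have m1B : measurable_fun setT (fun x => (\1_B x)%:E : \bar R).
  by apply/measurable_EFinP; exact: measurable_indic.
pose F (p : T * T) := (\1_B p.1)%:E * g (mul (inv p.2) p.1).
have mF : measurable_fun setT F.
  apply: emeasurable_funM; first exact: measurableT_comp m1B measurable_fst.
  apply: measurableT_comp => //.
  apply: measurable_mul2 measurable_fst.
  exact: measurableT_comp (mg_inv mg) measurable_snd.
have F0 p : 0 <= F p by apply: mule_ge0 => //; rewrite lee_fin.
pose G (p : T * T) := g p.1 * (\1_B (mul p.2 p.1))%:E.
have mG' : measurable_fun setT G.
  apply: emeasurable_funM; first exact: measurableT_comp mG measurable_fst.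
  apply: (measurableT_comp m1B).
  exact: measurable_mul2 measurable_snd measurable_fst.
have G0 p : 0 <= G p by apply: mule_ge0 => //; rewrite lee_fin.
have sec_l (H : T * T -> \bar R) x : measurable_fun setT H -> measurable_fun setT (fun y => H (x, y)).
  by move=> mH; apply: measurableT_comp mH _.
have sec_r (H : T * T -> \bar R) y : measurable_fun setT H -> measurable_fun setT (fun x => H (x, y)).
  by move=> mH; apply: measurableT_comp mH _.
transitivity (\int[mu]_x \int[nu]_y F (x, y)).
  rewrite -[X in mu X]setIT -integral_indic// muleC -ge0_integralZl//; last first.
    by apply: integral_ge0.
  apply: integral_eq_on => //.
  - by apply: emeasurable_funM.
  - exact: measurable_fun_fubini_tonelli_F.
  - by move=> x; apply: mule_ge0; [exact: integral_ge0|rewrite lee_fin].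
  - by move=> x; exact: integral_ge0.
  move=> x Dx; rewrite muleC.
  transitivity ((\1_B x)%:E * \int[nu]_y (g \o inv) (mul (inv x) y)).
    by rewrite (integral_left_invariant lnu (mg_closV mg Dx))//= => y; exact: g0.
  have mh : measurable_fun setT (fun y => (g \o inv) (mul (inv x) y)).
    exact: (measurableT_comp mgi (measurable_mull (inv x))).
  have B0 : 0 <= (\1_B x)%:E :> \bar R by rewrite lee_fin.
  rewrite -(@ge0_integralZl _ _ _ nu setT measurableT _ mh _ (fun y _ => g0 _) B0).
  apply: integral_eq_on => //.
  - apply: (emeasurable_funM (measurable_cst ((\1_B x)%:E))).
    exact: mh.
  - exact: sec_l.
  - by move=> y; apply: mule_ge0; rewrite ?lee_fin//=.
  - move=> y Dy; rewrite /F/= (mg_invM mg) ?(mg_invK mg)//; exact: (mg_closV mg).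
rewrite fubini_tonelli//.
transitivity (\int[nu]_y \int[mu]_x G (x, y)).
  apply: integral_eq_on => //.
  - exact: measurable_fun_fubini_tonelli_G.
  - exact: measurable_fun_fubini_tonelli_G.
  - by move=> y; exact: integral_ge0.
  - by move=> y; exact: integral_ge0.
  move=> y Dy.
  rewrite -(integral_left_invariant lmu Dy (sec_r F y mF))//.
  apply: integral_eq_on => //.
  - by apply: measurableT_comp (sec_r F y mF) _; exact: measurable_mull.
  - exact: sec_r.
  - by move=> x Dx; rewrite /F /G/= (mg_mulK mg)// muleC.
rewrite -fubini_tonelli//; apply: eq_integral => x _.
rewrite /G/=; apply: ge0_integralZl => //.
have mr : measurable_fun setT (mul ^~ x) by apply: (@measurable_mul2 _ _ id (fun=> x)).
exact: (measurableT_comp m1B mr).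
Qed.

Lemma integral_indic_mul0 (m : {measure set T -> \bar R}) E (h : T -> \bar R) :
  measurable E -> m E = 0 -> measurable_fun setT h -> (forall x, 0 <= h x) ->
  \int[m]_x ((\1_E x)%:E * h x) = 0.
Proof.
move=> mE E0 mh h0; rewrite -[RHS](@integral0 _ _ _ m setT).
apply: ge0_ae_eq_integral => //.
- apply: emeasurable_funM => //.
  by apply/measurable_EFinP; exact: measurable_indic.
- by move=> x _; apply: mule_ge0 => //; rewrite lee_fin.
exists E; split => // x /= /not_implyP[_]; rewrite indicE.
by case: (boolP (x \in E)) => [|_]; rewrite ?inE// mul0e.
Qed.

(** For x in D this is nu (B x^-1), the weight on the right of [haar_exchange]. *)
Definition right_conv (nu : set T -> \bar R) B x := \int[nu]_y (\1_B (mul y x))%:E.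

Lemma right_conv_ge0 (nu : {measure set T -> \bar R}) B x : 0 <= right_conv nu B x.
Proof. by apply: integral_ge0 => y _; rewrite lee_fin. Qed.

Lemma measurable_right_conv (nu : {sigma_finite_measure set T -> \bar R}) B :
  measurable B -> measurable_fun setT (right_conv nu B).
Proof.
move=> mB; apply: (@measurable_fun_fubini_tonelli_F _ _ _ _ _ nu (fun p => (\1_B (mul p.2 p.1))%:E)).
- apply/measurable_EFinP; apply: measurableT_comp; first exact: measurable_indic.
  exact: measurable_mul2 measurable_snd measurable_fst.
- by move=> p; rewrite lee_fin.
Qed.

(** This is [haar_exchange] with mu twice, the whole space for B and the indicator of E for g: the
    right side is an integral over a null set. *)
Lemma left_invariant_inv0 (mu : {sigma_finite_measure set T -> \bar R}) E :
  left_invariant mu -> measurable E -> mu E = 0 -> mu (inv @^-1` E) = 0.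
Proof.
move=> lmu mE E0.
have mEi : measurable (inv @^-1` E) by rewrite -[X in measurable X]setTI; exact: (mg_inv mg).
have [muT|muT] := eqVneq (mu setT) 0.
  by apply/eqP; rewrite -measure_le0 -muT le_measure// inE.
have m1E : measurable_fun setT (fun x => (\1_E x)%:E : \bar R).
  by apply/measurable_EFinP; exact: measurable_indic.
have : mu setT * \int[mu]_y (\1_E (inv y))%:E = 0.
  rewrite (haar_exchange lmu lmu measurableT m1E) => [|x]; last by rewrite lee_fin.
  apply: (integral_indic_mul0 (h := right_conv mu setT)) => //.
    exact: measurable_right_conv.
  by move=> x; exact: right_conv_ge0.
move/eqP; rewrite mule_eq0 (negbTE muT)/= => /eqP.
by rewrite [X in X = _ -> _](@integral_indic _ _ _ mu setT measurableT (inv @^-1` E))// setIT.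
Qed.

Lemma left_invariant_inv0' (mu : {sigma_finite_measure set T -> \bar R}) E :
  left_invariant mu -> measurable E -> mu (inv @^-1` E) = 0 -> mu E = 0.
Proof.
move=> lmu mE Ei0.
have mi C : measurable C -> measurable (inv @^-1` C).
  by move=> mC; rewrite -[X in measurable X]setTI; exact: (mg_inv mg).
have mD : measurable (~` D) by apply: measurableC; exact: mg_dom mg.
apply: (@subset_measure0 _ _ _ _ _ (inv @^-1` (inv @^-1` E) `|` ~` D)) => //.
- by apply: measurableU => //; exact/mi/mi.
- move=> x Ex; have [Dx|] := pselect (D x); last by right.
  by left; rewrite /= (mg_invK mg).
apply/eqP; rewrite -measure_le0 (le_trans (measureU2 _ _ _))//; first exact/mi/mi.
rewrite [X in X + _](_ : _ = 0); last exact: left_invariant_inv0 lmu (mi _ mE) Ei0.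
by rewrite [X in _ + X](_ : _ = 0) ?adde0//; exact: lmu.1.
Qed.

(** Let k(x) = nu (B x^-1) and g = 1_A / k. Then [haar_exchange] for (mu, nu) and for (nu, nu)
    expresses mu A and nu A as [mu B] and [nu B] times one and the same integral. It remains to see
    that k is positive and finite almost everywhere for both measures. *)
Lemma haar_unique (mu nu : {sigma_finite_measure set T -> \bar R}) :
  left_invariant mu -> left_invariant nu -> nu setT != 0 -> exists B,
  [/\ measurable B, mu B < +oo, nu B != 0, nu B < +oo &
      forall A, measurable A -> nu B * mu A = mu B * nu A].
Proof.
move=> lmu lnu nuT.
have [F FT /all_and2[mF Foo]] := sigma_finiteT mu.
have [G GT /all_and2[mG Goo]] := sigma_finiteT nu.
have [[i j] nuFG] : exists ij : nat * nat, nu (F ij.1 `&` G ij.2) != 0.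
  apply/not_existsP => h; move/eqP : nuT; apply.
  apply/negligibleP => //; rewrite (_ : setT = \bigcup_i \bigcup_j (F i `&` G j)).
    apply: negligible_bigcup => i; apply: negligible_bigcup => j.
    apply/negligibleP; first exact: measurableI.
    by apply/eqP; move: (h (i, j)) => /negP; rewrite negbK.
  rewrite -[LHS]setIT {1}FT GT; apply/seteqP; split => x.
    by move=> [[i _ Fi] [j _ Gj]]; exists i => //; exists j.
  by move=> [i _ [j _ [Fi Gj]]]; split; [exists i|exists j].
set B := F i `&` G j in nuFG; rewrite /= in B nuFG.
have mB : measurable B by exact: measurableI.
have muB : mu B < +oo by apply: le_lt_trans (Foo i); apply: le_measure; rewrite ?inE//; exact: subIsetl.
have nuB : nu B < +oo by apply: le_lt_trans (Goo j); apply: le_measure; rewrite ?inE//; exact: subIsetr.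
exists B; split=> // A mA.
have m1 (C : set T) : measurable C -> measurable_fun setT (fun x => (\1_C x)%:E : \bar R).
  by move=> mC; apply/measurable_EFinP; exact: measurable_indic.
have p1 (C : set T) x : 0 <= (\1_C x)%:E :> \bar R by rewrite lee_fin.
have mi (C : set T) : measurable C -> measurable (inv @^-1` C).
  by move=> mC; rewrite -[X in measurable X]setTI; exact: (mg_inv mg).
pose k := right_conv nu B.
have mk : measurable_fun setT k by exact: measurable_right_conv.
have k0 x : 0 <= k x by exact: right_conv_ge0.
have int1 (m : {measure set T -> \bar R}) (C : set T) : measurable C ->
    \int[m]_x (\1_C x)%:E = m C.
  by move=> mC; rewrite integral_indic// setIT.
(* Exchange mu and nu in [haar_exchange], with g the indicator of E: the integral over the nu-null
   set E vanishes, so the inverse of E is mu-null. *)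
have ac E : measurable E -> nu E = 0 -> mu E = 0.
  move=> mE nuE; have := haar_exchange lnu lmu mB (m1 _ mE) (p1 E).
  rewrite (integral_indic_mul0 (h := right_conv mu B) mE nuE); last 2 first.
  - exact: measurable_right_conv.
  - by move=> x; exact: right_conv_ge0.
  move=> /eqP; rewrite mule_eq0 (negbTE nuFG)/= => /eqP.
  by rewrite (int1 mu (inv @^-1` E) (mi _ mE)) => /(left_invariant_inv0' lmu mE).
have mk1 (y : \bar R) : measurable (k @^-1` [set y]).
  by rewrite -[X in measurable X]setTI; exact: mk.
have N0 : nu (k @^-1` [set 0]) = 0.
  apply: (left_invariant_inv0' lnu) => //.
  have := haar_exchange lnu lnu mB (m1 _ (mk1 0)) (p1 (k @^-1` [set 0])).
  rewrite (int1 nu (inv @^-1` _) (mi _ (mk1 0))) [X in _ = X -> _]integral0_eq; last first.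
    move=> x _; rewrite indicE; case: (boolP (x \in _)) => [|_]; last by rewrite mul0e.
    by rewrite inE/= => kx; rewrite [X in _ * X](_ : _ = k x)// kx mule0.
  by move=> /eqP; rewrite mule_eq0 (negbTE nuFG)/= => /eqP.
(* The integral of k over the inverse of G l is nu B times at most nu (G l), hence finite, and these
   sets cover the space. *)
have Noo : nu (k @^-1` [set +oo]) = 0.
  apply/negligibleP => //.
  rewrite (_ : _ @^-1` _ = \bigcup_l (k @^-1` [set +oo] `&` inv @^-1` G l)); last first.
    rewrite -setI_bigcupr -preimage_bigcup -GT preimage_setT setIT//.
  apply: negligible_bigcup => l.
  have mE := mi _ (mG l).
  have h := haar_exchange lnu lnu mB (m1 _ mE) (p1 (inv @^-1` G l)).
  have fi : nu.-integrable setT (fun x => (\1_(inv @^-1` G l) x)%:E * k x).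
    apply/integrableP; split; first exact: emeasurable_funM (m1 _ mE) mk.
    under eq_integral do rewrite gee0_abs ?mule_ge0//.
    rewrite -h (int1 nu (inv @^-1` (inv @^-1` G l)) (mi _ mE)).
    apply: lte_mul_pinfty => //; first by rewrite ge0_fin_numE.
    apply: le_lt_trans (Goo l); apply: (@le_trans _ _ (nu (G l `|` ~` D))).
      apply: le_measure; rewrite ?inE//.
      - exact: mi.
      - by apply: measurableU => //; apply: measurableC; exact: mg_dom mg.
      - move=> x /= Gx; have [Dx|] := pselect (D x); last by right.
        by left; rewrite -(mg_invK mg Dx).
    rewrite (le_trans (measureU2 _ _ _))//; first by apply: measurableC; exact: mg_dom mg.
    by rewrite [X in _ + X](_ : _ = 0) ?adde0//; exact: lnu.1.
  apply: negligibleS (integrable_ae measurableT fi) => x [/= kx Gx] /(_ I).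
  by rewrite indicE mem_set// mul1e kx.
pose g x := (\1_A x * (fine (k x)) `^ (-1))%:E.
have mg' : measurable_fun setT g.
  apply/measurable_EFinP/measurable_funM; first exact: measurable_indic.
  apply: measurableT_comp (measurable_powR _) _.
  exact: measurableT_comp (fine_measurable measurableT) mk.
have g0 x : 0 <= g x by rewrite lee_fin mulr_ge0 ?powR_ge0.
have gk (m : {measure set T -> \bar R}) : m (k @^-1` [set 0] `|` k @^-1` [set +oo]) = 0 ->
    \int[m]_x (g x * k x) = m A.
  move=> mN; rewrite -(int1 m A)//; apply: ge0_ae_eq_integral => //.
  - exact: emeasurable_funM.
  - exact: m1.
  - by move=> x _; apply: mule_ge0.
  - exists (k @^-1` [set 0] `|` k @^-1` [set +oo]); split => //.
      exact: measurableU.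
    move=> x /= /not_implyP[_] h.
    have [kx0|kx0] := eqVneq (k x) 0; first by left.
    have [kxo|kxo] := eqVneq (k x) +oo; first by right.
    exfalso; apply: h; rewrite /g.
    have kf : k x \is a fin_num by rewrite ge0_fin_numE// lt_neqAle kxo leey.
    rewrite powR_inv1 ?fine_ge0// -{2}(fineK kf) -EFinM -mulrA mulVf ?mulr1//.
    by rewrite fine_eq0.
have nuN : nu (k @^-1` [set 0] `|` k @^-1` [set +oo]) = 0.
  apply/eqP; rewrite -measure_le0 (le_trans (measureU2 _ _ _))//.
  by rewrite [X in X + _](_ : _ = 0)// [X in _ + X](_ : _ = 0)// adde0.
have muN : mu (k @^-1` [set 0] `|` k @^-1` [set +oo]) = 0.
  by apply: ac => //; exact: measurableU.
have := haar_exchange lmu lnu mB mg' g0; rewrite [X in _ = X -> _](gk mu muN) => <-.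
have := haar_exchange lnu lnu mB mg' g0; rewrite [X in _ = X -> _](gk nu nuN) => <-.
by rewrite muleCA.
Qed.

End haar_uniqueness.

(** * Borel sets of products and matrix spaces *)

HB.instance Definition _ (T U : ptopologicalType) := Pointed.on (T * U)%type.

Section borel_measurability.
Variable R : realType.

Definition countable_base (T : topologicalType) (C : nat -> set T) :=
  (forall i, open (C i)) /\
  forall O x, open O -> O x -> exists i, C i x /\ C i `<=` O.

Definition second_countable_space (T : topologicalType) :=
  exists C, @countable_base T C.

Lemma countable_base_index (T : topologicalType) (I : countType) (C : I -> set T) :
  (forall i, open (C i)) ->
  (forall O x, open O -> O x -> exists i, C i x /\ C i `<=` O) ->
  second_countable_space T.
Proof.
move=> oC bC; exists (fun k => if unpickle k is Some i then C i else set0); split.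
  by move=> k; case: (unpickle k) => [i|]; [exact: oC|exact: open0].
move=> O x oO Ox; have [i [Cx CO]] := bC O x oO Ox.
by exists (pickle i); rewrite pickleK.
Qed.

Lemma second_countable_real : second_countable_space R.
Proof.
apply: (@countable_base_index _ (rat * rat)%type (fun q => ball (ratr q.1 : R) (ratr q.2))).
  by move=> i; exact: ball_open.
move=> O x oO Ox.
have /nbhs_ballP[e /= e0 eO] : nbhs x O by exact: open_nbhs_nbhs.
have /rat_in_itvoo[q /itvP qe] : 0 < e / 2 by rewrite divr_gt0.
have q0 : 0 < ratr q :> R by rewrite qe.
have /rat_in_itvoo[s /itvP sq] : x < x + ratr q by rewrite ltrDl.
have xs : ball x (ratr q) (ratr s : R).
  rewrite /ball/= distrC ger0_norm ?subr_ge0 ?sq//.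
  by rewrite ltrBlDl sq.
exists (s, q); split => /=; first exact: ball_sym.
move=> y sy; apply: eO; have := ball_triangle xs sy; rewrite /ball/= => /lt_trans; apply.
by rewrite [ltRHS]splitr ltrD// qe.
Qed.

Lemma open_setX (T U : topologicalType) (A : set T) (B : set U) :
  open A -> open B -> open (A `*` B).
Proof.
move=> oA oB; rewrite openE => -[x y] /= [Ax By]; exists (A, B) => //=.
by split; exact: open_nbhs_nbhs.
Qed.

Lemma second_countable_prod (T U : topologicalType) :
  second_countable_space T -> second_countable_space U ->
  second_countable_space (T * U)%type.
Proof.
move=> [C [oC bC]] [C' [oC' bC']].
apply: (@countable_base_index _ (nat * nat)%type (fun k => C k.1 `*` C' k.2)).
  by move=> k; exact: open_setX.
move=> O [x y] oO Oxy.
have [[P Q] /= [nP nQ] PQO] : nbhs (x, y) O by exact: open_nbhs_nbhs.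
move: nP nQ; rewrite !nbhsE => -[P' [oP' P'x] P'P] [Q' [oQ' Q'y] Q'Q].
have [i [Cx CP]] := bC _ _ oP' P'x; have [j [Cy CQ]] := bC' _ _ oQ' Q'y.
exists (i, j); split => // -[a b] [/= Ca Cb]; apply: PQO.
by split; [exact/P'P/CP|exact/Q'Q/CQ].
Qed.

Lemma second_countable_mx m n : second_countable_space 'M[R]_(m, n).
Proof.
have [C [oC bC]] := second_countable_real.
apply: (@countable_base_index _ 'M[nat]_(m, n) (fun k => [set N : 'M[R]_(m, n) | forall i j, C (k i j) (N i j)])).
  move=> k; rewrite openE => N /= kN; exists (fun i j => C (k i j)) => //.
  by move=> i j; exact: open_nbhs_nbhs.
move=> O N oO ON.
have [P nP PO] : nbhs N O by exact: open_nbhs_nbhs.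
have /choice[k kP] : forall ij : 'I_m * 'I_n, exists k, C k (N ij.1 ij.2) /\ C k `<=` P ij.1 ij.2.
  move=> [i j]; have := nP i j; rewrite nbhsE => -[Q [oQ Qx] QP].
  have [l [lx lQ]] := bC _ _ oQ Qx; exists l; split=> //.
  exact: subset_trans lQ QP.
exists (\matrix_(i, j) k (i, j)); split.
  by move=> i j; rewrite mxE; exact: (kP (i, j)).1.
by move=> M CM; apply: PO => i j; have := CM i j; rewrite mxE; exact: (kP (i, j)).2.
Qed.

Lemma normc_le_add (a b : R) : Normc.normc (Complex a b) <= `|a| + `|b|.
Proof.
rewrite /Normc.normc -(@ler_pXn2r _ 2) ?nnegrE ?addr_ge0// sqr_sqrtr ?addr_ge0 ?sqr_ge0//.
rewrite sqrrD !real_normK ?num_real// -addrA lerD2l lerDr.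
by rewrite mulrn_wge0// mulr_ge0.
Qed.

Lemma Re_le_normc (z : R[i]) : `|complex.Re z| <= Normc.normc z.
Proof.
case: z => a b /=; rewrite -(@ler_pXn2r _ 2) ?nnegrE ?sqrtr_ge0// sqr_sqrtr ?addr_ge0 ?sqr_ge0//.
by rewrite real_normK ?num_real// lerDl sqr_ge0.
Qed.

Lemma Im_le_normc (z : R[i]) : `|complex.Im z| <= Normc.normc z.
Proof.
case: z => a b /=; rewrite -(@ler_pXn2r _ 2) ?nnegrE ?sqrtr_ge0// sqr_sqrtr ?addr_ge0 ?sqr_ge0//.
by rewrite real_normK ?num_real// lerDr sqr_ge0.
Qed.

(** The norm of [R[i]^o] has values in [R[i]], so the radii of its balls are complex numbers; this
    replaces them by real ones. *)
Lemma nbhs_complexP (z : R[i]^o) (A : set R[i]^o) : nbhs z A <->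
  exists2 e : R, 0 < e & forall w, Normc.normc (z - w) < e -> A w.
Proof.
split.
  move=> /nbhs_ballP[[e e'] /=]; rewrite ltcE/= => /andP[/eqP e'0 e0] eA.
  exists e => // w zw; apply: eA; rewrite /ball/= ltcE/= e'0 eqxx/=.
  exact: zw.
move=> [e e0 eA]; apply/nbhs_ballP; exists (real_complex R e) => /=.
  by rewrite ltcE/= eqxx.
by move=> w; rewrite /ball/= ltcE/= eqxx/= => zw; exact: eA.
Qed.

Lemma continuous_Re : continuous (fun z : R[i]^o => complex.Re z : R).
Proof.
move=> z A /nbhs_ballP[e /= e0 eA]; apply/nbhs_complexP; exists e => // w zw.
apply: eA; rewrite /ball/=; apply: le_lt_trans zw.
by have := Re_le_normc (z - w); case: (z) (w) => a b [].
Qed.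

Lemma continuous_Im : continuous (fun z : R[i]^o => complex.Im z : R).
Proof.
move=> z A /nbhs_ballP[e /= e0 eA]; apply/nbhs_complexP; exists e => // w zw.
apply: eA; rewrite /ball/=; apply: le_lt_trans zw.
by have := Im_le_normc (z - w); case: (z) (w) => a b [].
Qed.

Lemma continuous_Complex : continuous (fun p : R * R => Complex p.1 p.2 : R[i]^o).
Proof.
move=> [a b] A /nbhs_complexP[e /= e0 eA].
exists (ball a (e / 2), ball b (e / 2)) => /=.
  by split; apply: nbhsx_ballx; rewrite divr_gt0.
move=> [c d] /= [ac bd]; apply: eA; apply: le_lt_trans (normc_le_add _ _) _.
by rewrite [ltRHS]splitr ltrD.
Qed.

Lemma second_countable_complex : second_countable_space R[i]^o.
Proof.
have [C [oC bC]] := second_countable_real.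
apply: (@countable_base_index _ (nat * nat)%type
   (fun k => [set z : R[i]^o | C k.1 (complex.Re z) /\ C k.2 (complex.Im z)])).
  move=> k; apply: openI.
    by apply: open_comp (oC k.1) => z _; exact: continuous_Re.
  by apply: open_comp (oC k.2) => z _; exact: continuous_Im.
move=> O z oO Oz.
have /nbhs_complexP[e e0 eO] : nbhs z O by exact: open_nbhs_nbhs.
have bx (x : R) : ball x (e / 2) x by apply: ballxx; rewrite divr_gt0.
have [i [Ci CiO]] := bC _ _ (ball_open (complex.Re z) _) (bx _).
have [j [Cj CjO]] := bC _ _ (ball_open (complex.Im z) _) (bx _).
exists (i, j); split => // w [/= /CiO h1 /CjO h2]; apply: eO.
case: z w h1 h2 {Oz Ci Cj CiO CjO} => a b [c d] h1 h2.
by apply: le_lt_trans (normc_le_add _ _) _; rewrite [ltRHS]splitr ltrD.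
Qed.

Lemma measurable_to_borel d (X : measurableType d) (T : ptopologicalType) C (f : X -> borel T) :
  countable_base C -> (forall i, measurable (f @^-1` (C i : set T))) -> measurable_fun setT f.
Proof.
move=> [oC bC] mC.
apply: (@measurability _ _ _ _ setT f (@open T) erefl).
move=> _ /= [A oA <-]; rewrite setTI.
have -> : A = \bigcup_(i in [set i | C i `<=` A]) C i.
  apply/seteqP; split=> [x Ax|x [i /= CA]]; last exact: CA.
  by have [i [Cx CA]] := bC _ _ oA Ax; exists i.
rewrite preimage_bigcup bigcup_mkcond; apply: bigcupT_measurable => i.
by case: ifPn.
Qed.

Lemma continuous_borel (T U : ptopologicalType) (f : borel T -> borel U) :
  continuous (f : T -> U) -> measurable_fun setT f.
Proof.
move=> cf; apply: (@measurability _ _ _ _ setT f (@open U) erefl).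
move=> _ /= [A oA <-]; rewrite setTI; apply: sub_sigma_algebra.
by apply: open_comp oA => x _; exact: cf.
Qed.

(** The type R carries its own measurable structure besides [borel R]; both are generated by open
    sets, so they give the same measurable functions. *)
Lemma borel_realP d (X : measurableType d) (f : X -> R) :
  measurable_fun setT (f : X -> borel R) <-> measurable_fun setT f.
Proof.
split=> mf.
  apply: (@measurability _ _ _ _ setT f _ (RGenOpens.measurableE R)).
  move=> _ /= [A [x [y ->]] <-]; apply: mf => //.
  by apply: sub_sigma_algebra; exact: interval_open.
apply: (@measurability _ _ _ _ setT (f : X -> borel R) (@open R) erefl).
by move=> _ /= [A oA <-]; apply: mf => //; exact: open_measurable.
Qed.

Lemma continuous_borel_real (T : ptopologicalType) (f : borel T -> R) :
  continuous (f : T -> R) -> measurable_fun setT f.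
Proof.
move=> cf; apply/borel_realP; exact: (@continuous_borel T R f cf).
Qed.

(** Second countability makes every open set of the product a countable union of boxes, so that the
    Borel sets of T * U are no more than the product sigma-algebra. *)
Lemma measurable_pair_borel d (X : measurableType d) (T U : ptopologicalType)
    (f : X -> borel T) (g : X -> borel U) :
  second_countable_space T -> second_countable_space U ->
  measurable_fun setT f -> measurable_fun setT g ->
  @measurable_fun _ _ X (borel (T * U)%type) setT (fun x => (f x, g x)).
Proof.
move=> [C [oC bC]] [C' [oC' bC']] mf mg.
pose D k : set (T * U)%type := if unpickle k is Some (i, j) then C i `*` C' j else set0.
apply: (@measurable_to_borel _ _ (T * U)%type D).
  split=> [k|]; first by rewrite /D; case: unpickle => [[i j]|]; [exact: open_setX|exact: open0].
  move=> O [x y] oO Oxy.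
  have [[P Q] /= [nP nQ] PQO] : nbhs (x, y) O by exact: open_nbhs_nbhs.
  move: nP nQ; rewrite !nbhsE => -[P' [oP' P'x] P'P] [Q' [oQ' Q'y] Q'Q].
  have [i [Cx CP]] := bC _ _ oP' P'x; have [j [Cy CQ]] := bC' _ _ oQ' Q'y.
  exists (pickle (i, j)); rewrite /D pickleK; split => // -[a b] [/= Ca Cb]; apply: PQO.
  by split; [exact/P'P/CP|exact/Q'Q/CQ].
move=> k; rewrite /D; case: unpickle => [[i j]|]; last by rewrite preimage_set0.
rewrite (_ : _ @^-1` _ = (f @^-1` C i) `&` (g @^-1` C' j))//.
by apply: measurableI; rewrite -[X in measurable X]setTI; [apply: mf|apply: mg] => //;
  apply: sub_sigma_algebra.
Qed.

Lemma measurable_mx_borelP d (X : measurableType d) m n (f : X -> borel 'M[R]_(m, n)) :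
  measurable_fun setT f <-> forall i j, measurable_fun setT (fun x => f x i j).
Proof.
split=> [mf i j|mf].
  have mc : measurable_fun setT (fun M : borel 'M[R]_(m, n) => M i j).
    by apply: continuous_borel_real; exact: coord_continuous.
  exact: (measurableT_comp mc mf).
apply: (@measurability _ _ _ _ setT f (@open 'M[R]_(m, n)) erefl).
move=> _ /= [A oA <-]; rewrite setTI.
have [C [oC bC]] := second_countable_real.
pose B (k : 'M[nat]_(m, n)) := [set N : 'M[R]_(m, n) | forall i j, C (k i j) (N i j)].
have -> : A = \bigcup_(k in [set k | B k `<=` A]) B k.
  apply/seteqP; split=> [N AN|x [k /= CA]]; last exact: CA.
  have [P nP PO] : nbhs N A by exact: open_nbhs_nbhs.
  have /choice[k kP] : forall ij : 'I_m * 'I_n, exists k, C k (N ij.1 ij.2) /\ C k `<=` P ij.1 ij.2.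
    move=> [i j]; have := nP i j; rewrite nbhsE => -[Q [oQ Qx] QP].
    have [l [lx lQ]] := bC _ _ oQ Qx; exists l; split=> //.
    exact: subset_trans lQ QP.
  exists (\matrix_(i, j) k (i, j)).
    by move=> M CM; apply: PO => i j; have := CM i j; rewrite mxE; exact: (kP (i, j)).2.
  by move=> i j; rewrite mxE; exact: (kP (i, j)).1.
rewrite preimage_bigcup bigcup_mkcond; apply: countable_bigcupT_measurable => // k.
case: ifPn => // _.
have -> : f @^-1` B k = \bigcap_i \bigcap_j ((fun x => f x i j) @^-1` C (k i j)).
  by apply/seteqP; split => x /= h; [move=> i _ j _; exact: h|move=> i j; exact: h].
apply: fin_bigcap_measurable => // i _; apply: fin_bigcap_measurable => // j _.
by rewrite -[X in measurable X]setTI; apply: mf => //; exact: open_measurable.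
Qed.

Lemma measurable_complex_borelP d (X : measurableType d) (f : X -> borel R[i]^o) :
  measurable_fun setT f <-> measurable_fun setT (fun x => complex.Re (f x)) /\
    measurable_fun setT (fun x => complex.Im (f x)).
Proof.
split=> [mf|[mR mI]].
  have mRe : measurable_fun setT (fun z : borel R[i]^o => complex.Re z).
    exact: continuous_borel_real continuous_Re.
  have mIm : measurable_fun setT (fun z : borel R[i]^o => complex.Im z).
    exact: continuous_borel_real continuous_Im.
  by split; [exact: (measurableT_comp mRe mf)|exact: (measurableT_comp mIm mf)].
have mC := @continuous_borel (R * R)%type R[i]^o _ continuous_Complex.
have mP : @measurable_fun _ _ X (borel (R * R)%type) setT (fun x => (complex.Re (f x), complex.Im (f x))).
  by apply: measurable_pair_borel; try exact: second_countable_real; exact/borel_realP.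
have := measurableT_comp mC mP; congr measurable_fun.
by apply/funext => x /=; case: (f x).
Qed.

End borel_measurability.

(** * Lebesgue measure under affine maps *)

Lemma pushforward_measure d (T : measurableType d) d' (T' : measurableType d')
    (R : realType) (m : {measure set T -> \bar R}) (phi : T -> T') :
  measurable_fun setT phi ->
  exists m' : {measure set T' -> \bar R}, forall A, m' A = m (phi @^-1` A).
Proof.
move=> mphi; pose nu A := m (phi @^-1` A).
have nu0 : nu set0 = 0%E by rewrite /nu preimage_set0 measure0.
have nu_ge0 A : (0 <= nu A)%E by exact: measure_ge0.
have nu_add : semi_sigma_additive nu.
  move=> F mF tF mUF; rewrite /nu preimage_bigcup.
  have mpF i : measurable (phi @^-1` F i) by rewrite -[X in measurable X]setTI; exact: mphi.
  apply: measure_semi_sigma_additive => //; last exact: bigcup_measurable.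
  apply/trivIsetP => /= i j _ _ ij; rewrite -preimage_setI.
  by move/trivIsetP : tF => /(_ _ _ _ _ ij) ->//; rewrite preimage_set0.
by exists (HB.pack nu (isMeasure.Build _ _ _ nu nu0 nu_ge0 nu_add) : {measure set T' -> \bar R}).
Qed.

(** Haar measure and pushforwards come as plain measures; this repackages a proof of
    sigma-finiteness as the structure that [haar_unique] takes. *)
Lemma as_sigma_finite_measure d (T : measurableType d) (R : realType)
    (m : {measure set T -> \bar R}) : sigma_finite setT m ->
  exists m' : {sigma_finite_measure set T -> \bar R}, m' = m :> (set T -> \bar R).
Proof.
move=> sf.
have : forall f : set T -> \bar R, f = m -> exists m' : {sigma_finite_measure set T -> \bar R}, m' = f :> (set T -> \bar R).
  move=> f fm.
  have f0 : f set0 = 0%E by rewrite fm measure0.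
  have f_ge0 A : (0 <= f A)%E by rewrite fm; exact: measure_ge0.
  have f_add : semi_sigma_additive f by rewrite fm; exact: measure_semi_sigma_additive.
  have f_sf : sigma_finite setT f by rewrite fm.
  pose m1 : {measure set T -> \bar R} := HB.pack f (isMeasure.Build _ _ _ f f0 f_ge0 f_add).
  by exists (HB.pack f (isMeasure.Build _ _ _ f f0 f_ge0 f_add)
    (Measure_isSigmaFinite.Build _ _ _ m1 f_sf) : {sigma_finite_measure set T -> \bar R}).
by move=> /(_ m erefl).
Qed.

Lemma ereal_cross_mul (R : realType) (x y a b : \bar R) : x \is a fin_num -> x != 0%E ->
  y \is a fin_num -> (x * a = y * b -> a = (fine y / fine x)%:E * b)%E.
Proof.
case: x => // x _; rewrite eqe => x0; case: y => // y _ /= h.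
have := congr1 (mule x^-1%:E) h.
by rewrite !muleA -!EFinM mulVf// mul1e [(x^-1 * y)%R]mulrC.
Qed.

Section lebesgue_affine_line.
Variable R : realType.
Local Notation mu := (@lebesgue_measure R).

(** The measure |a| mu(preimage of A) agrees with mu on half-open intervals. For negative a the
    preimage is closed at the other end, which does not affect its length. *)
Lemma lebesgue_measure_affine (a s : R) (A : set R) : a != 0 -> measurable A ->
  (mu ((fun t => a * t + s)%R @^-1` A) = (`|a|^-1)%:E * mu A)%E.
Proof.
move=> a0 mA.
have maff : measurable_fun setT (fun t : measurableTypeR R => a * t + s : measurableTypeR R).
  by apply: measurable_funD => //; exact: measurable_funM.
have anp : 0 <= `|a| by [].
have [nu0 nu0E] := pushforward_measure mu maff.
pose nu : {measure set (measurableTypeR R) -> \bar R} := mscale (NngNum anp) nu0.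
have nuE B : nu B = (`|a|%:E * mu ((fun t => a * t + s)%R @^-1` B))%E.
  by rewrite /nu/= /mscale/= nu0E.
suff -> : mu A = nu A.
  by rewrite nuE muleA -EFinM mulVf ?normr_eq0// mul1e.
apply: lebesgue_measure_unique => // _ [[x y] _ <-] /=.
rewrite nuE.
have [a_gt0|a_lt0|] := ltgtP 0 a; last by move=> e; move: a0; rewrite -e eqxx.
  have -> : (fun t => a * t + s) @^-1` `]x, y] = `](x - s) / a, (y - s) / a]%classic.
    apply/seteqP; split => t /=; rewrite !in_itv/= -ltrBlDr -lerBrDr.
      by rewrite ltr_pdivrMr// ler_pdivlMr// mulrC.
    by rewrite ltr_pdivrMr// ler_pdivlMr// mulrC.
  rewrite !lebesgue_measure_itv/= !lte_fin gtr0_norm//.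
  rewrite ltr_pM2r ?invr_gt0// ltrD2r.
  case: ifP => _; last by rewrite mule0.
  by rewrite -!EFinB -EFinM; congr (_%:E); field.
have -> : (fun t => a * t + s) @^-1` `]x, y] = `[(y - s) / a, (x - s) / a[%classic.
  apply/seteqP; split => t /=; rewrite !in_itv/= -ltrBlDr -lerBrDr.
    by rewrite ltr_ndivlMr// ler_ndivrMr// andbC mulrC.
  by rewrite ltr_ndivlMr// ler_ndivrMr// andbC mulrC.
rewrite !lebesgue_measure_itv/= !lte_fin ltr0_norm//.
rewrite ltr_nM2r ?invr_lt0// ltrD2r.
case: ifP => _; last by rewrite mule0.
by rewrite -!EFinB -EFinM; congr (_%:E); field.
Qed.

End lebesgue_affine_line.

Lemma scaled_measure_integral d (T : measurableType d) d' (T' : measurableType d')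
    (R : realType) (m : {measure set T -> \bar R}) (m' : {measure set T' -> \bar R})
    (phi : T -> T') (c : R) (f : T' -> \bar R) : 0 <= c ->
  measurable_fun setT phi ->
  (forall A, measurable A -> m (phi @^-1` A) = (c%:E * m' A)%E) ->
  measurable_fun setT f -> (forall x, (0 <= f x)%E) ->
  (\int[m]_x f (phi x) = c%:E * \int[m']_x f x)%E.
Proof.
move=> c0 mphi mE mf f0.
rewrite -(@ge0_integral_mscale _ _ _ m' setT measurableT (NngNum c0) f)//.
have := @ge0_integral_pushforward _ _ _ _ R phi mphi m setT f measurableT mf (fun x _ => f0 x).
rewrite preimage_setT => <-.
by apply: eq_measure_integral => A mA _; rewrite /= /mscale/= -mE.
Qed.

Section leb_affine.
Variable R : realType.
Local Notation Rn n := (borel 'cV[R]_n).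

Lemma consv_0 n (t : R) (x : 'cV[R]_n) j : @consv R n t x (lshift n (ord0 : 'I_1)) j = t.
Proof. by rewrite (ord1 j) /consv (@col_mxEu _ 1 n) !mxE eqxx mulr1n. Qed.

Lemma consv_S n (t : R) (x : 'cV[R]_n) (i : 'I_n) j : @consv R n t x (rshift 1 i) j = x i j.
Proof. by rewrite /consv (@col_mxEd _ 1 n). Qed.

Lemma measurable_consv n d (T : measurableType d) (f : T -> R) (g : T -> Rn n) :
  measurable_fun setT f -> measurable_fun setT g ->
  measurable_fun setT (fun x => consv (f x) (g x) : Rn n.+1).
Proof.
move=> mf mg; apply/measurable_mx_borelP => i j.
rewrite -(@splitK 1 n i); case: (fintype.split (i : 'I_(1 + n))) => k /=.
  by rewrite ord1; under eq_fun do rewrite consv_0.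
by under eq_fun do rewrite consv_S; have := (measurable_mx_borelP g).1 mg k j.
Qed.

Lemma measurable_mulmx_fun d (T : measurableType d) m n p (f : T -> borel 'M[R]_(m, n))
    (g : T -> borel 'M[R]_(n, p)) : measurable_fun setT f -> measurable_fun setT g ->
  measurable_fun setT (fun x => f x *m g x : borel 'M[R]_(m, p)).
Proof.
move=> /measurable_mx_borelP mf /measurable_mx_borelP mg; apply/measurable_mx_borelP => i j.
under eq_fun do rewrite mxE; apply: measurable_sum => k.
exact: measurable_funM.
Qed.

Lemma measurable_addmx_fun d (T : measurableType d) m n (f g : T -> borel 'M[R]_(m, n)) :
  measurable_fun setT f -> measurable_fun setT g ->
  measurable_fun setT (fun x => f x + g x : borel 'M[R]_(m, n)).
Proof.
move=> /measurable_mx_borelP mf /measurable_mx_borelP mg; apply/measurable_mx_borelP => i j.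
by under eq_fun do rewrite mxE; exact: measurable_funD.
Qed.

Lemma measurable_oppmx_fun d (T : measurableType d) m n (f : T -> borel 'M[R]_(m, n)) :
  measurable_fun setT f -> measurable_fun setT (fun x => - f x : borel 'M[R]_(m, n)).
Proof.
move=> /measurable_mx_borelP mf; apply/measurable_mx_borelP => i j.
by under eq_fun do rewrite mxE; exact: measurableT_comp.
Qed.

Lemma measurable_affine n (h : 'M[R]_n) (a : 'cV[R]_n) :
  measurable_fun setT (fun x : Rn n => h *m x + a : Rn n).
Proof.
apply: (measurable_addmx_fun (f := fun x : Rn n => h *m x : Rn n) (g := fun=> a)) => //.
by apply: (@measurable_mulmx_fun _ _ _ _ _ (fun=> h) id).
Qed.

Lemma measurable_preimage_fun d d' (T : measurableType d) (T' : measurableType d') (f : T -> T') A :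
  measurable_fun setT f -> measurable A -> measurable (f @^-1` A).
Proof. by move=> mf mA; rewrite -[X in measurable X]setTI; exact: mf. Qed.

Lemma measurable_leb_section n (A : set (Rn n.+1)) : measurable A ->
  measurable_fun setT (fun t : R => leb [set x : Rn n | A (consv t x)]).
Proof.
move=> mA; have mA' : measurable ((fun p : R * Rn n => consv p.1 p.2 : Rn n.+1) @^-1` A).
  by apply: measurable_preimage_fun => //; exact: measurable_consv.
have := measurable_fun_xsection (@leb R n) mA'.
congr measurable_fun; apply/funext => t /=; congr leb.
by apply/seteqP; split => x; rewrite /xsection /= inE.
Qed.

Lemma measurable_section n (A : set (Rn n.+1)) t : measurable A ->
  measurable ([set x | A (consv t x)] : set (Rn n)).
Proof.
move=> mA; apply: (@measurable_preimage_fun _ _ _ _ (fun x : Rn n => consv t x : Rn n.+1)) => //.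
exact: measurable_consv.
Qed.

Lemma leb_shift n (a : 'cV[R]_n) (A : set (Rn n)) : measurable A ->
  leb ((fun x => x + a) @^-1` A : set (Rn n)) = leb A.
Proof.
elim: n a A => [|n ih] a A mA.
  congr leb; apply/seteqP; split => x /=;
    by rewrite (_ : x + a = x)//; apply/matrixP => -[].
have [s [b ab]] := consvP a; rewrite {}ab /=.
have consvD t x : consv t x + consv s b = consv (t + s) (x + b).
  apply/matrixP => i j; rewrite mxE -(@splitK 1 n i); case: (fintype.split (i : 'I_(1 + n))) => k /=.
    by rewrite ord1 !consv_0.
  by rewrite !consv_S mxE.
transitivity (\int[@lebesgue_measure R]_t leb [set x : Rn n | A (consv (t + s) x)])%E.
  apply: eq_integral => t _.
  rewrite -(ih b [set x | A (consv (t + s) x)]); last exact: measurable_section.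
  by congr leb; apply/seteqP; split => x /=; rewrite consvD.
pose phi t := leb [set x : Rn n | A (consv t x)].
have ms : measurable_fun setT (fun t : R => t + s) by exact: measurable_funD.
rewrite (@scaled_measure_integral _ _ _ _ _ lebesgue_measure lebesgue_measure (fun t : R => t + s) 1 phi)//.
- by rewrite mul1e.
- move=> B mB; have := @lebesgue_measure_affine R 1 s B (oner_neq0 _) mB.
  by rewrite normr1 invr1 => <-; congr lebesgue_measure; apply/seteqP; split => t /=; rewrite mul1r.
- exact: measurable_leb_section.
Qed.

Lemma leb_setT_neq0 n : @leb R n setT != 0%E.
Proof.
elim: n => [|n ih] /=; first by rewrite /leb/= diracE mem_set// eqe oner_eq0.
rewrite (_ : [set _ | _] = setT)// integral_cst//.
rewrite mule_eq0 negb_or ih/=.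
by have := @lebesgue_measure_itv R `]-oo, +oo[; rewrite set_itvNyy /= => ->.
Qed.

(** The factor c, in the end 1 / |det h|, is kept as a variable until multiplicativity and
    elimination identify it. *)
Definition leb_scaling n (h : 'M[R]_n) (c : R) := 0 <= c /\
  forall A : set (Rn n), measurable A -> leb (mulmx h @^-1` A : set (Rn n)) = (c%:E * leb A)%E.

Lemma measurable_mulmxl n (h : 'M[R]_n) : measurable_fun setT (mulmx h : Rn n -> Rn n).
Proof. by apply: (@measurable_mulmx_fun _ _ _ _ _ (fun=> h) id). Qed.

Lemma leb_scalingM n (h k : 'M[R]_n) c d :
  leb_scaling h c -> leb_scaling k d -> leb_scaling (h *m k) (c * d).
Proof.
move=> [c0 hc] [d0 kd]; split=> [|A mA]; first exact: mulr_ge0.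
have -> : mulmx (h *m k) @^-1` A = mulmx k @^-1` (mulmx h @^-1` A) :> set (Rn n).
  by apply/seteqP; split => x /=; rewrite mulmxA.
rewrite kd ?hc// ?muleA -?EFinM 1?mulrC//.
exact: (measurable_preimage_fun (@measurable_mulmxl n h) mA).
Qed.

Lemma leb_finite_set n : exists B : set (Rn n), [/\ measurable B, leb B != 0%E & (leb B < +oo)%E].
Proof.
have [F FT /all_and2[mF Foo]] := sigma_finiteT (@leb R n).
have [i nF] : exists i, leb (F i) != 0%E.
  apply/not_existsP => h; have /eqP := leb_setT_neq0 n; apply.
  apply/negligibleP => //; rewrite FT; apply: negligible_bigcup => i.
  apply/negligibleP; first exact: mF.
  by apply/eqP; move: (h i) => /negP; rewrite negbK.
by exists (F i); split; [exact: mF| |exact: Foo].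
Qed.

Lemma leb_scaling_unique n (h : 'M[R]_n) c d : leb_scaling h c -> leb_scaling h d -> c = d.
Proof.
have [B [mB B0 Boo]] := leb_finite_set n.
move=> [c0 hc] [d0 hd]; have := hc B mB; rewrite hd//.
have Bf : leb B \is a fin_num by rewrite ge0_fin_numE.
rewrite -(fineK Bf) -!EFinM => -[] /mulIf; rewrite fine_eq0// => /(_ B0) ->//.
Qed.

Lemma measurable_group_Rn n :
  measurable_group (@setT (Rn n)) (fun x y : Rn n => (x : 'cV[R]_n) + y) (fun x : Rn n => - (x : 'cV[R]_n)).
Proof.
split => //.
- exact: measurable_addmx_fun.
- exact: measurable_oppmx_fun.
- by move=> x y _ _; rewrite addKr.
- by move=> x _; rewrite opprK.
- by move=> x y _ _; rewrite opprD addrC.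
Qed.

(** The pushforward of [leb] by h is again translation invariant, hence a multiple of [leb] by
    [haar_unique] on the additive group. *)
Lemma leb_scaling_exists n (h : 'M[R]_n) : h \in unitmx -> exists c, leb_scaling h c.
Proof.
move=> uh.
have [m mE] := pushforward_measure (@leb R n) (@measurable_mulmxl n h).
have sfm : sigma_finite setT m.
  have [F FT /all_and2[mF Foo]] := sigma_finiteT (@leb R n).
  exists (fun i => mulmx (invmx h) @^-1` F i).
    by rewrite -preimage_bigcup -FT preimage_setT.
  move=> i; split; first exact: (measurable_preimage_fun (@measurable_mulmxl n (invmx h)) (mF i)).
  rewrite mE (_ : _ @^-1` _ = F i); first exact: Foo.
  by apply/seteqP; split => x /=; rewrite mulmxA mulVmx// mul1mx.
have [m' m'E] := as_sigma_finite_measure sfm.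
have lm' : left_invariant (@setT (Rn n)) (fun x y : Rn n => (x : 'cV[R]_n) + y) m'.
  split=> [|g _ A mA]; first by rewrite setCT measure0.
  rewrite m'E !mE.
  have -> : mulmx h @^-1` ((fun y : Rn n => (g : 'cV[R]_n) + y) @^-1` A) =
      (fun x => x + invmx h *m g) @^-1` (mulmx h @^-1` A) :> set (Rn n).
    by apply/seteqP; split => x /=; rewrite mulmxDr mulmxA mulmxV// mul1mx addrC.
  apply: leb_shift; exact: (measurable_preimage_fun (@measurable_mulmxl n h) mA).
have lleb : left_invariant (@setT (Rn n)) (fun x y : Rn n => (x : 'cV[R]_n) + y) (@leb R n).
  split=> [|g _ A mA]; first by rewrite setCT measure0.
  rewrite -[RHS](leb_shift g mA); congr leb.
  by apply/seteqP; split => x /=; rewrite addrC.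
have [B [mB m'B B0 Boo H]] := haar_unique (measurable_group_Rn n) lm' lleb (leb_setT_neq0 n).
have Bf : leb B \is a fin_num by rewrite ge0_fin_numE.
have m'Bf : m' B \is a fin_num by rewrite ge0_fin_numE.
exists (fine (m' B) / fine (leb B)); split=> [|A mA].
  by rewrite divr_ge0// fine_ge0.
by apply: (ereal_cross_mul Bf B0 m'Bf); rewrite -H// m'E mE.
Qed.

(** Fits the recursion in [leb]: the first coordinate of the image is a t whatever x is, and for
    fixed t the remaining ones are an affine function of x, handled by the factor of e and a
    shift. *)
Lemma leb_scaling_lower n (a : R) (c : 'cV[R]_n) (e : 'M[R]_n) k : a != 0 ->
  leb_scaling e k -> leb_scaling (block_mx a%:M 0 c e : 'M[R]_(1 + n)) (`|a|^-1 * k).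
Proof.
move=> a0 [k0 ek]; split=> [|A mA]; first by rewrite mulr_ge0// invr_ge0.
have mulE t x : (block_mx a%:M 0 c e : 'M[R]_(1 + n)) *m consv t x = consv (a * t) (e *m x + t *: c).
  rewrite /consv mul_block_col mul0mx addr0 -scalar_mxM; congr col_mx.
  by rewrite mul_mx_scalar addrC.
pose phi t := leb [set x : Rn n | A (consv t x)].
transitivity (\int[@lebesgue_measure R]_t (k%:E * phi (a * t + 0)%R))%E.
  apply: eq_integral => t _; rewrite /= addr0.
  have mB : measurable ([set x | A (consv (a * t) x)] : set (Rn n)) by exact: measurable_section.
  rewrite /phi -(leb_shift (t *: c) mB) -ek; last first.
    apply: (@measurable_preimage_fun _ _ _ _ (fun x : Rn n => x + t *: c : Rn n)) => //.
    exact: (measurable_addmx_fun (f := id) (g := fun=> t *: c)).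
  by congr leb; apply/seteqP; split => x /=; rewrite mulE.
have mphi : measurable_fun setT phi by exact: measurable_leb_section.
have maff : measurable_fun setT (fun t : R => a * t + 0 : R).
  by apply: measurable_funD => //; exact: measurable_funM.
rewrite (@ge0_integralZl _ _ _ lebesgue_measure setT measurableT (fun t => phi (a * t + 0))); last 3 first.
- exact: measurableT_comp mphi maff.
- by move=> t _; exact: measure_ge0.
- by rewrite lee_fin.
rewrite (@scaled_measure_integral _ _ _ _ _ lebesgue_measure lebesgue_measure (fun t : R => a * t + 0) `|a|^-1 phi)//.
- by rewrite muleA -EFinM mulrC.
- by move=> B mB; exact: lebesgue_measure_affine.
Qed.

Lemma leb_scaling1 n : @leb_scaling n 1%:M 1.
Proof.
split=> // A mA; rewrite mul1e; congr leb.
by apply/seteqP; split => x /=; rewrite mul1mx.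
Qed.

(* U is conjugate to its inverse by a matrix preserving leb, so its scaling factor has
   square 1. *)
Lemma leb_scaling_unitriangular n (b : 'rV[R]_n) :
  leb_scaling (block_mx 1%:M b 0 1%:M : 'M[R]_(1 + n)) 1.
Proof.
pose U : 'M[R]_(1 + n) := block_mx 1%:M b 0 1%:M.
pose D : 'M[R]_(1 + n) := block_mx (-1)%:M 0 0 1%:M.
have uU : U \in unitmx by rewrite unitmxE /U det_ublock !det1 mulr1 unitr1.
have [c hc] : exists c, leb_scaling U c by exact: (@leb_scaling_exists n.+1 U).
have hD : leb_scaling D 1.
  have := @leb_scaling_lower n (-1) 0 1%:M 1; rewrite normrN1 invr1 mulr1; apply.
    by rewrite oppr_eq0 oner_eq0.
  exact: leb_scaling1.
have UDUD : U *m D *m U *m D = 1%:M.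
  rewrite /U /D !mulmx_block !mul0mx !mulmx0 !mul1mx !mulmx1 !addr0 !add0r.
  by rewrite !mul0mx add0r -scalar_mxM mulrNN mulr1 mul_scalar_mx scaleN1r addNr -scalar_mx_block.
have hUD := @leb_scalingM n.+1 _ _ _ _ (@leb_scalingM n.+1 _ _ _ _ (@leb_scalingM n.+1 _ _ _ _ hc hD) hc) hD.
rewrite UDUD !mulr1 in hUD.
have cc : c * c = 1 by exact: leb_scaling_unique hUD (@leb_scaling1 n.+1).
have c0 : 0 <= c by exact: hc.1.
have c1 : c = 1 by apply/eqP; rewrite -(@pexpr_eq1 _ c 2)// expr2 cc.
by move: hc; rewrite c1.
Qed.

(** Induction by elimination. If the corner entry a is nonzero, h = L U with the Schur complement of
    a in L; otherwise a row with nonzero first entry is added to the top row beforehand. *)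
Lemma leb_scaling_det n (h : 'M[R]_n) : h \in unitmx -> leb_scaling h `|\det h|^-1.
Proof.
elim: n h => [|n ih] h uh.
  rewrite det_mx00 normr1 invr1 (_ : h = 1%:M); first exact: leb_scaling1.
  by apply/matrixP => -[].
have main (k : 'M[R]_(1 + n)) : ulsubmx k 0 0 != 0 -> k \in unitmx ->
    leb_scaling (k : 'M[R]_n.+1) `|\det k|^-1.
  move=> k0 uk; pose a := ulsubmx k 0 0.
  pose L : 'M[R]_(1 + n) := block_mx a%:M 0 (dlsubmx k) (drsubmx k - dlsubmx k *m (a^-1 *: ursubmx k)).
  pose U : 'M[R]_(1 + n) := block_mx 1%:M (a^-1 *: ursubmx k) 0 1%:M.
  have kE : k = L *m U.
    rewrite /L /U mulmx_block !mulmx1 !mulmx0 !addr0 mul_scalar_mx scalerA mulfV// scale1r.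
    rewrite addrCA subrr addr0 -[LHS]submxK; congr block_mx.
    by apply/matrixP => i j; rewrite !ord1 [in RHS]mxE eqxx mulr1n.
  have dk : \det k = a * \det (drsubmx k - dlsubmx k *m (a^-1 *: ursubmx k)).
    by rewrite {1}kE det_mulmx det_lblock det_ublock !det1 !mulr1 det_scalar1.
  rewrite dk normrM invfM.
  have ue : drsubmx k - dlsubmx k *m (a^-1 *: ursubmx k) \in unitmx.
    move: uk; rewrite !unitmxE dk !unitfE mulf_eq0 negb_or => /andP[_ //].
  rewrite {1}kE -[X in leb_scaling _ X]mulr1.
  apply: (@leb_scalingM n.+1); last exact: leb_scaling_unitriangular.
  by apply: leb_scaling_lower => //; exact: ih.
have [h00|h00] := eqVneq (@ulsubmx _ 1 n 1 n h 0 0) 0; last exact: main.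
have [i hi] : exists i, @dlsubmx _ 1 n 1 n h i 0 != 0.
  apply/not_existsP => hh; move: uh; rewrite unitmxE unitfE => /eqP; apply.
  rewrite -[h](@submxK _ 1 n 1 n).
  have -> : @ulsubmx _ 1 n 1 n h = 0 by apply/matrixP => i j; rewrite !ord1 h00 mxE.
  have -> : @dlsubmx _ 1 n 1 n h = 0.
    by apply/matrixP => i j; rewrite ord1 [RHS]mxE; apply/eqP; move: (hh i) => /negP; rewrite negbK.
  by rewrite (@det_ublock _ 1 n) det_mx11 mxE mul0r.
pose U : 'M[R]_(1 + n) := block_mx 1%:M (delta_mx 0 i) 0 1%:M.
pose U' : 'M[R]_(1 + n) := block_mx 1%:M (- delta_mx 0 i) 0 1%:M.
have U'U : U' *m U = 1%:M.
  by rewrite /U /U' mulmx_block !mul1mx !mulmx1 !mulmx0 !mul0mx !addr0 !add0r subrr -scalar_mx_block.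
have dU : \det U = 1 by rewrite /U det_ublock !det1 mulr1.
have -> : h = U' *m (U *m h) by rewrite mulmxA U'U mul1mx.
have dU' : \det U' = 1 by rewrite /U' det_ublock !det1 mulr1.
rewrite det_mulmx dU' mul1r -[X in leb_scaling _ X]mul1r.
apply: (@leb_scalingM n.+1); first exact: leb_scaling_unitriangular.
apply: main; last by rewrite unitmxE det_mulmx dU mul1r -unitmxE.
rewrite -{1}[h](@submxK _ 1 n 1 n) /U (@mulmx_block _ 1 n 1 n 1 n) (@block_mxKul _ 1 n 1 n) mul1mx.
rewrite mxE h00 add0r mxE (bigD1 i)//= big1 ?addr0 => [|j ji].
  by rewrite mxE !eqxx mul1r.
by rewrite mxE eqxx (negbTE ji) mul0r.
Qed.

Lemma leb_affine n (h : 'M[R]_n) (a : 'cV[R]_n) (A : set (Rn n)) : h \in unitmx ->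
  measurable A -> leb ((fun x => h *m x + a) @^-1` A : set (Rn n)) = ((`|\det h|^-1)%:E * leb A)%E.
Proof.
move=> uh mA; have [_ <-//] := leb_scaling_det uh.
rewrite -[RHS](leb_shift (invmx h *m a)); last exact: (measurable_preimage_fun (@measurable_mulmxl n h) mA).
congr leb; apply/seteqP; split => x /=; by rewrite mulmxDr mulmxA mulmxV// mul1mx.
Qed.

Lemma integral_leb_affine n (h : 'M[R]_n) (a : 'cV[R]_n) (f : Rn n -> \bar R) : h \in unitmx ->
  measurable_fun setT f -> (forall x, 0 <= f x)%E ->
  (\int[@leb R n]_x f (h *m x + a)%R = (`|\det h|^-1)%:E * \int[@leb R n]_x f x)%E.
Proof.
move=> uh mf f0.
apply: (@scaled_measure_integral _ _ _ _ _ _ _ (fun x : Rn n => h *m x + a : Rn n)) => //.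
- exact: measurable_affine.
- by move=> A mA; exact: leb_affine.
Qed.

End leb_affine.

(** * The Hilbert space of square integrable functions *)

Definition cmod2 (R : realType) (z : R[i]) : R := complex.Re z ^+ 2 + complex.Im z ^+ 2.

(** The real part of [z * conjc w], a real inner product. The imaginary part is recovered by
    replacing w with i w, as in [mulr_conjcE]. *)
Definition cdot (R : realType) (z w : R[i]) : R :=
  complex.Re z * complex.Re w + complex.Im z * complex.Im w.

Section complex_algebra.
Variable R : realType.
Implicit Types z w : R[i].

Lemma cmod2_ge0 z : 0 <= cmod2 z.
Proof. by rewrite addr_ge0// sqr_ge0. Qed.

Lemma normc_sqr z : Normc.normc z ^+ 2 = cmod2 z.
Proof. by case: z => a b; rewrite sqr_sqrtr// addr_ge0// sqr_ge0. Qed.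

Lemma cmod2_eq0 z : cmod2 z = 0 -> z = 0.
Proof.
case: z => a b /eqP; rewrite /cmod2/= paddr_eq0 ?sqr_ge0// !sqrf_eq0.
by move=> /andP[/eqP-> /eqP->].
Qed.

Lemma cmod2M z w : cmod2 (z * w) = cmod2 z * cmod2 w.
Proof. by case: z w => a b [c d]; rewrite /cmod2/=; ring. Qed.

Lemma cmod2_conj z : cmod2 (conjc z) = cmod2 z.
Proof. by case: z => a b; rewrite /cmod2/= sqrrN. Qed.

Lemma cmod2D_le z w : cmod2 (z + w) <= 2 * cmod2 z + 2 * cmod2 w.
Proof.
case: z w => a b [c d]; rewrite /cmod2/=.
have := sqr_ge0 (a - c); have := sqr_ge0 (b - d); rewrite !sqrrB; lra.
Qed.

Lemma cmod2N z : cmod2 (- z) = cmod2 z.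
Proof. by case: z => a b; rewrite /cmod2/= !sqrrN. Qed.

Lemma cdot_le z w : `|cdot z w| <= cmod2 z + cmod2 w.
Proof.
rewrite ler_norml; case: z w => a b [c d]; rewrite /cdot /cmod2/=.
have := sqr_ge0 (a - c); have := sqr_ge0 (b - d).
have := sqr_ge0 (a + c); have := sqr_ge0 (b + d).
have := sqr_ge0 (a); have := sqr_ge0 (b); have := sqr_ge0 (c); have := sqr_ge0 (d).
rewrite !sqrrB !sqrrD; lra.
Qed.

Lemma cdotC z w : cdot z w = cdot w z.
Proof. by rewrite /cdot mulrC [X in _ + X]mulrC. Qed.

Lemma cdotDl z w u : cdot (z + w) u = cdot z u + cdot w u.
Proof. by case: z w u => a b [c d] [e f]; rewrite /cdot/=; ring. Qed.

Lemma cdotZl (k : R) z w : cdot (real_complex R k * z) w = k * cdot z w.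
Proof. by case: z w => a b [c d]; rewrite /cdot/=; ring. Qed.

Lemma cdot_same z : cdot z z = cmod2 z.
Proof. by rewrite /cdot -!expr2. Qed.

Lemma mulr_conjcE z w : z * conjc w = Complex (cdot z w) (cdot z (Complex 0 1 * w)).
Proof. by case: z w => a b [c d]; rewrite /cdot/=; congr Complex; ring. Qed.

End complex_algebra.

Section complex_L2_theory.
Context d (T : measurableType d) (R : realType).
Variable mu : {measure set T -> \bar R}.
Implicit Types f g : T -> R[i].
Local Notation L2 := (L2 mu setT).
Local Notation cmeas := (@cmeasurable _ T R setT).
Local Notation aeq := (ae_eq_on mu setT).
Local Open Scope ereal_scope.

Definition csq f : \bar R := \int[mu]_x (cmod2 (f x))%:E.

Lemma csq_ge0 f : 0 <= csq f.
Proof. by apply: integral_ge0 => x _; rewrite lee_fin cmod2_ge0. Qed.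

Lemma L2normE (D : set T) f : measurable D ->
  L2norm mu D f = (\int[mu]_(x in D) (cmod2 (f x))%:E) `^ 2^-1.
Proof.
move=> mD; rewrite /L2norm unlock; congr poweR; rewrite [RHS]integral_mkcond.
apply: eq_integral => x _; rewrite !patchE; case: ifP => _.
  by rewrite -normc_sqr abse_EFin poweR_EFin powR_mulrn// real_normK// num_real.
by rewrite abse0 poweR0r.
Qed.

Lemma L2norm_csq f : L2norm mu setT f = (csq f) `^ 2^-1.
Proof. exact: L2normE. Qed.

Lemma L2P f : L2 f <-> cmeas f /\ csq f < +oo.
Proof.
rewrite /Defs.L2 L2norm_csq; split=> -[mf h]; split => //.
  by apply: lty_poweRy h; rewrite invr_eq0.
exact: poweR_lty.
Qed.

Lemma measurable_cmod2 f : cmeas f -> measurable_fun setT (fun x => cmod2 (f x)).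
Proof. by move=> [mR mI]; apply: measurable_funD; exact: measurable_funX. Qed.

Lemma measurable_ecmod2 f : cmeas f -> measurable_fun setT (fun x => (cmod2 (f x))%:E).
Proof. by move=> mf; apply/measurable_EFinP; exact: measurable_cmod2. Qed.

Lemma measurable_cdot f g : cmeas f -> cmeas g -> measurable_fun setT (fun x => cdot (f x) (g x)).
Proof. by move=> [? ?] [? ?]; apply: measurable_funD; exact: measurable_funM. Qed.

Lemma cmeasD f g : cmeas f -> cmeas g -> cmeas (fun x => f x + g x)%R.
Proof.
move=> [fR fI] [gR gI]; split.
  apply: eq_measurable_fun (measurable_funD fR gR) => x _ /=.
  by case: (f x) (g x) => ? ? [].
apply: eq_measurable_fun (measurable_funD fI gI) => x _ /=.
by case: (f x) (g x) => ? ? [].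
Qed.

Lemma cmeasM f g : cmeas f -> cmeas g -> cmeas (fun x => f x * g x)%R.
Proof.
move=> [fR fI] [gR gI]; split.
  apply: eq_measurable_fun (measurable_funB (measurable_funM fR gR) (measurable_funM fI gI)) => x _ /=.
  by case: (f x) (g x) => ? ? [].
apply: eq_measurable_fun (measurable_funD (measurable_funM fR gI) (measurable_funM fI gR)) => x _ /=.
by case: (f x) (g x) => ? ? [].
Qed.

Lemma cmeas_cst (a : R[i]) : cmeas (fun=> a).
Proof. by split; exact: measurable_cst. Qed.

Lemma cmeas_conj f : cmeas f -> cmeas (fun x => conjc (f x)).
Proof.
move=> [fR fI]; split; first by apply: eq_measurable_fun fR => x _; case: (f x).
by apply: eq_measurable_fun (measurableT_comp (@oppr_measurable R setT) fI) => x _ /=; case: (f x).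
Qed.

Lemma csqZ (a : R[i]) f : cmeas f -> csq (fun x => a * f x)%R = (cmod2 a)%:E * csq f.
Proof.
move=> mf; rewrite /csq -ge0_integralZl//.
- by apply: eq_integral => x _; rewrite cmod2M EFinM.
- exact: measurable_ecmod2.
- by move=> x _; rewrite lee_fin cmod2_ge0.
- by rewrite lee_fin cmod2_ge0.
Qed.

Lemma csqD_le f g : cmeas f -> cmeas g ->
  csq (fun x => f x + g x)%R <= 2%:E * csq f + 2%:E * csq g.
Proof.
move=> mf mg; have mf2 := measurable_ecmod2 mf; have mg2 := measurable_ecmod2 mg.
have p0 (h : T -> R[i]) x : 0 <= (cmod2 (h x))%:E by rewrite lee_fin cmod2_ge0.
rewrite /csq -!ge0_integralZl// -ge0_integralD//; last 4 first.
- by move=> x _; apply: mule_ge0.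
- exact: emeasurable_funM.
- by move=> x _; apply: mule_ge0.
- exact: emeasurable_funM.
apply: ge0_le_integral => //.
- by move=> x _; rewrite lee_fin cmod2_ge0.
- exact: measurable_ecmod2 (cmeasD mf mg).
- by apply: emeasurable_funD; exact: emeasurable_funM.
- by move=> x _; rewrite -!EFinM -EFinD lee_fin cmod2D_le.
Qed.

Lemma L2_meas f : L2 f -> cmeas f. Proof. by case. Qed.

Lemma L2_csq f : L2 f -> csq f < +oo. Proof. by case/L2P. Qed.

Lemma L2D f g : L2 f -> L2 g -> L2 (fun x => f x + g x)%R.
Proof.
move=> /L2P[mf f2] /L2P[mg g2]; apply/L2P; split; first exact: cmeasD.
apply: le_lt_trans (csqD_le mf mg) _.
by apply: lte_add_pinfty; apply: lte_mul_pinfty.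
Qed.

Lemma L2Z (a : R[i]) f : L2 f -> L2 (fun x => a * f x)%R.
Proof.
move=> /L2P[mf f2]; apply/L2P; split; first by apply: cmeasM => //; exact: cmeas_cst.
by rewrite csqZ//; apply: lte_mul_pinfty => //; rewrite lee_fin cmod2_ge0.
Qed.

Lemma L2_0 : L2 (fun=> 0%R).
Proof.
apply/L2P; split; first exact: cmeas_cst.
by rewrite /csq integral0_eq ?ltry// => x _; rewrite /cmod2/= expr0n addr0.
Qed.

Lemma L2N f : L2 f -> L2 (fun x => - f x)%R.
Proof.
by move=> /(L2Z (-1)%R); congr (Defs.L2 _ _ _); apply/funext => x; rewrite mulN1r.
Qed.

Lemma L2B f g : L2 f -> L2 g -> L2 (fun x => f x - g x)%R.
Proof. by move=> Lf /L2N; exact: L2D. Qed.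

Lemma integrable_cdot f g : L2 f -> L2 g ->
  mu.-integrable setT (fun x => (cdot (f x) (g x))%:E).
Proof.
move=> /L2P[mf f2] /L2P[mg g2].
have i2 (h : T -> R[i]) : cmeas h -> csq h < +oo -> mu.-integrable setT (fun x => (cmod2 (h x))%:E).
  move=> mh h2; apply/integrableP; split; first exact: measurable_ecmod2.
  by under eq_integral do rewrite gee0_abs ?lee_fin ?cmod2_ge0//.
apply: (le_integrable measurableT _ _ (integrableD measurableT (i2 _ mf f2) (i2 _ mg g2))).
  by apply/measurable_EFinP; exact: measurable_cdot.
move=> x _ /=; rewrite lee_fin (le_trans (cdot_le _ _))//.
by rewrite ler_norm.
Qed.

Definition cip f g : R := Rintegral mu setT (fun x => cdot (f x) (g x)).

Lemma eq_cip f f' g g' : L2 f -> L2 f' -> L2 g -> L2 g' ->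
  aeq f f' -> aeq g g' -> cip f g = cip f' g'.
Proof.
move=> Lf Lf' Lg Lg' ff' gg'; rewrite /cip /Rintegral; congr fine.
apply: ae_eq_integral => //.
- by apply/measurable_EFinP; apply: measurable_cdot; exact: L2_meas.
- by apply/measurable_EFinP; apply: measurable_cdot; exact: L2_meas.
- by apply: filterS2 ff' gg' => x h1 h2 _; rewrite (h1 I) (h2 I).
Qed.

Lemma cipC f g : cip f g = cip g f.
Proof. by apply: eq_Rintegral => x _; rewrite cdotC. Qed.

Lemma cipDl f g h : L2 f -> L2 g -> L2 h ->
  cip (fun x => f x + g x)%R h = (cip f h + cip g h)%R.
Proof.
move=> Lf Lg Lh; rewrite /cip -RintegralD//.
- by apply: eq_Rintegral => x _; rewrite cdotDl.
- exact: integrable_cdot.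
- exact: integrable_cdot.
Qed.

Lemma cipZl (k : R) f g : L2 f -> L2 g ->
  cip (fun x => real_complex R k * f x)%R g = (k * cip f g)%R.
Proof.
move=> Lf Lg; rewrite /cip -RintegralZl//; last exact: integrable_cdot.
by apply: eq_Rintegral => x _; rewrite cdotZl.
Qed.

Lemma cip_csq f : L2 f -> (cip f f)%:E = csq f.
Proof.
move=> /L2_csq f2; rewrite /cip /Rintegral.
rewrite [X in (fine X)%:E](_ : _ = csq f); last by apply: eq_integral => x _; rewrite cdot_same.
by rewrite fineK// ge0_fin_numE// csq_ge0.
Qed.

Lemma csq_eq0 f : cmeas f -> csq f = 0 -> aeq f (fun=> 0%R).
Proof.
move=> mf f0; have := (ae_eq_integral_abs mu measurableT (measurable_ecmod2 mf)).1.
move=> /(_ _)[|N [mN N0 NE]].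
  rewrite -[RHS]f0; apply: eq_integral => x _.
  by rewrite gee0_abs// lee_fin cmod2_ge0.
exists N; split => // x /= h; apply: NE => /= h'; apply: h => _.
by apply: cmod2_eq0; have [] := h' I.
Qed.

Lemma aeq_refl f : aeq f f. Proof. by apply: nearW => x _. Qed.

Lemma aeq_sym f g : aeq f g -> aeq g f.
Proof. by apply: filterS => x h /h. Qed.

Lemma aeq_trans f g h : aeq f g -> aeq g h -> aeq f h.
Proof. by apply: filterS2 => x h1 h2 /[dup] /h1 -> /h2. Qed.

Lemma aeq_op1 (op : R[i] -> R[i]) f g : aeq f g -> aeq (fun x => op (f x)) (fun x => op (g x)).
Proof. by apply: filterS => x h /h ->. Qed.

Lemma aeq_op2 (op : R[i] -> R[i] -> R[i]) f f' g g' : aeq f f' -> aeq g g' ->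
  aeq (fun x => op (f x) (g x)) (fun x => op (f' x) (g' x)).
Proof. by apply: filterS2 => x h1 h2 /[dup] /h1 -> /h2 ->. Qed.

Lemma fatou_bound (f : nat -> T -> R) (g : T -> R) (C : \bar R) :
  (forall n, measurable_fun setT (f n)) -> (forall n x, (0 <= f n x)%R) ->
  (forall x, f n x @[n --> \oo] --> g x) ->
  (forall n, \int[mu]_x (f n x)%:E <= C) -> \int[mu]_x (g x)%:E <= C.
Proof.
move=> mf f0 fg fC.
have := @fatou _ _ _ mu setT measurableT (fun n x => (f n x)%:E).
move=> /(_ (fun n => (measurable_EFinP _ _).2 (mf n)) (fun n x _ => _)) h.
apply: (@le_trans _ _ (\int[mu]_x limn_einf (fun n => (f n x)%:E))).
  rewrite le_eqVlt; apply/orP; left; apply/eqP; apply: eq_integral => x _.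
  have h' : (f n x)%:E @[n --> \oo] --> (g x)%:E.
    by apply: cvg_EFin; [exact: nearW|exact: fg].
  by rewrite (cvg_limn_einf_sup h').1.
apply: le_trans; first by apply: h => n x; rewrite lee_fin.
rewrite limn_einf_lim; apply: lime_le; first exact: is_cvg_einfs.
apply: nearW => n; apply: le_trans (fC n).
by apply: ereal_inf_lbound; exists n => //=.
Qed.

Lemma csq_ae f g : cmeas f -> cmeas g -> aeq f g -> csq f = csq g.
Proof.
move=> mf mg fg; apply: ae_eq_integral => //; try exact: measurable_ecmod2.
by apply: filterS fg => x h _; rewrite (h I).
Qed.

End complex_L2_theory.

(** * Completeness of L2 *)

Section riesz_fischer.
Context d (T : measurableType d) (R : realType).
Variable mu : {measure set T -> \bar R}.
Implicit Types f g : T -> R[i].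
Local Notation L2 := (L2 mu setT).
Local Notation cmeas := (@cmeasurable _ T R setT).
Local Notation aeq := (ae_eq_on mu setT).

(** The rate 8^-k leaves room for weights 4^k: the weighted squared increments still sum to at most
    2. *)
Lemma fast_subsequence (a : nat -> R) : a k @[k --> \oo] --> (0 : R) ->
  exists phi : nat -> nat, [/\ forall k, (phi k <= phi k.+1)%N, forall k, (k <= phi k)%N &
    forall k, a (phi k) <= 8^-1 ^+ k].
Proof.
move=> a0.
have /choice[N NP] : forall k, exists N, forall n, (N <= n)%N -> a n <= 8^-1 ^+ k.
  move=> k; have /cvgr_dist_le/(_ (8^-1 ^+ k)) := a0; case.
    by rewrite exprn_gt0// invr_gt0.
  move=> N _ NP; exists N => n Nn; have := NP n Nn.
  by rewrite /= sub0r normrN; apply: le_trans (ler_norm _).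
pose phi := fix phi k := if k is k'.+1 then maxn (phi k').+1 (N k'.+1) else N 0%N.
exists phi; split.
- by move=> k /=; rewrite leq_max leqnSn.
- by elim=> [//|k ih] /=; rewrite leq_max ltnS ih.
- by case=> [|k]; apply: NP => //=; rewrite leq_maxr.
Qed.

Lemma geometric_increments_cvg (u : nat -> R) (C : R) :
  (forall k, `|u k.+1 - u k| <= C * 2^-1 ^+ k) -> cvgn u.
Proof.
move=> uC.
have cs : cvgn (series (fun k => u k.+1 - u k)).
  apply: normed_cvg; apply: (@series_le_cvg _ _ (geometric C 2^-1)).
  - by move=> k /=.
  - by move=> k; exact: le_trans (uC k).
  - by move=> k; exact: uC.
  - by apply: is_cvg_geometric_series; rewrite ger0_norm ?invr_ge0// invf_lt1// ltr1n.
have -> : u = fun n => u 0%N + series (fun k => u k.+1 - u k) n.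
  by apply/funext => n; rewrite /series/= telescope_sumr// addrC subrK.
by apply: is_cvgD => //; exact: is_cvg_cst.
Qed.

Lemma riesz_fischer (f : nat -> T -> R[i]) (a : nat -> R) :
  (forall n, L2 (f n)) -> a k @[k --> \oo] --> (0 : R) ->
  (forall m n, (m <= n)%N -> (csq mu (fun x => f n x - f m x)%R <= (a m)%:E)%E) ->
  exists2 g, L2 g & forall m, (csq mu (fun x => g x - f m x)%R <= (a m)%:E)%E.
Proof.
move=> Lf a0 fa; have [phi [phiS phik aphi]] := fast_subsequence a0.
have mf n : cmeas (f n) := L2_meas (Lf n).
pose dk k x := f (phi k.+1) x - f (phi k) x.
have Ldk k : L2 (dk k) by exact: L2B.
have mdk k : measurable_fun setT (fun x => (cmod2 (dk k x))%:E).
  by apply: measurable_ecmod2; exact: L2_meas (Ldk k).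
(* F has integral at most 2, and where F x is finite the k-th increment at x is at most 2^-k times
   the square root of F x, so the subsequence converges there. *)
pose F x := (\sum_(k <oo) ((4 ^+ k)%:E * (cmod2 (dk k x))%:E))%E.
have t0 k x : (0 <= (4 ^+ k)%:E * (cmod2 (dk k x))%:E)%E.
  by rewrite -EFinM lee_fin mulr_ge0 ?exprn_ge0// cmod2_ge0.
have mt k : measurable_fun setT (fun x => (4 ^+ k)%:E * (cmod2 (dk k x))%:E)%E.
  exact: emeasurable_funM.
have mF : measurable_fun setT F.
  by apply: ge0_emeasurable_sum => //; move=> k x _ _; exact: t0.
have F0 x : (0 <= F x)%E by apply: nneseries_ge0 => k _ _; exact: t0.
have intF : (\int[mu]_x F x < +oo)%E.
  rewrite integral_nneseries//.
  apply: (@le_lt_trans _ _ (\sum_(k <oo) (2^-1 ^+ k)%:E)%E).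
    apply: lee_nneseries => [k _ _|k _]; first exact: integral_ge0.
    rewrite ge0_integralZl// ?lee_fin ?exprn_ge0//; last first.
      by move=> x _; rewrite lee_fin cmod2_ge0.
    apply: (@le_trans _ _ ((4 ^+ k)%:E * (8^-1 ^+ k)%:E)%E).
      rewrite lee_pmul2l// ?lte_fin ?exprn_gt0//.
      by apply: le_trans (fa _ _ (phiS k)) _; rewrite lee_fin.
    by rewrite -EFinM -exprMn lee_fin (_ : 4 / 8 = 2^-1)//; field.
  rewrite (_ : \sum_(k <oo) _ = (2:R)%:E)%E ?ltry//.
  apply/cvg_lim => //.
  rewrite (_ : (fun n => _) = (fun n => (series (geometric 1 2^-1) n)%:E)); last first.
    by apply/funext => n; rewrite /series/= sumEFin; congr (_%:E); apply: eq_bigr => k _; rewrite mul1r.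
  apply: cvg_EFin; first exact: nearW.
  have := @cvg_geometric_series R 1 2^-1; rewrite (_ : 1 / (1 - 2^-1) = 2); last by field.
  by apply; rewrite ger0_norm ?invr_ge0// invf_lt1// ltr1n.
pose A := [set x | (F x < +oo)%E].
have mA : measurable A.
  rewrite (_ : A = ~` (F @^-1` [set +oo%E])); last first.
    by apply/seteqP; split => x; rewrite /A/= ltey => /eqP.
  apply: measurableC; rewrite -[X in measurable X]setTI; exact: mF.
have Aae : {ae mu, forall x, A x}.
  have iF : mu.-integrable setT F.
    by apply/integrableP; split => //; under eq_integral do rewrite gee0_abs//.
  apply: filterS (integrable_ae measurableT iF) => x /(_ I).
  by rewrite ge0_fin_numE.
(* Off the set of convergence the value 0 makes the sequence converge everywhere, so that its limit
   is measurable. *)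
pose h k x : R[i] := if x \in A then f (phi k) x else 0.
have mh k : cmeas (h k).
  have e (x : T) : h k x = (real_complex R (\1_A x)) * f (phi k) x.
    by rewrite /h indicE; case: (x \in A) => /=; rewrite ?mul1r// mul0r.
  rewrite (funext e); apply: cmeasM => //; split => /=; last exact: measurable_cst.
  exact: measurable_indic.
have dkle x k : A x -> cmod2 (dk k x) <= fine (F x) * (2^-1 ^+ k) ^+ 2.
  move=> Ax; have Ff : F x \is a fin_num by rewrite ge0_fin_numE.
  have : ((4 ^+ k)%:E * (cmod2 (dk k x))%:E <= F x)%E.
    apply: le_trans (@nneseries_lim_ge _ (fun k => (4 ^+ k)%:E * (cmod2 (dk k x))%:E)%E xpredT 0%N k.+1 _).
      rewrite big_nat_recr//= leeDr// sume_ge0// => i _; exact: t0.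
    by move=> n _ _; exact: t0.
  rewrite -(fineK Ff) -EFinM lee_fin => h1.
  rewrite -exprM mulnC exprM -ler_pdivrMr ?exprn_gt0 ?invr_gt0//.
  rewrite (_ : 2^-1 ^+ 2 = 4^-1 :> R); last by field.
  by rewrite -exprVn invrK mulrC.
have cvh (p : R[i] -> R) : p 0 = 0 -> (forall z w, p (z - w) = p z - p w) -> (forall z, p z ^+ 2 <= cmod2 z) ->
    forall x, cvgn (fun k => p (h k x)).
  move=> p0 pB ple x; rewrite /h; case: (boolP (x \in A)) => [|_]; last first.
    rewrite p0; exact: is_cvg_cst.
  rewrite inE => Ax; apply: (@geometric_increments_cvg _ (Num.sqrt (fine (F x)))) => k.
  rewrite -pB -(@ler_pXn2r _ 2) ?nnegrE ?mulr_ge0 ?sqrtr_ge0 ?exprn_ge0 ?invr_ge0//.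
  rewrite real_normK ?num_real// exprMn sqr_sqrtr; last exact: fine_ge0.
  exact: le_trans (ple _) (dkle x k Ax).
have cR := cvh (@complex.Re R) erefl (fun z w => _) (fun z => _).
have {}cR : forall x, cvgn (fun k => complex.Re (h k x)).
  apply: cR => [z w|z]; first by case: z w => ? ? [].
  by rewrite /cmod2 lerDl sqr_ge0.
have cI : forall x, cvgn (fun k => complex.Im (h k x)).
  apply: (cvh (@complex.Im R)) => // [z w|z]; first by case: z w => ? ? [].
  by rewrite /cmod2 lerDr sqr_ge0.
pose g x : R[i] := Complex (limn (fun k => complex.Re (h k x))) (limn (fun k => complex.Im (h k x))).
have mg : cmeas g.
  split.
    apply: (@measurable_fun_cvg _ _ _ _ (fun k x => complex.Re (h k x))) => [k|x _]; first exact: (mh k).1.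
    exact: cR.
  apply: (@measurable_fun_cvg _ _ _ _ (fun k x => complex.Im (h k x))) => [k|x _]; first exact: (mh k).2.
  exact: cI.
(* Fatou along the indices phi (n + m), which are at least m, so that the hypothesis with modulus a
   m applies to each term. *)
have gfm m : (csq mu (fun x => g x - f m x)%R <= (a m)%:E)%E.
  apply: (@fatou_bound _ _ _ mu (fun n x => cmod2 (h (n + m)%N x - f m x))).
  - by move=> n; apply: measurable_cmod2; apply: cmeasD => //; exact: L2_meas (L2N (Lf m)).
  - by move=> n x; exact: cmod2_ge0.
  - move=> x; have e z w : cmod2 (z - w) = (complex.Re z - complex.Re w) ^+ 2 + (complex.Im z - complex.Im w) ^+ 2 :> R.
      by case: z w => ? ? [].
    under eq_fun do rewrite e expr2 [X in _ + X]expr2; rewrite e !expr2.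
    have r1 : complex.Re (h (n + m)%N x) - complex.Re (f m x) @[n --> \oo] --> complex.Re (g x) - complex.Re (f m x).
      by apply: cvgB; [rewrite (cvg_shiftn m (fun n => complex.Re (h n x))); exact: cR|exact: cvg_cst].
    have r2 : complex.Im (h (n + m)%N x) - complex.Im (f m x) @[n --> \oo] --> complex.Im (g x) - complex.Im (f m x).
      by apply: cvgB; [rewrite (cvg_shiftn m (fun n => complex.Im (h n x))); exact: cI|exact: cvg_cst].
    by apply: cvgD; exact: cvgM.
  move=> n; apply: le_trans (fa m (phi (n + m)%N) _); last first.
    by apply: leq_trans (phik _); exact: leq_addl.
  rewrite le_eqVlt; apply/orP; left; apply/eqP.
  apply: csq_ae.
  - by apply: cmeasD => //; exact: L2_meas (L2N (Lf m)).
  - by apply: L2_meas; exact: L2B.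
  - by apply: filterS Aae => x Ax _; rewrite /h mem_set.
exists g => //; apply/L2P; split => //.
have -> : g = (fun x => (g x - f 0%N x) + f 0%N x) by apply/funext => x; rewrite subrK.
apply: le_lt_trans (csqD_le _ _ _) _ => //.
  by apply: cmeasD => //; exact: L2_meas (L2N (Lf 0%N)).
apply: lte_add_pinfty; apply: lte_mul_pinfty => //; last exact: L2_csq.
by apply: le_lt_trans (gfm 0%N) _; rewrite ltry.
Qed.

End riesz_fischer.

(** * The quotient of L2 by almost everywhere equality *)

Section L2_space.
Context d (T : measurableType d) (R : realType).
Variable mu : {measure set T -> \bar R}.
Implicit Types f g : T -> R[i].
Local Notation L2 := (L2 mu setT).
Local Notation aeq := (ae_eq_on mu setT).

(* Elements of L2 modulo a.e. equality are represented by chosen functions. *)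
Definition l2_choose f : T -> R[i] := xget (fun=> 0) [set g | L2 g /\ aeq f g].

Lemma l2_chooseP f : L2 f -> L2 (l2_choose f) /\ aeq f (l2_choose f).
Proof.
move=> Lf; apply: (@xgetPex _ (fun=> 0) [set g | L2 g /\ aeq f g]).
by exists f; split => //; exact: aeq_refl.
Qed.

Lemma l2_choose_eq f g : aeq f g -> l2_choose f = l2_choose g.
Proof.
move=> fg; congr xget; apply/seteqP; split => h [Lh ae]; split => //.
  exact: aeq_trans (aeq_sym fg) ae.
exact: aeq_trans fg ae.
Qed.

(** A total idempotent, whose fixed points form the type [l2]: equality of classes becomes equality
    of functions. Functions outside L2 are sent to the class of 0. *)
Definition l2_rep f : T -> R[i] := if `[< L2 f >] then l2_choose f else l2_choose (fun=> 0).

Lemma l2_repP f : L2 (l2_rep f).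
Proof.
by rewrite /l2_rep; case: ifPn => [/asboolP Lf|_]; [exact: (l2_chooseP Lf).1|exact: (l2_chooseP (L2_0 mu)).1].
Qed.

Lemma l2_rep_ae f : L2 f -> aeq f (l2_rep f).
Proof. by move=> Lf; rewrite /l2_rep asboolT//; exact: (l2_chooseP Lf).2. Qed.

Lemma l2_rep_idem f : l2_rep (l2_rep f) = l2_rep f.
Proof.
rewrite {1}/l2_rep asboolT; last exact: l2_repP.
rewrite {2}/l2_rep; case: ifPn => [/asboolP Lf|nf].
  by rewrite {1}/l2_rep asboolT//; symmetry; apply: l2_choose_eq; exact: (l2_chooseP Lf).2.
rewrite {1}/l2_rep (negbTE nf); symmetry; apply: l2_choose_eq.
exact: (l2_chooseP (L2_0 mu)).2.
Qed.

Record l2 := MkL2 { l2fun :> T -> R[i]; l2fun_rep : l2_rep l2fun == l2fun }.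

HB.instance Definition _ := [isSub for l2fun].
HB.instance Definition _ := [Choice of l2 by <:].

Definition to_l2 f : l2 := MkL2 (introT eqP (l2_rep_idem f)).

Lemma l2_L2 (x : l2) : L2 x.
Proof. by case: x => f /= /eqP <-; exact: l2_repP. Qed.

Lemma l2funK (x : l2) : to_l2 x = x.
Proof. by apply: val_inj => /=; case: x => f /= /eqP. Qed.

Lemma to_l2_ae f : L2 f -> aeq (to_l2 f) f.
Proof. by move=> /l2_rep_ae; exact: aeq_sym. Qed.

Lemma eq_to_l2 f g : L2 f -> L2 g -> aeq f g -> to_l2 f = to_l2 g.
Proof.
move=> Lf Lg fg; apply: val_inj => /=; rewrite /l2_rep !asboolT//.
exact: l2_choose_eq.
Qed.

Lemma to_l2_inj f g : L2 f -> L2 g -> to_l2 f = to_l2 g -> aeq f g.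
Proof.
move=> Lf Lg fg; apply: aeq_trans (aeq_sym (to_l2_ae Lf)) _.
by rewrite fg; exact: to_l2_ae.
Qed.

Definition l2_add (x y : l2) : l2 := to_l2 (fun t => x t + y t).
Definition l2_opp (x : l2) : l2 := to_l2 (fun t => - x t).
Definition l2_cscale (a : R[i]) (x : l2) : l2 := to_l2 (fun t => a * x t).
Definition l2_scale (a : R) (x : l2) : l2 := l2_cscale (real_complex R a) x.

Lemma to_l2_add f g : L2 f -> L2 g -> l2_add (to_l2 f) (to_l2 g) = to_l2 (fun t => f t + g t).
Proof.
move=> Lf Lg; apply: eq_to_l2; [apply: L2D; exact: l2_L2|exact: L2D|].
by apply: aeq_op2; exact: to_l2_ae.
Qed.

Lemma to_l2_cscale a f : L2 f -> l2_cscale a (to_l2 f) = to_l2 (fun t => a * f t).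
Proof.
move=> Lf; apply: eq_to_l2; [apply: L2Z; exact: l2_L2|exact: L2Z|].
by apply: (aeq_op1 (fun z => a * z)); exact: to_l2_ae.
Qed.

Lemma to_l2_opp f : L2 f -> l2_opp (to_l2 f) = to_l2 (fun t => - f t).
Proof.
move=> Lf; apply: eq_to_l2; [apply: L2N; exact: l2_L2|exact: L2N|].
by apply: (aeq_op1 (fun z => - z)); exact: to_l2_ae.
Qed.

Lemma l2_ind (P : l2 -> Prop) : (forall f, L2 f -> P (to_l2 f)) -> forall x, P x.
Proof. by move=> h x; rewrite -(l2funK x); apply: h; exact: l2_L2. Qed.

Lemma l2_addA : associative l2_add.
Proof.
elim/l2_ind => f Lf; elim/l2_ind => g Lg; elim/l2_ind => h Lh.
rewrite !to_l2_add//; try exact: L2D.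
by congr to_l2; apply/funext => t; rewrite addrA.
Qed.

Lemma l2_addC : commutative l2_add.
Proof.
elim/l2_ind => f Lf; elim/l2_ind => g Lg; rewrite !to_l2_add//.
by congr to_l2; apply/funext => t; rewrite addrC.
Qed.

Lemma l2_add0 : left_id (to_l2 (fun=> 0)) l2_add.
Proof.
elim/l2_ind => f Lf; rewrite !to_l2_add//; last exact: L2_0.
by congr to_l2; apply/funext => t; rewrite add0r.
Qed.

Lemma l2_addN : left_inverse (to_l2 (fun=> 0)) l2_opp l2_add.
Proof.
elim/l2_ind => f Lf; rewrite to_l2_opp// to_l2_add//; last exact: L2N.
by congr to_l2; apply/funext => t; rewrite addNr.
Qed.

HB.instance Definition _ := GRing.isZmodule.Build l2 l2_addA l2_addC l2_add0 l2_addN.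

Lemma l2_scaleA a b x : l2_scale a (l2_scale b x) = l2_scale (a * b) x.
Proof.
elim/l2_ind: x => f Lf; rewrite /l2_scale !to_l2_cscale//; last exact: L2Z.
by congr to_l2; apply/funext => t; rewrite mulrA -rmorphM.
Qed.

Lemma l2_scale1 : left_id 1 l2_scale.
Proof.
elim/l2_ind => f Lf; rewrite /l2_scale to_l2_cscale//.
by congr to_l2; apply/funext => t; rewrite mul1r.
Qed.

Lemma l2_scaleDr : right_distributive l2_scale +%R.
Proof.
move=> a; elim/l2_ind => f Lf; elim/l2_ind => g Lg.
rewrite /l2_scale /GRing.add/= !(to_l2_add, to_l2_cscale)//; try exact: L2Z; try exact: L2D.
by congr to_l2; apply/funext => t; rewrite mulrDr.
Qed.

Lemma l2_scaleDl x : {morph l2_scale^~ x : a b / a + b}.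
Proof.
move=> a b; elim/l2_ind: x => f Lf.
rewrite /l2_scale [RHS]/GRing.add/= !(to_l2_add, to_l2_cscale)//; try exact: L2Z.
by congr to_l2; apply/funext => t; rewrite rmorphD mulrDl.
Qed.

HB.instance Definition _ := GRing.Zmodule_isLmodule.Build R l2 l2_scaleA l2_scale1 l2_scaleDr l2_scaleDl.

Lemma to_l2D f g : L2 f -> L2 g -> to_l2 (fun t => f t + g t) = to_l2 f + to_l2 g.
Proof. by move=> Lf Lg; rewrite -to_l2_add. Qed.

Lemma to_l2N f : L2 f -> to_l2 (fun t => - f t) = - to_l2 f.
Proof. by move=> Lf; rewrite -to_l2_opp. Qed.

Lemma to_l2B f g : L2 f -> L2 g -> to_l2 (fun t => f t - g t) = to_l2 f - to_l2 g.
Proof. by move=> Lf Lg; rewrite to_l2D ?to_l2N//; exact: L2N. Qed.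

Lemma to_l2Z (a : R) f : L2 f -> to_l2 (fun t => real_complex R a * f t) = a *: to_l2 f.
Proof. by move=> Lf; rewrite -to_l2_cscale. Qed.

Lemma to_l2_0 : to_l2 (fun=> 0) = 0. Proof. by []. Qed.

Definition l2_ip (x y : l2) : R := cip mu x y.

Lemma l2_ipE f g : L2 f -> L2 g -> l2_ip (to_l2 f) (to_l2 g) = cip mu f g.
Proof.
by move=> Lf Lg; apply: eq_cip => //; try exact: l2_L2; exact: to_l2_ae.
Qed.

Lemma l2_ip_csq f : L2 f -> (l2_ip (to_l2 f) (to_l2 f))%:E = csq mu f.
Proof. by move=> Lf; rewrite l2_ipE// cip_csq. Qed.

Lemma l2_hilbert : hilbert l2_ip.
Proof.
split.
- by move=> x y; exact: cipC.
- move=> x y z; elim/l2_ind: x => f Lf; elim/l2_ind: y => g Lg; elim/l2_ind: z => h Lh.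
  by rewrite -to_l2D// !l2_ipE ?cipDl//; exact: L2D.
- move=> a x z; elim/l2_ind: x => f Lf; elim/l2_ind: z => h Lh.
  by rewrite -to_l2Z// !l2_ipE ?cipZl//; exact: L2Z.
- by move=> x; rewrite -lee_fin /l2_ip cip_csq ?csq_ge0//; exact: l2_L2.
- move=> x x0; have Lx := l2_L2 x.
  have /csq_eq0 : csq mu x = 0%E by rewrite -cip_csq// -/(l2_ip x x) x0.
  move=> /(_ (L2_meas Lx)) h; rewrite -(l2funK x) -to_l2_0.
  by apply: eq_to_l2 => //; exact: L2_0.
move=> u a a0 ua.
have ip_ge0 x : 0 <= l2_ip x x.
  by rewrite -lee_fin /l2_ip cip_csq ?csq_ge0//; exact: l2_L2.
have nrm2 x : hnorm l2_ip x ^+ 2 = l2_ip x x by rewrite sqr_sqrtr.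
(* The modulus is squared because [csq] is a squared norm. *)
have [| | |g Lg gP] := @riesz_fischer _ _ _ mu (fun n => u n : T -> R[i]) (fun m => a m ^+ 2).
- by move=> n; exact: l2_L2.
- have h : a k * a k @[k --> \oo] --> (0 * 0 : R) by exact: cvgM.
  by rewrite mulr0 in h; under eq_fun do rewrite expr2.
- move=> m n mn; have := ua m n mn.
  rewrite -l2_ip_csq; last by apply: L2B; exact: l2_L2.
  rewrite to_l2B ?l2funK; try exact: l2_L2.
  move=> h; rewrite lee_fin -nrm2 ler_pXn2r// nnegrE ?sqrtr_ge0//.
  by apply: le_trans h; exact: sqrtr_ge0.
exists (to_l2 g).
apply: (@squeeze_cvgr _ _ _ _ (fun=> 0) a) => //; last exact: cvg_cst.
apply: nearW => n; rewrite sqrtr_ge0/=.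
have an : 0 <= a n by apply: le_trans (ua n n (leqnn n)); exact: sqrtr_ge0.
rewrite -(@ler_pXn2r _ 2) ?nnegrE ?sqrtr_ge0// nrm2 -lee_fin.
apply: le_trans (gP n); rewrite le_eqVlt; apply/orP; left; apply/eqP.
have -> : u n - to_l2 g = to_l2 (fun x => u n x - g x) by rewrite to_l2B ?l2funK//; exact: l2_L2.
rewrite l2_ip_csq; last by apply: L2B => //; exact: l2_L2.
apply: eq_integral => x _; rewrite -[X in cmod2 X]opprB cmod2N//.
Qed.

Definition l2_mulI (x : l2) : l2 := l2_cscale (Complex 0 1) x.

Lemma l2_mulI_to_l2 f : L2 f -> l2_mulI (to_l2 f) = to_l2 (fun t => Complex 0 1 * f t).
Proof. exact: to_l2_cscale. Qed.

Lemma l2_mulI_linear (a : R) x y : l2_mulI (a *: x + y) = a *: l2_mulI x + l2_mulI y.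
Proof.
elim/l2_ind: x => f Lf; elim/l2_ind: y => g Lg.
have Lz (h : T -> R[i]) : L2 h -> L2 (fun x => Complex 0 1 * h x) by exact: L2Z.
rewrite -to_l2Z// -to_l2D//; last exact: L2Z.
rewrite /l2_mulI !to_l2_cscale//; last by apply: L2D => //; exact: L2Z.
rewrite -(to_l2Z a (Lz _ Lf)) -(to_l2D _ (Lz _ Lg)); last by apply: L2Z; exact: Lz.
by congr to_l2; apply/funext => t; rewrite mulrDr mulrCA.
Qed.

Lemma l2_ip_mulI x y : l2_ip (l2_mulI x) (l2_mulI y) = l2_ip x y.
Proof.
elim/l2_ind: x => f Lf; elim/l2_ind: y => g Lg.
rewrite /l2_mulI !to_l2_cscale// !l2_ipE//; try exact: L2Z.
by apply: eq_Rintegral => t _; case: (f t) (g t) => a b [c e]; rewrite /cdot/=; ring.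
Qed.

Lemma l2_mulI_mulI x : l2_mulI (l2_mulI x) = - x.
Proof.
elim/l2_ind: x => f Lf; rewrite /l2_mulI !to_l2_cscale//; last exact: L2Z.
rewrite -to_l2N//; congr to_l2; apply/funext => t; rewrite mulrA.
by case: (f t) => a b; congr Complex => /=; ring.
Qed.

Lemma inner_l2 f g : L2 f -> L2 g ->
  inner mu setT f g = Complex (l2_ip (to_l2 f) (to_l2 g)) (l2_ip (to_l2 f) (l2_mulI (to_l2 g))).
Proof.
move=> Lf Lg; rewrite /l2_mulI to_l2_cscale// !l2_ipE//; last exact: L2Z.
rewrite /inner /cintegral; congr Complex; apply: eq_Rintegral => t _;
  by rewrite mulr_conjcE.
Qed.

Lemma L2norm_l2 f : L2 f -> L2norm mu setT f = (hnorm l2_ip (to_l2 f))%:E.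
Proof.
move=> Lf; rewrite L2norm_csq -l2_ip_csq// poweR_EFin; congr (_%:E).
by rewrite powR12_sqrt// -lee_fin l2_ip_csq// csq_ge0.
Qed.

Variable W : set (T -> R[i]).
Hypothesis cW : closed_subspace mu W.

(** The constant sequence f converges to g in norm, so closedness already makes W stable under
    almost everywhere equality and lets it descend to [l2]. *)
Lemma closed_subspace_ae f g : L2 g -> W f -> aeq f g -> W g.
Proof.
case: cW => WL _ _ Wlim Lg Wf fg.
suff h : L2norm mu setT (fun x => f x - g x) = 0%E.
  apply: (Wlim (fun _ : nat => f) g (fun=> Wf) Lg).
  by rewrite h; exact: cvg_cst.
have Lfg : L2 (fun x => f x - g x) by apply: L2B => //; exact: WL.
rewrite L2norm_l2// to_l2B//; last exact: WL.
by rewrite (eq_to_l2 (WL _ Wf) Lg fg) subrr hnorm0//; exact: l2_hilbert.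
Qed.

Lemma l2_closed_subspace : closed_subspace_of l2_ip [set x : l2 | W x].
Proof.
have [WL W0 WD Wlim] := cW; split.
- apply: (closed_subspace_ae _ W0); first exact: l2_L2.
  by apply: aeq_sym; apply: to_l2_ae; exact: L2_0.
- move=> a x y Wx Wy /=.
  have Lx := l2_L2 x; have Ly := l2_L2 y.
  apply: (closed_subspace_ae (l2_L2 (a *: x + y)) (WD (real_complex R a) _ _ Wx Wy)).
  rewrite -[in X in aeq _ X](l2funK x) -[in X in aeq _ X](l2funK y).
  rewrite -to_l2Z// -to_l2D//; last exact: L2Z.
  by apply: aeq_sym; apply: to_l2_ae; apply: L2D => //; exact: L2Z.
move=> u l Wu ul; apply: (Wlim (fun k => u k)) => //; first exact: l2_L2.
have e k : L2norm mu setT (fun x => u k x - l x) = (hnorm l2_ip (u k - l))%:E.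
  rewrite L2norm_l2; last by apply: L2B; exact: l2_L2.
  by rewrite to_l2B ?l2funK//; exact: l2_L2.
by rewrite (funext e); apply: cvg_EFin; [exact: nearW|exact: ul].
Qed.

End L2_space.

(** * The affine Weyl-Heisenberg group *)

Section aWH_group.
Variables (R : realType) (n : nat).
Local Notation E := (aWH_type R n).
Implicit Types (x xi : 'cV[R]_n) (h : 'M[R]_n).

Lemma expiD (a b : R) : expi (a + b) = expi a * expi b.
Proof. by rewrite /expi cosD sinD; congr Complex; ring. Qed.

Lemma expi0 : expi (0 : R) = 1.
Proof. by rewrite /expi cos0 sin0. Qed.

Lemma expiN (a : R) : expi (- a) = conjc (expi a).
Proof. by rewrite /expi cosN sinN. Qed.

Lemma cmod2_expi (a : R) : cmod2 (expi a) = 1.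
Proof. by rewrite /cmod2/= cos2Dsin2. Qed.

Lemma dotDl x y xi : dot (x + y) xi = dot x xi + dot y xi.
Proof. by rewrite /dot -big_split; apply: eq_bigr => i _; rewrite mxE mulrDl. Qed.

Lemma dotC x xi : dot x xi = dot xi x.
Proof. by apply: eq_bigr => i _; rewrite mulrC. Qed.

Lemma dotDr x y xi : dot xi (x + y) = dot xi x + dot xi y.
Proof. by rewrite dotC dotDl !(dotC xi). Qed.

Lemma dotNr x xi : dot xi (- x) = - dot xi x.
Proof. by rewrite /dot -sumrN; apply: eq_bigr => i _; rewrite mxE mulrN. Qed.

Lemma dot0r xi : dot xi 0 = 0.
Proof. by rewrite /dot big1// => i _; rewrite mxE mulr0. Qed.

Lemma dot_tr h x xi : dot (h^T *m x) xi = dot x (h *m xi).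
Proof.
have dotE y z : dot y z = (y^T *m z) 0 0.
  by rewrite mxE; apply: eq_bigr => i _; rewrite mxE.
by rewrite !dotE trmx_mul trmxK mulmxA.
Qed.

Lemma chiC x xi : chi x xi = chi xi x. Proof. by rewrite /chi dotC. Qed.

Lemma chiDr xi x y : chi xi (x + y) = chi xi x * chi xi y.
Proof. by rewrite /chi dotDr mulrDr expiD. Qed.

Lemma chiDl xi x y : chi (x + y) xi = chi x xi * chi y xi.
Proof. by rewrite !(chiC _ xi) chiDr. Qed.

Lemma chiNr xi x : chi xi (- x) = conjc (chi xi x).
Proof. by rewrite /chi dotNr mulrN expiN. Qed.

Lemma chi0r xi : chi xi 0 = 1.
Proof. by rewrite /chi dot0r mulr0 expi0. Qed.

Lemma chi_tr h x xi : chi (h^T *m x) xi = chi x (h *m xi).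
Proof. by rewrite /chi dot_tr. Qed.

Lemma cmod2_chi x xi : cmod2 (chi x xi) = 1.
Proof. exact: cmod2_expi. Qed.

Lemma mulr_conjc (z : R[i]) : z * conjc z = real_complex R (cmod2 z).
Proof. by case: z => a b; congr Complex; rewrite /cmod2/=; ring. Qed.

Lemma norm1_cmod2 (z : R[i]) : `|z| = 1 -> cmod2 z = 1.
Proof.
move=> z1; have : Normc.normc z = 1 by have := congr1 (@complex.Re R) z1.
by rewrite -normc_sqr => ->; rewrite expr1n.
Qed.

Lemma cmod2_norm1 (z : R[i]) : cmod2 z = 1 -> `|z| = 1.
Proof. by case: z => a b; rewrite /cmod2/= => z1; congr Complex; rewrite /= z1 sqrtr1. Qed.

Definition aWH1 : E := (1, 0, 0, 1%:M).

Definition aWH_inv (g : E) : E := let: (z, x, xi, h) := g in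
  (conjc z * chi xi x, - (invmx h *m x), - (h^T *m xi), invmx h).

(** Membership in the full affine Weyl-Heisenberg group, with |z| = 1 expressed through a real
    number. *)
Definition aWH_ok (g : E) := let: (z, _, _, h) := g in cmod2 z = 1 /\ h \in unitmx.

Lemma aWH_okM g1 g2 : aWH_ok g1 -> aWH_ok g2 -> aWH_ok (aWH_mul g1 g2).
Proof.
case: g1 g2 => [[[z1 x1] xi1] h1] [[[z2 x2] xi2] h2] /= [z1E u1] [z2E u2].
by rewrite unitmx_mul u1 u2; split => //; rewrite !cmod2M z1E z2E cmod2_chi !mulr1.
Qed.

Lemma aWH_okV g : aWH_ok g -> aWH_ok (aWH_inv g).
Proof.
case: g => [[[z x] xi] h] /= [zE u].
by rewrite unitmx_inv u; split => //; rewrite cmod2M cmod2_conj zE cmod2_chi mulr1.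
Qed.

Lemma aWH_mulA g1 g2 g3 : aWH_ok g1 -> aWH_ok g2 ->
  aWH_mul (aWH_mul g1 g2) g3 = aWH_mul g1 (aWH_mul g2 g3).
Proof.
case: g1 g2 g3 => [[[z1 x1] xi1] h1] [[[z2 x2] xi2] h2] [[[z3 x3] xi3] h3] /= [_ u1] [_ u2].
congr (_, _, _, _).
- rewrite chiDl !mulmxDr chiDr chi_tr.
  have -> : invmx h1 *m (h1 *m h2 *m x3) = h2 *m x3 by rewrite !mulmxA mulVmx// mul1mx.
  rewrite !mulmxA; ring.
- by rewrite mulmxDr mulmxA addrA.
- have -> : invmx (h1 *m h2) = invmx h2 *m invmx h1.
    have u12 : h1 *m h2 \in unitmx by rewrite unitmx_mul u1.
    apply: (can_inj (mulKmx u12)); rewrite mulmxV// !mulmxA.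
    by rewrite -(mulmxA h1) mulmxV// mulmx1 mulmxV.
  by rewrite trmx_mul mulmxDr addrA mulmxA.
- by rewrite mulmxA.
Qed.

Lemma aWH_mul1 g : aWH_mul aWH1 g = g.
Proof.
case: g => [[[z x] xi] h] /=; rewrite !mul1mx invmx1 trmx1 mul1mx !add0r.
by rewrite chiC chi0r mul1r mulr1.
Qed.

Lemma aWH_mulV g : aWH_ok g -> aWH_mul (aWH_inv g) g = aWH1.
Proof.
case: g => [[[z x] xi] h] /= [z1 u]; congr (_, _, _, _).
- have -> : chi (- (h^T *m xi)) (invmx h *m x) = conjc (chi xi x).
    by rewrite chiC chiNr chiC chi_tr mulmxA mulmxV// mul1mx.
  rewrite (_ : _ * _ = (z * conjc z) * (chi xi x * conjc (chi xi x))); last by ring.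
  by rewrite !mulr_conjc z1 cmod2_chi mulr1.
- by rewrite addNr.
- by rewrite invmxK addNr.
- by rewrite mulVmx.
Qed.

Lemma aWH_mulgV g : aWH_ok g -> aWH_mul g (aWH_inv g) = aWH1.
Proof.
case: g => [[[z x] xi] h] /= [z1 u]; congr (_, _, _, _).
- have -> : chi xi (h *m - (invmx h *m x)) = conjc (chi xi x).
    by rewrite mulmxN mulmxA mulmxV// mul1mx chiNr.
  rewrite (_ : _ * _ = (z * conjc z) * (chi xi x * conjc (chi xi x))); last by ring.
  by rewrite !mulr_conjc z1 cmod2_chi mulr1.
- by rewrite mulmxN mulmxA mulmxV// mul1mx subrr.
- by rewrite mulmxN mulmxA -trmx_mul mulmxV// trmx1 mul1mx subrr.
- by rewrite mulmxV.
Qed.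

Lemma aWH_mulg1 g : aWH_mul g aWH1 = g.
Proof.
case: g => [[[z x] xi] h] /=; rewrite !mulmx0 mulmx1 !addr0.
by rewrite chi0r !mulr1.
Qed.

Lemma aWH_mulK g k : aWH_ok g -> aWH_mul (aWH_inv g) (aWH_mul g k) = k.
Proof. by move=> og; rewrite -aWH_mulA ?aWH_mulV ?aWH_mul1//; exact: aWH_okV. Qed.

Lemma aWH_mulVK g k : aWH_ok g -> aWH_mul g (aWH_mul (aWH_inv g) k) = k.
Proof. by move=> og; rewrite -aWH_mulA ?aWH_mulgV ?aWH_mul1//; exact: aWH_okV. Qed.

Lemma aWH_inv_unique g k : aWH_ok g -> aWH_mul g k = aWH1 -> k = aWH_inv g.
Proof. by move=> og gk; rewrite -(aWH_mulK k og) gk aWH_mulg1. Qed.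

Lemma aWH_invK g : aWH_ok g -> aWH_inv (aWH_inv g) = g.
Proof.
by move=> og; symmetry; apply: aWH_inv_unique; [exact: aWH_okV|exact: aWH_mulV].
Qed.

Lemma aWH_invM g k : aWH_ok g -> aWH_ok k -> aWH_inv (aWH_mul g k) = aWH_mul (aWH_inv k) (aWH_inv g).
Proof.
move=> og ok; symmetry; apply: aWH_inv_unique; first exact: aWH_okM.
by rewrite aWH_mulA// aWH_mulVK// aWH_mulgV.
Qed.

Lemma aWH_mulgK g k : aWH_ok g -> aWH_ok k -> aWH_mul (aWH_mul g k) (aWH_inv k) = g.
Proof. by move=> og ok; rewrite aWH_mulA// aWH_mulgV// aWH_mulg1. Qed.

Lemma aWH_mulgVK g k : aWH_ok g -> aWH_ok k -> aWH_mul (aWH_mul g (aWH_inv k)) k = g.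
Proof. by move=> og ok; rewrite aWH_mulA ?aWH_mulV ?aWH_mulg1//; exact: aWH_okV. Qed.

Section tc.
Variables (V : {vspace 'cV[R]_n}) (H : set 'M[R]_n).
Hypothesis tc : translation_complete V H.
Local Notation G := (tc_group V H).

Lemma tc_ok g : G g -> aWH_ok g.
Proof.
case: g => [[[z x] xi] h] [z1 _ Hh]; split; first exact: norm1_cmod2.
exact: sub_GL (tc.1) _ Hh.
Qed.

Lemma tc_group1 : G aWH1.
Proof. by split; [rewrite normr1|exact: mem0v|exact: sub_GL1 tc.1]. Qed.

Lemma tc_groupM g k : G g -> G k -> G (aWH_mul g k).
Proof.
move=> Gg Gk; have [ok1 ok2] := (tc_ok Gg, tc_ok Gk).
case: g k Gg Gk ok1 ok2 => [[[z1 x1] xi1] h1] [[[z2 x2] xi2] h2] /= [z1E v1 H1] [z2E v2 H2] [c1 _] [c2 _].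
split; first by apply: cmod2_norm1; rewrite !cmod2M c1 c2 cmod2_chi !mulr1.
  by apply: memvD => //; apply: tc.2 => //; exact: sub_GLV tc.1 _ H1.
exact: sub_GLM tc.1 _ _ H1 H2.
Qed.

Lemma tc_groupV g : G g -> G (aWH_inv g).
Proof.
move=> Gg; have := tc_ok Gg; case: g Gg => [[[z x] xi] h] /= [zE v Hh] [c1 _].
split; first by apply: cmod2_norm1; rewrite cmod2M cmod2_conj c1 cmod2_chi mulr1.
  by rewrite memvN; apply: tc.2.
exact: sub_GLV tc.1 _ Hh.
Qed.

End tc.
End aWH_group.

(** * Measurability of the group operations *)

Section aWH_measurability.
Variables (R : realType) (n : nat).
Local Notation E := (aWH_type R n).
Local Notation Rn := (borel 'cV[R]_n).
Local Notation Mn := (borel 'M[R]_n).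

Definition awhz (g : E) : R[i]^o := g.1.1.1.
Definition awhx (g : E) : 'cV[R]_n := g.1.1.2.
Definition awhxi (g : E) : 'cV[R]_n := g.1.2.
Definition awhh (g : E) : 'M[R]_n := g.2.

Lemma measurable_to_aWH d (X : measurableType d) (f : X -> borel E) :
  measurable_fun setT (fun x => complex.Re (awhz (f x))) ->
  measurable_fun setT (fun x => complex.Im (awhz (f x))) ->
  measurable_fun setT (fun x => awhx (f x) : Rn) ->
  measurable_fun setT (fun x => awhxi (f x) : Rn) ->
  measurable_fun setT (fun x => awhh (f x) : Mn) ->
  measurable_fun setT f.
Proof.
move=> mR mI mx mxi mh.
have scc := second_countable_complex R.
have scv := second_countable_mx R n 1.
have scm := second_countable_mx R n n.
have scP := @second_countable_prod _ _.
have m1 : @measurable_fun _ _ X (borel R[i]^o) setT (fun x => awhz (f x)) by exact/measurable_complex_borelP.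
have m2 := measurable_pair_borel scc scv m1 mx.
have m3 := measurable_pair_borel (scP _ _ scc scv) scv m2 mxi.
have m4 := measurable_pair_borel (scP _ _ (scP _ _ scc scv) scv) scm m3 mh.
have e : (fun x => (awhz (f x), awhx (f x), awhxi (f x), awhh (f x))) = f.
  by apply/funext => x; rewrite /awhz /awhx /awhxi /awhh; case: (f x) => [[[]]].
by rewrite -e.
Qed.

Lemma continuous_awhz : continuous (awhz : E -> R[i]^o).
Proof.
have c1 : continuous (fun g : E => g.1) by move=> g; exact: cvg_fst.
have c2 : continuous (fun p : R[i]^o * 'cV[R]_n * 'cV[R]_n => p.1) by move=> g; exact: cvg_fst.
have c3 : continuous (fun p : R[i]^o * 'cV[R]_n => p.1) by move=> g; exact: cvg_fst.
move=> g; exact: (continuous_comp (continuous_comp (@c1 g) (@c2 _)) (@c3 _)).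
Qed.

Lemma measurable_awhz : @measurable_fun _ _ (borel E) (borel R[i]^o) setT awhz.
Proof. exact: (@continuous_borel E _ _ continuous_awhz). Qed.

Lemma continuous_awhx : continuous (awhx : E -> 'cV[R]_n).
Proof.
have c1 : continuous (fun g : E => g.1) by move=> g; exact: cvg_fst.
have c2 : continuous (fun p : R[i]^o * 'cV[R]_n * 'cV[R]_n => p.1) by move=> g; exact: cvg_fst.
have c3 : continuous (fun p : R[i]^o * 'cV[R]_n => p.2) by move=> g; exact: cvg_snd.
move=> g; exact: (continuous_comp (continuous_comp (@c1 g) (@c2 _)) (@c3 _)).
Qed.

Lemma measurable_awhx : @measurable_fun _ _ (borel E) Rn setT awhx.
Proof. exact: (@continuous_borel E _ _ continuous_awhx). Qed.

Lemma continuous_awhxi : continuous (awhxi : E -> 'cV[R]_n).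
Proof.
have c1 : continuous (fun g : E => g.1) by move=> g; exact: cvg_fst.
have c2 : continuous (fun p : R[i]^o * 'cV[R]_n * 'cV[R]_n => p.2) by move=> g; exact: cvg_snd.
move=> g; exact: (continuous_comp (@c1 g) (@c2 _)).
Qed.

Lemma measurable_awhxi : @measurable_fun _ _ (borel E) Rn setT awhxi.
Proof. exact: (@continuous_borel E _ _ continuous_awhxi). Qed.

Lemma continuous_awhh : continuous (awhh : E -> 'M[R]_n).
Proof. by move=> g; exact: cvg_snd. Qed.

Lemma measurable_awhh : @measurable_fun _ _ (borel E) Mn setT awhh.
Proof. exact: (@continuous_borel E _ _ continuous_awhh). Qed.

Section functions.
Context d (X : measurableType d).
Implicit Types (f g : X -> R[i]) (u v : X -> R).

Lemma measurable_expi u : measurable_fun setT u -> cmeasurable setT (fun x => expi (u x)).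
Proof.
move=> mu; split.
  by apply: (measurableT_comp _ mu); apply: continuous_measurable_fun; exact: continuous_cos.
by apply: (measurableT_comp _ mu); apply: continuous_measurable_fun; exact: continuous_sin.
Qed.

Lemma measurable_dot (a b : X -> Rn) : measurable_fun setT a -> measurable_fun setT b ->
  measurable_fun setT (fun x => dot (a x) (b x)).
Proof.
move=> /measurable_mx_borelP ma /measurable_mx_borelP mb.
by apply: measurable_sum => i; exact: measurable_funM.
Qed.

Lemma measurable_chi (a b : X -> Rn) : measurable_fun setT a -> measurable_fun setT b ->
  cmeasurable setT (fun x => chi (a x) (b x)).
Proof.
by move=> ma mb; apply: measurable_expi; apply: measurable_funM => //; exact: measurable_dot.
Qed.

Lemma measurable_det m (a : X -> borel 'M[R]_m) : measurable_fun setT a ->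
  measurable_fun setT (fun x => \det (a x)).
Proof.
move=> /measurable_mx_borelP ma; apply: measurable_sum => s.
by apply: measurable_funM => //; apply: measurable_prod => i _.
Qed.

Lemma measurable_trmx p q (a : X -> borel 'M[R]_(p, q)) : measurable_fun setT a ->
  measurable_fun setT (fun x => (a x)^T : borel 'M[R]_(q, p)).
Proof.
move=> /measurable_mx_borelP ma; apply/measurable_mx_borelP => i j.
by under eq_fun do rewrite mxE; exact: ma.
Qed.

Lemma measurable_invmx (a : X -> Mn) : measurable_fun setT a ->
  measurable_fun setT (fun x => invmx (a x) : Mn).
Proof.
move=> ma; have /measurable_mx_borelP mc := ma.
apply/measurable_mx_borelP => i j.
(* [invmx] returns a singular matrix unchanged; on the others it is given by cofactors. *)
have -> : (fun x => invmx (a x) i j) = (fun x => if \det (a x) == 0 then a x i j else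
    (\det (a x))^-1 * ((-1) ^+ (j + i) * \det (row' j (col' i (a x))))).
  apply/funext => x; rewrite /invmx unitmxE unitfE.
  by case: eqP => //= _; rewrite !mxE /cofactor.
apply: measurable_fun_ifT => //; first by apply: measurable_fun_eqr => //; exact: measurable_det.
apply: measurable_funM; first by apply: measurableT_comp (@measurable_invr R) _; exact: measurable_det.
apply: measurable_funM => //; apply: (@measurable_det n.-1).
by apply/measurable_mx_borelP => k l; under eq_fun do rewrite !mxE; exact: mc.
Qed.

End functions.

Section products.
Context d (X : measurableType d) (f g : X -> borel E).
Hypotheses (mf : measurable_fun setT f) (mg : measurable_fun setT g).

Let fz := (measurable_complex_borelP _).1 (measurableT_comp measurable_awhz mf).
Let gz := (measurable_complex_borelP _).1 (measurableT_comp measurable_awhz mg).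
Let fx := measurableT_comp measurable_awhx mf.
Let gx := measurableT_comp measurable_awhx mg.
Let fxi := measurableT_comp measurable_awhxi mf.
Let gxi := measurableT_comp measurable_awhxi mg.
Let fh := measurableT_comp measurable_awhh mf.
Let gh := measurableT_comp measurable_awhh mg.

Lemma measurable_aWH_mul : measurable_fun setT (fun x => aWH_mul (f x) (g x) : borel E).
Proof.
have mz : cmeasurable setT (fun x => awhz (f x) * awhz (g x) *
    chi (awhxi (f x)) (awhh (f x) *m awhx (g x))).
  apply: cmeasM; first by apply: cmeasM; [exact: fz|exact: gz].
  by apply: measurable_chi; [exact: fxi|exact: measurable_mulmx_fun fh gx].
have e x : aWH_mul (f x) (g x) = (awhz (f x) * awhz (g x) * chi (awhxi (f x)) (awhh (f x) *m awhx (g x)),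
  awhx (f x) + awhh (f x) *m awhx (g x), awhxi (f x) + (invmx (awhh (f x)))^T *m awhxi (g x), awhh (f x) *m awhh (g x)).
  by rewrite /awhz /awhx /awhxi /awhh; case: (f x) (g x) => [[[? ?] ?] ?] [[[? ?] ?] ?].
rewrite (funext e); apply: measurable_to_aWH => /=.
- exact: mz.1.
- exact: mz.2.
- by apply: measurable_addmx_fun; [exact: fx|exact: measurable_mulmx_fun fh gx].
- apply: measurable_addmx_fun; first exact: fxi.
  by apply: measurable_mulmx_fun; [apply: measurable_trmx; exact: measurable_invmx|exact: gxi].
- exact: measurable_mulmx_fun fh gh.
Qed.

Lemma measurable_aWH_inv : measurable_fun setT (fun x => aWH_inv (f x) : borel E).
Proof.
have mz : cmeasurable setT (fun x => conjc (awhz (f x)) * chi (awhxi (f x)) (awhx (f x))).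
  apply: cmeasM; first by apply: cmeas_conj; exact: fz.
  by apply: measurable_chi; [exact: fxi|exact: fx].
have e x : aWH_inv (f x) = (conjc (awhz (f x)) * chi (awhxi (f x)) (awhx (f x)),
  - (invmx (awhh (f x)) *m awhx (f x)), - ((awhh (f x))^T *m awhxi (f x)), invmx (awhh (f x))).
  by rewrite /awhz /awhx /awhxi /awhh; case: (f x) => [[[? ?] ?] ?].
rewrite (funext e); apply: measurable_to_aWH => /=.
- exact: mz.1.
- exact: mz.2.
- apply: measurable_oppmx_fun; apply: measurable_mulmx_fun; [exact: measurable_invmx|exact: fx].
- by apply: measurable_oppmx_fun; apply: measurable_mulmx_fun; [exact: measurable_trmx|exact: fxi].
- exact: measurable_invmx.
Qed.

End products.

End aWH_measurability.

(** * Continuity, compactness and closedness in finite dimension *)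

Section finite_dimensional_continuity.
Variable R : realType.

Lemma continuous_cstR (T : topologicalType) (c : R) : continuous (fun _ : T => c).
Proof. by move=> x; exact: cvg_cst. Qed.

Lemma continuous_mulR (T : topologicalType) (f g : T -> R) :
  continuous f -> continuous g -> continuous (fun x => f x * g x).
Proof. by move=> cf cg x; apply: cvgM; [exact: cf|exact: cg]. Qed.

Lemma continuous_subR (T : topologicalType) (f g : T -> R) :
  continuous f -> continuous g -> continuous (fun x => f x - g x).
Proof. by move=> cf cg x; apply: cvgB; [exact: cf|exact: cg]. Qed.

Lemma continuous_addR (T : topologicalType) (f g : T -> R) :
  continuous f -> continuous g -> continuous (fun x => f x + g x).
Proof. by move=> cf cg x; apply: cvgD; [exact: cf|exact: cg]. Qed.

Lemma continuous_big_sum (T : topologicalType) (I : Type) (r : seq I) (f : I -> T -> R) :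
  (forall i, continuous (f i)) -> continuous (fun x => \sum_(i <- r) f i x).
Proof.
move=> cf; elim: r => [|i r ih] x.
  rewrite (_ : (fun _ => _) = fun=> 0); first exact: cvg_cst.
  by apply/funext => y; rewrite big_nil.
rewrite (_ : (fun _ => _) = fun y => f i y + \sum_(j <- r) f j y).
  by apply: cvgD; [exact: cf|exact: ih].
by apply/funext => y; rewrite big_cons.
Qed.

Lemma continuous_big_prod (T : topologicalType) (I : Type) (r : seq I) (f : I -> T -> R) :
  (forall i, continuous (f i)) -> continuous (fun x => \prod_(i <- r) f i x).
Proof.
move=> cf; elim: r => [|i r ih] x.
  rewrite (_ : (fun _ => _) = fun=> 1); first exact: cvg_cst.
  by apply/funext => y; rewrite big_nil.
rewrite (_ : (fun _ => _) = fun y => f i y * \prod_(j <- r) f j y).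
  by apply: cvgM; [exact: cf|exact: ih].
by apply/funext => y; rewrite big_cons.
Qed.

Lemma continuous_to_mx (T : topologicalType) m n (f : T -> 'M[R]_(m, n)) :
  (forall i j, continuous (fun x => f x i j)) -> continuous f.
Proof.
move=> cf x A [P nP PA].
have h : \forall y \near x, forall ij : 'I_m * 'I_n, P ij.1 ij.2 (f y ij.1 ij.2).
  by apply: filter_forall => -[i j]; exact: cf (nP i j).
by apply: filterS h => y h; apply: PA => i j; exact: (h (i, j)).
Qed.

Lemma continuous_det n : continuous (fun M : 'M[R]_n => \det M).
Proof.
apply: continuous_big_sum => s; apply: continuous_mulR; first exact: continuous_cstR.
by apply: continuous_big_prod => i; exact: coord_continuous.
Qed.

Lemma compact_mx_box m n (k : R) : compact [set M : 'M[R]_(m, n) | forall i j, `|M i j| <= k].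
Proof.
have h := @rV_compact R (m * n) (fun=> `[- k, k]%classic) (fun=> @segment_compact R _ _).
have cv : continuous (@vec_mx R m n).
  apply: continuous_to_mx => i j.
  rewrite (_ : (fun _ => _) = (fun M : 'rV[R]_(m * n) => M 0 (mxvec_index i j))).
    exact: coord_continuous.
  by apply/funext => M; rewrite mxE.
have := continuous_compact (continuous_subspaceT cv) h.
congr compact; apply/seteqP; split => [_ [v vk <-] i j|M Mk].
  by rewrite mxE; have := vk (mxvec_index i j); rewrite /= in_itv/= ler_norml.
exists (mxvec M); last by rewrite mxvecK.
move=> l /=; case/mxvec_indexP: l => i j; rewrite mxvecE in_itv/= -ler_norml.
exact: Mk.
Qed.

(** V is the zero set of x |-> [projv V x - x], whose coordinates are linear forms in the entries of
    x. *)
Lemma closed_vspace n (V : {vspace 'cV[R]_n}) : closed [set x : 'cV[R]_n | x \in V].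
Proof.
have cp : continuous (fun x : 'cV[R]_n => projv V x - x).
  apply: continuous_to_mx => i j.
  rewrite (_ : (fun _ => _) = (fun x : 'cV[R]_n =>
      \sum_(l < n) x l 0 * projv V (delta_mx l 0) i j - x i j)).
    apply: continuous_subR; last exact: coord_continuous.
    apply: continuous_big_sum => l; apply: continuous_mulR; last exact: continuous_cstR.
    exact: coord_continuous.
  apply/funext => x; rewrite !mxE; congr (_ - _).
  rewrite {1}(matrix_sum_delta x) linear_sum summxE; apply: eq_bigr => l _.
  by rewrite big_ord1 linearZ/= mxE.
have h i : closed [set x : 'cV[R]_n | (projv V x - x) i 0 = 0].
  apply: (@preimage_closed _ _ (fun x : 'cV[R]_n => (projv V x - x) i 0) [set 0]).
    move=> x _; apply: (@continuous_comp _ _ _ (fun x : 'cV[R]_n => projv V x - x) (fun y => y i 0)); first exact: cp.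
    exact: coord_continuous.
  exact: closed_eq.
have -> : [set x : 'cV[R]_n | x \in V] = \bigcap_i [set x : 'cV[R]_n | (projv V x - x) i 0 = 0].
  apply/seteqP; split => [x /= xV i _ /=|x h0 /=].
    by rewrite projv_id// subrr mxE.
  suff -> : x = projv V x by exact: memv_proj.
  apply/eqP; rewrite eq_sym -subr_eq0; apply/eqP/matrixP => i j.
  by rewrite ord1 [RHS]mxE; exact: h0.
by apply: closed_bigI => i _; exact: h.
Qed.

End finite_dimensional_continuity.

(** * Compact exhaustion and sigma-finiteness of Haar measure *)

Section haar_sigma_finite.
Variables (R : realType) (n : nat).
Local Notation E := (aWH_type R n).
Local Notation awhz := (@awhz R n).
Local Notation awhx := (@awhx R n).
Local Notation awhxi := (@awhxi R n).
Local Notation awhh := (@awhh R n).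
Variables (V : {vspace 'cV[R]_n}) (H : set 'M[R]_n).
Hypothesis tc : translation_complete V H.
Local Notation G := (tc_group V H).

(** The lower bound on |det h| keeps limits away from the singular matrices: H is closed in GL but
    possibly not among all matrices. *)
Definition exhaustion (k : nat) : set E := [set g |
  [/\ cmod2 (awhz g) = 1, awhxi g \in V,
      H (awhh g) /\ k.+1%:R^-1 <= `|\det (awhh g)|,
      (forall i j, `|awhx g i j| <= k%:R) /\ (forall i j, `|awhxi g i j| <= k%:R) &
      forall i j, `|awhh g i j| <= k%:R]].

Lemma closed_exhaustion k : closed (exhaustion k).
Proof.
pose A1 : set E := [set g | cmod2 (awhz g) = 1].
pose A2 : set E := awhxi @^-1` [set x | x \in V].
pose A3 : set E := awhh @^-1` [set h | H h /\ k.+1%:R^-1 <= `|\det h|].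
have c1 : closed A1.
  apply: (@preimage_closed _ _ (fun g : E => cmod2 (awhz g)) [set 1]); last exact: closed_eq.
  have cR : continuous (fun g : E => complex.Re (awhz g)).
    by move=> g; exact: continuous_comp (@continuous_awhz R n g) (@continuous_Re R _).
  have cI : continuous (fun g : E => complex.Im (awhz g)).
    by move=> g; exact: continuous_comp (@continuous_awhz R n g) (@continuous_Im R _).
  have e : (fun g : E => cmod2 (awhz g)) = (fun g => complex.Re (awhz g) * complex.Re (awhz g) +
      complex.Im (awhz g) * complex.Im (awhz g)).
    by apply/funext => g; case: (awhz g) => a b; rewrite /cmod2/= !expr2.
  by rewrite e => g _; apply: (@continuous_addR R E); apply: (@continuous_mulR R E).
have c2 : closed A2.
  apply: preimage_closed; last exact: closed_vspace.
  by move=> g _; exact: continuous_awhxi.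
have c3 : closed A3.
  apply: preimage_closed; first by move=> g _; exact: continuous_awhh.
  move=> h hcl.
  (* The determinant bound passes to the limit point and makes it invertible, so that [closed_in_GL]
     applies. *)
  have hdet : k.+1%:R^-1 <= `|\det h|.
    have cd : closed [set h : 'M[R]_n | k.+1%:R^-1 <= `|\det h|].
      have cn : closed [set y : R | k.+1%:R^-1 <= `|y|].
        apply: (@preimage_closed _ _ (fun y : R => `|y|) [set y | k.+1%:R^-1 <= y]); last exact: closed_ge.
        by move=> y _; exact: (@norm_continuous _ R^o).
      apply: (@preimage_closed _ _ (fun h : 'M[R]_n => \det h) [set y : R | k.+1%:R^-1 <= `|y|]) => //.
      by move=> M _; exact: continuous_det.
    rewrite closure_id in cd; have : closure [set h : 'M[R]_n | k.+1%:R^-1 <= `|\det h|] h.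
      by apply: closure_subset hcl => M [].
    by rewrite -cd.
  split => //; apply: (closed_in_GL tc.1).
    rewrite unitmxE unitfE -normr_gt0; apply: lt_le_trans hdet.
    by rewrite invr_gt0.
  by apply: closure_subset hcl => M [].
pose B m p := [set M : 'M[R]_(m, p) | forall i j, `|M i j| <= k%:R].
have cB m p : closed (B m p).
  by apply: compact_closed; [exact: norm_hausdorff|exact: compact_mx_box].
have cBx : closed ((awhx : E -> 'cV[R]_n) @^-1` B n 1%N).
  by apply: preimage_closed => // g _; exact: continuous_awhx.
have cBxi : closed ((awhxi : E -> 'cV[R]_n) @^-1` B n 1%N).
  by apply: preimage_closed => // g _; exact: continuous_awhxi.
have cBh : closed ((awhh : E -> 'M[R]_n) @^-1` B n n).
  by apply: preimage_closed => // g _; exact: continuous_awhh.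
have -> : exhaustion k = A1 `&` A2 `&` A3 `&` ((awhx : E -> 'cV[R]_n) @^-1` B n 1%N) `&`
   ((awhxi : E -> 'cV[R]_n) @^-1` B n 1%N) `&` ((awhh : E -> 'M[R]_n) @^-1` B n n).
  apply/seteqP; split => g; first by move=> [? ? ? [? ?] ?].
  by move=> [[[[[? ?] ?] ?] ?] ?]; split.
by do 5 (apply: closedI => //).
Qed.

Lemma compact_exhaustion k : compact (exhaustion k).
Proof.
pose Bz : set R[i]^o := (fun p : R * R => Complex p.1 p.2) @` (`[-1, 1] `*` `[-1, 1]).
have cBz : compact Bz.
  apply: continuous_compact; first by apply: continuous_subspaceT; exact: continuous_Complex.
  by apply: compact_setX; exact: segment_compact.
pose B m p := [set M : 'M[R]_(m, p) | forall i j, `|M i j| <= k%:R].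
have cB m p : compact (B m p) by exact: compact_mx_box.
have cbox : compact (Bz `*` B n 1%N `*` B n 1%N `*` B n n : set E) by do 3 (apply: compact_setX => //).
apply: subclosed_compact cbox _; first exact: closed_exhaustion.
move=> [[[[a b] x] xi] h] [/= z1 _ _ [hx hxi] hh]; split => //; split => //; split => //.
exists (a, b) => //=; rewrite !in_itv/=.
have : a ^+ 2 + b ^+ 2 = 1 by [].
have := sqr_ge0 a; have := sqr_ge0 b => b0 a0 ab.
by split; rewrite -ler_norml -(@ler_pXn2r _ 2) ?nnegrE// real_normK ?num_real// expr1n; lra.
Qed.

Lemma exhaustion_cover : G = \bigcup_k exhaustion k.
Proof.
apply/seteqP; split => [g Gg|g [k _ [z1 v [Hh _] _ _]]]; last first.
  case: g z1 v Hh => [[[z x] xi] h] /= z1 v Hh; split => //; exact: cmod2_norm1.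
have := tc_ok tc Gg; case: g Gg => [[[z x] xi] h] /= [_ v Hh] [z1 uh].
have mxb m p (M : 'M[R]_(m, p)) : exists k, forall l, (k <= l)%N -> forall i j, `|M i j| <= l%:R.
  exists (Num.bound (\sum_i \sum_j `|M i j|)) => l kl i j.
  apply: (@le_trans _ _ (\sum_i \sum_j `|M i j|)).
    rewrite (bigD1 i)//= (bigD1 j)//= -addrA lerDl addr_ge0// sumr_ge0// => i' _.
    exact: sumr_ge0.
  apply/ltW; apply: lt_le_trans (archi_boundP _) _; last by rewrite ler_nat.
  by apply: sumr_ge0 => i' _; exact: sumr_ge0.
have [k1 h1] := mxb _ _ x; have [k2 h2] := mxb _ _ xi; have [k3 h3] := mxb _ _ h.
have d0 : 0 < `|\det h| by rewrite normr_gt0 -unitfE -unitmxE.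
pose k4 := Num.bound `|\det h|^-1.
exists (k1 + k2 + k3 + k4)%N => //; split => //=.
- split=> //; rewrite -[leRHS]invrK lef_pV2 ?posrE ?invr_gt0//.
  apply/ltW; apply: lt_le_trans (archi_boundP _) _; first by rewrite invr_ge0.
  by rewrite ler_nat -addnS; apply: leq_trans (leq_addl _ _); rewrite leqnSn.
- by split=> i j; [apply: h1|apply: h2]; rewrite -?addnA ?leq_addr// addnCA leq_addr.
- by move=> i j; apply: h3; rewrite -addnA addnCA leq_addr.
Qed.

Lemma measurable_exhaustion k : measurable (exhaustion k : set (borel E)).
Proof.
rewrite -(setCK (exhaustion k)); apply: measurableC; apply: sub_sigma_algebra.
by apply: closed_openC; exact: closed_exhaustion.
Qed.

Lemma measurable_tc_group : measurable (G : set (borel E)).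
Proof.
rewrite exhaustion_cover; apply: bigcup_measurable => k _; exact: measurable_exhaustion.
Qed.

Lemma exhaustion_sub k : exhaustion k `<=` G.
Proof. by rewrite exhaustion_cover => g gk; exists k. Qed.

Lemma measurable_group_tc : measurable_group (G : set (borel E)) (@aWH_mul R n) (@aWH_inv R n).
Proof.
have ok g := @tc_ok _ _ _ _ tc g; split.
- exact: measurable_tc_group.
- exact: measurable_aWH_mul measurable_fst measurable_snd.
- by apply: (measurable_aWH_inv (f := @id (borel E))); exact: measurable_id.
- by move=> x y; exact: tc_groupM.
- by move=> x; exact: tc_groupV.
- by move=> x y Gx _; apply: aWH_mulK; exact: ok.
- by move=> x Gx; apply: aWH_invK; exact: ok.
- by move=> x y Gx Gy; apply: aWH_invM; exact: ok.
Qed.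

Variable mu : {measure set (borel E) -> \bar R}.
Hypothesis hmu : left_haar G mu.

(** Group identities hold on G only, so preimages computed from them agree on G only; as mu vanishes
    off G, their measures are equal all the same. *)
Lemma haar_null_congr (A B : set (borel E)) : measurable A -> measurable B ->
  A `&` G = B `&` G -> mu A = mu B.
Proof.
move=> mA mB AB.
have mG := measurable_tc_group.
have e (C : set (borel E)) : measurable C -> mu C = mu (C `&` G).
  move=> mC; rewrite -[in LHS](setIT C) -(setUv G) setIUr measureU//.
  - rewrite [X in _ + X](_ : _ = 0%E) ?adde0//.
    apply: (@subset_measure0 _ _ _ mu (C `&` ~` G) (~` G)) => //.
    - by apply: measurableI => //; exact: measurableC.
    - exact: measurableC.
    - exact: haar_supp hmu.
  - exact: measurableI.
  - by apply: measurableI => //; exact: measurableC.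
  - by rewrite setIACA setICr setI0.
by rewrite e// AB -e.
Qed.

(** [left_haar] speaks of images of subsets of G. The image under g^-1 is the preimage under g, and
    both sides can be cut down to G, which gives preimages of arbitrary Borel sets. *)
Lemma haar_left_invariant : left_invariant (G : set (borel E)) (@aWH_mul R n) mu.
Proof.
have ok g := @tc_ok _ _ _ _ tc g.
split=> [|g Gg A mA]; first exact: haar_supp hmu.
have mG := measurable_tc_group.
have Gg' := tc_groupV tc Gg.
have -> : mu A = mu (A `&` G).
  by apply: haar_null_congr => //; [exact: measurableI|rewrite -setIA setIid].
rewrite -(haar_left hmu Gg' (measurableI _ _ mA mG)) ; last by move=> x [].
apply: haar_null_congr.
- exact: (measurable_preimage_fun (measurable_mull measurable_group_tc g) mA).
- have -> : [set aWH_mul (aWH_inv g) a | a in A `&` G] = (aWH_mul g @^-1` (A `&` G)) `&` G.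
    apply/seteqP; split => [_ [a [Aa Ga] <-]|a [[Aa Gga] Ga]]; last first.
      by exists (aWH_mul g a) => //; rewrite aWH_mulK//; exact: ok.
    split; last exact: tc_groupM.
    by rewrite /= aWH_mulVK//; exact: ok.
  apply: measurableI => //.
  exact: (measurable_preimage_fun (measurable_mull measurable_group_tc g) (measurableI _ _ mA mG)).
apply/seteqP; split => a [h Ga]; split => //.
  by exists (aWH_mul g a); [split => //; exact: tc_groupM|rewrite aWH_mulK//; exact: ok].
case: h => b [Ab Gb] <-; by rewrite /= aWH_mulVK//; exact: ok.
Qed.

Lemma haar_sigma_finite : sigma_finite setT mu.
Proof.
exists (fun k => if k is k'.+1 then exhaustion k' else ~` G).
  apply/seteqP; split => // g _; have [Gg|nGg] := pselect (G g); last by exists 0%N.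
  by move: Gg; rewrite exhaustion_cover => -[k _ gk]; exists k.+1.
case=> [|k]; split.
- by apply: measurableC; exact: measurable_tc_group.
- by rewrite (haar_supp hmu) ltry.
- exact: measurable_exhaustion.
- by apply: haar_compact hmu _ _ _; [exact: compact_exhaustion|exact: exhaustion_sub].
Qed.

End haar_sigma_finite.

(** * The quasi-regular representation *)

Section quasiregular.
Variables (R : realType) (n : nat).
Local Notation Rn := (borel 'cV[R]_n).
Local Notation E := (aWH_type R n).
Local Notation leb := (@leb R n).
Local Notation L2 := (L2 leb setT).
Local Notation cmeas := (@cmeasurable _ Rn R setT).
Local Notation aeq := (ae_eq_on leb setT).
Local Notation X := (l2 leb).
Local Notation ip := (@l2_ip _ _ _ leb).
Local Notation J := (@l2_mulI _ _ _ leb).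
Implicit Types (f g : Rn -> R[i]) (F K : X).

Lemma cmod2_real (k : R) : cmod2 (real_complex R k) = k ^+ 2.
Proof. by rewrite /cmod2/= expr0n addr0. Qed.

Lemma quasiregE (z : R[i]) (x xi : 'cV[R]_n) h f y : quasireg (z, x, xi, h) f y =
  z * chi (y - x) xi * real_complex R (Num.sqrt `|\det h|)^-1 * f (invmx h *m y + - (invmx h *m x)).
Proof. by rewrite /quasireg /translation /modulation /dilation mulmxBr !mulrA. Qed.

Lemma cmeas_quasireg (k : E) f : cmeas f -> cmeas (quasireg k f).
Proof.
case: k => [[[z x] xi] h] mf; rewrite (_ : quasireg _ _ = fun y =>
   z * chi (y - x) xi * real_complex R (Num.sqrt `|\det h|)^-1 * f (invmx h *m y + - (invmx h *m x))); last first.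
  by apply/funext => y; rewrite quasiregE.
apply: cmeasM; last first.
  have ma := @measurable_affine R n (invmx h) (- (invmx h *m x)).
  by split; [exact: measurableT_comp mf.1 ma|exact: measurableT_comp mf.2 ma].
apply: cmeasM; last exact: cmeas_cst.
apply: cmeasM; first exact: cmeas_cst.
apply: measurable_chi => //.
by apply: (measurable_addmx_fun (f := id) (g := fun=> - x)).
Qed.

Lemma csq_quasireg (k : E) f : aWH_ok k -> cmeas f -> csq leb (quasireg k f) = csq leb f.
Proof.
case: k => [[[z x] xi] h] [z1 uh] mf.
have d0 : 0 < `|\det h| by rewrite normr_gt0 -unitfE -unitmxE.
have mf2 : measurable_fun setT (fun y => (cmod2 (f y))%:E) by exact: measurable_ecmod2.
have mfa : measurable_fun setT (fun y : Rn => (cmod2 (f (invmx h *m y + - (invmx h *m x))))%:E).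
  exact: (measurableT_comp mf2 (@measurable_affine R n (invmx h) (- (invmx h *m x)))).
transitivity (\int[leb]_y ((`|\det h|^-1)%:E * (cmod2 (f (invmx h *m y + - (invmx h *m x))))%:E))%E.
  apply: eq_integral => y _.
  rewrite quasiregE !cmod2M z1 cmod2_chi cmod2_real exprVn sqr_sqrtr ?normr_ge0// !mul1r.
  by rewrite EFinM.
rewrite (@ge0_integralZl _ _ _ leb setT measurableT _ mfa _ _) => [|y _|]; last 2 first.
- by rewrite lee_fin cmod2_ge0.
- by rewrite lee_fin invr_ge0.
rewrite (integral_leb_affine _ _ mf2); last 2 first.
- by rewrite unitmx_inv.
- by move=> y; rewrite lee_fin cmod2_ge0.
rewrite det_inv normfV invrK muleA -EFinM mulVf ?mul1e//.
exact: lt0r_neq0.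
Qed.

Lemma L2_quasireg (k : E) f : aWH_ok k -> L2 f -> L2 (quasireg k f).
Proof.
move=> ok /L2P[mf fin]; apply/L2P; split; first exact: cmeas_quasireg.
by rewrite csq_quasireg.
Qed.

Lemma quasiregD (k : E) f g :
  quasireg k (fun y => f y + g y) = (fun y => quasireg k f y + quasireg k g y).
Proof. by case: k => [[[z x] xi] h]; apply/funext => y; rewrite !quasiregE mulrDr. Qed.

Lemma quasiregZ (k : E) (a : R[i]) f :
  quasireg k (fun y => a * f y) = (fun y => a * quasireg k f y).
Proof. by case: k => [[[z x] xi] h]; apply/funext => y; rewrite !quasiregE mulrCA. Qed.

Lemma quasiregB (k : E) f g :
  quasireg k (fun y => f y - g y) = (fun y => quasireg k f y - quasireg k g y).
Proof. by case: k => [[[z x] xi] h]; apply/funext => y; rewrite !quasiregE mulrBr. Qed.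

Lemma quasireg_mul (k1 k2 : E) f : aWH_ok k1 -> aWH_ok k2 ->
  quasireg (aWH_mul k1 k2) f = quasireg k1 (quasireg k2 f).
Proof.
case: k1 k2 => [[[z1 x1] xi1] h1] [[[z2 x2] xi2] h2] [_ u1] [_ u2]; apply/funext => y.
rewrite /aWH_mul !quasiregE -!mulmxBr.
have d1 : 0 < `|\det h1| by rewrite normr_gt0 -unitfE -unitmxE.
have -> : invmx (h1 *m h2) = invmx h2 *m invmx h1.
  have u12 : h1 *m h2 \in unitmx by rewrite unitmx_mul u1.
  apply: (can_inj (mulKmx u12)); rewrite mulmxV// !mulmxA.
  by rewrite -(mulmxA h1) mulmxV// mulmx1 mulmxV.
have ey : y - (x1 + h1 *m x2) = h1 *m (invmx h1 *m (y - x1) - x2).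
  by rewrite mulmxBr mulmxA mulmxV// mul1mx opprD addrA.
have -> : invmx h2 *m invmx h1 *m (y - (x1 + h1 *m x2)) = invmx h2 *m (invmx h1 *m (y - x1) - x2).
  by rewrite ey -!mulmxA (mulmxA (invmx h1)) mulVmx// mul1mx.
rewrite det_mulmx normrM sqrtrM ?normr_ge0// invfM rmorphM.
(* The phase in the group law compensates for modulation by xi1 acting at y - x1 on one side and at
   y - x1 - h1 x2 on the other. *)
have ec : chi xi1 (h1 *m x2) * chi (y - (x1 + h1 *m x2)) (xi1 + (invmx h1)^T *m xi2) =
    chi (y - x1) xi1 * chi (invmx h1 *m (y - x1) - x2) xi2.
  rewrite mulrC chiDr (chiC _ ((invmx h1)^T *m xi2)) chi_tr ey mulmxA mulVmx// mul1mx (chiC xi2).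
  rewrite -ey mulrAC -(chiC (h1 *m x2)) -chiDl; congr (chi _ _ * _).
  by rewrite opprD addrA subrK.
rewrite -[z1 * z2 * _ * _]mulrA ec; ring.
Qed.

Lemma quasireg1 f : quasireg (aWH1 R n) f = f.
Proof.
apply/funext => y; by rewrite quasiregE invmx1 !mul1mx subr0 chi0r det1 normr1 sqrtr1 invr1 (_ : real_complex R 1 = 1)// !mul1r.
Qed.

(** The difference has norm 0 and [quasireg] preserves norms; hence the representation descends to
    classes. *)
Lemma aeq_quasireg (k : E) f g : aWH_ok k -> L2 f -> L2 g -> aeq f g ->
  aeq (quasireg k f) (quasireg k g).
Proof.
move=> ok Lf Lg fg.
have Lfg := L2B Lf Lg.
have := @csq_eq0 _ _ _ leb _ (L2_meas (L2_quasireg ok Lfg)).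
rewrite (csq_quasireg ok (L2_meas Lfg)).
rewrite (@csq_ae _ _ _ leb _ (fun=> 0)) => [/(_ _)|||].
- have -> : csq leb (fun=> 0) = 0%E :> \bar R by rewrite /csq integral0_eq// => x _; rewrite cmod2_real expr0n.
  move=> /(_ erefl); apply: filterS => y /(_ I); rewrite quasiregB => /eqP.
  by rewrite subr_eq0 => /eqP.
- exact: L2_meas Lfg.
- exact: cmeas_cst.
- by apply: filterS fg => y /(_ I) ->; rewrite subrr.
Qed.

Definition qpi (k : E) F : X := to_l2 leb (quasireg k F).

Lemma qpi_to_l2 (k : E) f : aWH_ok k -> L2 f -> qpi k (to_l2 leb f) = to_l2 leb (quasireg k f).
Proof.
move=> ok Lf; apply: eq_to_l2; try by [apply: L2_quasireg => //; exact: l2_L2 | exact: L2_quasireg].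
by apply: aeq_quasireg => //; [exact: l2_L2|exact: to_l2_ae].
Qed.

Lemma qpi_linear (k : E) : aWH_ok k -> forall (a : R) F K, qpi k (a *: F + K) = a *: qpi k F + qpi k K.
Proof.
move=> ok a F K; elim/l2_ind: F => f Lf; elim/l2_ind: K => g Lg.
have Lq h : L2 h -> L2 (quasireg k h) by exact: L2_quasireg.
have La : L2 (fun y => real_complex R a * f y) by exact: L2Z.
rewrite -to_l2Z// -to_l2D// !qpi_to_l2//; last exact: L2D.
have Laq : L2 (fun y => real_complex R a * quasireg k f y) by exact/L2Z/Lq.
by rewrite -(to_l2Z a (Lq _ Lf)) -(to_l2D Laq (Lq _ Lg)) quasiregD quasiregZ.
Qed.

Lemma qpi_mulI (k : E) F : aWH_ok k -> qpi k (J F) = J (qpi k F).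
Proof.
move=> ok; elim/l2_ind: F => f Lf.
rewrite /l2_mulI to_l2_cscale// !qpi_to_l2//; last exact: L2Z.
by rewrite to_l2_cscale ?quasiregZ//; exact: L2_quasireg.
Qed.

Lemma qpi_mul (k1 k2 : E) F : aWH_ok k1 -> aWH_ok k2 -> qpi (aWH_mul k1 k2) F = qpi k1 (qpi k2 F).
Proof.
move=> ok1 ok2; elim/l2_ind: F => f Lf.
rewrite !qpi_to_l2 ?quasireg_mul//; [exact: L2_quasireg|exact: aWH_okM].
Qed.

Lemma qpi1 F : qpi (aWH1 R n) F = F.
Proof. by rewrite /qpi quasireg1 l2funK. Qed.

Lemma qpi_sqr (k : E) F : aWH_ok k -> ip (qpi k F) (qpi k F) = ip F F.
Proof.
move=> ok; elim/l2_ind: F => f Lf; apply: EFin_inj.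
by rewrite qpi_to_l2// (l2_ip_csq Lf) (l2_ip_csq (L2_quasireg ok Lf)) (csq_quasireg ok (L2_meas Lf)).
Qed.

Lemma ip_polarization F K : ip F K = (ip (F + K) (F + K) - ip F F - ip K K) / 2.
Proof. by have hX := @l2_hilbert _ _ _ leb; rewrite !(hipE hX) (hipC hX K F); field. Qed.

Lemma qpi_isometry (k : E) F K : aWH_ok k -> ip (qpi k F) (qpi k K) = ip F K.
Proof.
move=> ok; have qD : qpi k (F + K) = qpi k F + qpi k K by rewrite -{1}[F]scale1r qpi_linear// scale1r.
by rewrite ip_polarization -qD !qpi_sqr// -ip_polarization.
Qed.

Lemma qpi_adjoint (k : E) F K : aWH_ok k -> ip (qpi k F) K = ip F (qpi (aWH_inv k) K).
Proof.
move=> ok; rewrite -(qpi_isometry _ _ (aWH_okV ok)) -qpi_mul ?aWH_mulV ?qpi1//.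
exact: aWH_okV.
Qed.

Lemma qpi_hnorm (k : E) F : aWH_ok k -> hnorm ip (qpi k F) = hnorm ip F.
Proof. by move=> ok; rewrite /hnorm qpi_sqr. Qed.

Lemma qpi_bl (k : E) : aWH_ok k -> bounded_linear ip (qpi k).
Proof.
move=> ok; split; first exact: qpi_linear.
by exists 1 => F; rewrite qpi_hnorm// mul1r.
Qed.

Lemma mulI_bl : bounded_linear ip J.
Proof.
split; first exact: l2_mulI_linear.
by exists 1 => F; rewrite /hnorm l2_ip_mulI mul1r.
Qed.

Lemma mulI_skew F K : ip (J F) K = - ip F (J K).
Proof.
by have hX := @l2_hilbert _ _ _ leb; rewrite -[LHS]l2_ip_mulI l2_mulI_mulI !(hipE hX).
Qed.

End quasiregular.

(** * Voice transforms *)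

Lemma measurable_parameter_Rintegral d1 (T1 : measurableType d1) d2 (T2 : measurableType d2)
    (R : realType) (nu : {sigma_finite_measure set T2 -> \bar R}) (h : T1 * T2 -> R) :
  measurable_fun setT h -> measurable_fun setT (fun x => Rintegral nu setT (fun y => h (x, y))).
Proof.
move=> mh; apply: measurableT_comp => //.
under eq_fun do rewrite integralE.
have mEh : measurable_fun setT (fun p => (h p)%:E) by exact/measurable_EFinP.
apply: emeasurable_funB.
  have h1 := @measurable_fun_fubini_tonelli_F _ _ _ _ _ nu _ (measurable_funepos mEh).
  congr (measurable_fun _ _): (h1 (fun p => funepos_ge0 _ p)).
  by apply/funext => x; apply: eq_integral => y _; rewrite !funeposE.
have h1 := @measurable_fun_fubini_tonelli_F _ _ _ _ _ nu _ (measurable_funeneg mEh).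
congr (measurable_fun _ _): (h1 (fun p => funeneg_ge0 _ p)).
by apply/funext => x; apply: eq_integral => y _; rewrite !funenegE.
Qed.

Opaque to_l2 l2_ip l2_mulI qpi tc_group aWH_mul aWH_inv.

Section complex_pairs.
Variable R : realType.
Implicit Types a b c d k : R.

Lemma complexD a b c d : Complex a b + Complex c d = Complex (a + c) (b + d).
Proof. by []. Qed.

Lemma complex_realM k a b : real_complex R k * Complex a b = Complex (k * a) (k * b).
Proof. by congr Complex; rewrite mul0r ?subr0 ?addr0. Qed.

Lemma complex_iM a b : Complex 0 1 * Complex a b = Complex (- b) a.
Proof. by congr Complex; rewrite mul0r mul1r ?sub0r ?add0r. Qed.

End complex_pairs.

Section voices.
Variables (R : realType) (n : nat).
Local Notation Rn := (borel 'cV[R]_n).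
Local Notation E := (aWH_type R n).
Local Notation leb := (@leb R n).
Local Notation L2 := (L2 leb setT).
Local Notation cmeas := (@cmeasurable _ Rn R setT).
Local Notation aeq := (ae_eq_on leb setT).
Local Notation X := (l2 leb).
Local Notation ip := (@l2_ip _ _ _ leb).
Local Notation J := (@l2_mulI _ _ _ leb).
Local Notation pi := (@qpi R n).
Local Notation hX := (@l2_hilbert _ _ _ leb).
Implicit Types (f g : Rn -> R[i]) (F K psi : X).

Lemma cmeas_quasireg_pair f : cmeas f ->
  cmeasurable setT (fun p : borel E * Rn => quasireg p.1 f p.2).
Proof.
move=> mf.
have m1 : measurable_fun setT (fun p : borel E * Rn => p.1) := measurable_fst.
have m2 : measurable_fun setT (fun p : borel E * Rn => p.2) := measurable_snd.
have mz := (measurable_complex_borelP _).1 (measurableT_comp (@measurable_awhz R n) m1).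
have mx := measurableT_comp (@measurable_awhx R n) m1.
have mxi := measurableT_comp (@measurable_awhxi R n) m1.
have mh := measurableT_comp (@measurable_awhh R n) m1.
have mih := measurable_invmx mh.
have e : (fun p : borel E * Rn => quasireg p.1 f p.2) = (fun p => awhz p.1 *
   chi (p.2 - awhx p.1) (awhxi p.1) * real_complex R (Num.sqrt `|\det (awhh p.1)|)^-1 *
   f (invmx (awhh p.1) *m p.2 + - (invmx (awhh p.1) *m awhx p.1))).
  by apply/funext => -[[[[z x] xi] h] y]; rewrite quasiregE.
rewrite e; apply: cmeasM.
  apply: cmeasM.
    apply: cmeasM; first exact: mz.
    apply: measurable_chi => //; apply: measurable_addmx_fun => //.
    exact: (measurable_oppmx_fun mx).
  split; last exact: measurable_cst.
  apply: measurableT_comp (@measurable_invr R) _.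
  apply: (measurableT_comp (f := @Num.sqrt R)).
    by apply: continuous_measurable_fun; exact: sqrt_continuous.
  by apply: measurableT_comp => //; exact: measurable_det.
have ma : measurable_fun setT (fun p : borel E * Rn =>
    invmx (awhh p.1) *m p.2 + - (invmx (awhh p.1) *m awhx p.1) : Rn).
  apply: (measurable_addmx_fun (f := fun p : borel E * Rn => invmx (awhh p.1) *m p.2 : Rn)).
    exact: (measurable_mulmx_fun mih m2).
  by apply: measurable_oppmx_fun; exact: (measurable_mulmx_fun mih mx).
by split; [exact: measurableT_comp mf.1 ma|exact: measurableT_comp mf.2 ma].
Qed.

Lemma measurable_cip_quasireg f g : cmeas f -> cmeas g ->
  measurable_fun setT (fun k : borel E => cip leb f (quasireg k g)).
Proof.
move=> mf mg; have mp := cmeas_quasireg_pair mg.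
apply: (@measurable_parameter_Rintegral _ _ _ _ _ leb (fun p : borel E * Rn => cdot (f p.2) (quasireg p.1 g p.2))).
apply: measurable_cdot => //.
have m2 : measurable_fun setT (fun p : borel E * Rn => p.2) := measurable_snd.
by split; [exact: measurableT_comp mf.1 m2|exact: measurableT_comp mf.2 m2].
Qed.

Section tc_voices.
Variables (V : {vspace 'cV[R]_n}) (H : set 'M[R]_n).
Hypothesis tc : translation_complete V H.
Local Notation G := (tc_group V H).
Local Notation ok := (tc_ok tc).

(** Extended by 0 off G, as mu lives on the ambient space: voices become elements of L2 over the
    whole type, where the quotient and its completeness are available. *)
Definition voR psi F (k : borel E) : R := if k \in G then ip F (pi k psi) else 0.

(* As pi k commutes with i, the imaginary part <F, i pi(k) psi> is voR of i psi. *)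
Definition vo psi F (k : borel E) : R[i] := Complex (voR psi F k) (voR (J psi) F k).

Lemma measurable_voR psi F : measurable_fun setT (voR psi F).
Proof.
have -> : voR psi F = (fun k => \1_G k * cip leb F (quasireg k psi)).
  apply/funext => k; rewrite /voR indicE; case: ifPn => [|_]; last by rewrite mul0r.
  rewrite inE mul1r => /ok okk.
  apply: eq_cip; try exact: l2_L2; try by [exact: aeq_refl].
    by apply: L2_quasireg => //; exact: l2_L2.
  by apply: to_l2_ae; apply: L2_quasireg => //; exact: l2_L2.
apply: measurable_funM; first by apply: measurable_indic; exact: measurable_tc_group tc.
by apply: measurable_cip_quasireg; apply: L2_meas; exact: l2_L2.
Qed.

Lemma cmeas_vo psi F : cmeasurable setT (vo psi F).
Proof. by split; exact: measurable_voR. Qed.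

Lemma voE psi F k : G k -> vo psi F k = Complex (ip F (pi k psi)) (ip F (J (pi k psi))).
Proof. by move=> Gk; rewrite /vo /voR mem_set// qpi_mulI//; exact: ok. Qed.

Lemma vo_out psi F k : ~ G k -> vo psi F k = 0.
Proof. by move=> Gk; rewrite /vo /voR memNset. Qed.

Lemma voPl (a : R) psi F K k : vo psi (a *: F + K) k = real_complex R a * vo psi F k + vo psi K k.
Proof.
have [Gk|Gk] := pselect (G k); last by rewrite !vo_out ?mulr0 ?addr0.
by rewrite !(voE _ _ Gk) complex_realM complexD !(hipE hX).
Qed.

Lemma vo_mulI psi F k : vo psi (J F) k = Complex 0 1 * vo psi F k.
Proof.
have [Gk|Gk] := pselect (G k); last by rewrite !vo_out// mulr0.
by rewrite !(voE _ _ Gk) mulI_skew l2_ip_mulI complex_iM.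
Qed.

Lemma vo_translate psi F h k : G h -> vo psi (pi h F) k = vo psi F (aWH_mul (aWH_inv h) k).
Proof.
move=> Gh; have [Gk|Gk] := pselect (G k).
  have Gh' := tc_groupV tc Gh; have okh' := ok Gh'.
  rewrite (voE _ _ Gk) (voE _ _ (tc_groupM tc Gh' Gk)) !(qpi_adjoint _ _ (ok Gh)).
  by rewrite (qpi_mul _ okh' (ok Gk)) (qpi_mulI _ okh').
rewrite (vo_out _ _ Gk) vo_out// => Gk'; apply: Gk.
by rewrite -(aWH_mulVK k (ok Gh)); exact: tc_groupM.
Qed.

Lemma vo_qpi psi F h k : G h -> G k -> vo (pi h psi) F k = vo psi F (aWH_mul k h).
Proof.
move=> Gh Gk; rewrite (voE _ _ Gk) (voE _ _ (tc_groupM tc Gk Gh)).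
by rewrite (qpi_mul _ (ok Gk) (ok Gh)).
Qed.

(** Moves an operator from the analysing vector to the argument: the voice of B_k psi at F is that
    of psi at B_k F. *)
Lemma vo_selfadjoint A psi F k : adjoint_pair ip A A -> commuting A J ->
  (forall h, G h -> commuting A (pi h)) -> vo (A psi) F k = vo psi (A F) k.
Proof.
move=> sA AJ Api; have [Gk|Gk] := pselect (G k); last by rewrite !(vo_out _ _ Gk).
by rewrite !(voE _ _ Gk) -(Api _ Gk) -AJ -!sA.
Qed.

Lemma voZr (a : R) psi F k : vo (a *: psi) F k = real_complex R a * vo psi F k.
Proof.
have [Gk|Gk] := pselect (G k); last by rewrite !vo_out// mulr0.
by rewrite !(voE _ _ Gk) (blZ (qpi_bl (ok Gk))) (blZ (@mulI_bl R n)) !(hipE hX) complex_realM.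
Qed.

Lemma voDr psi psi' F k : vo (psi + psi') F k = vo psi F k + vo psi' F k.
Proof.
have [Gk|Gk] := pselect (G k); last by rewrite !vo_out// addr0.
by rewrite !(voE _ _ Gk) (blD (qpi_bl (ok Gk))) (blD (@mulI_bl R n)) !(hipE hX) complexD.
Qed.

Lemma vo0l psi k : vo psi 0 k = 0.
Proof.
have := voPl (-1) psi 0 0 k; rewrite scaler0 addr0 => e.
by rewrite e rmorphN rmorph1 mulN1r addNr.
Qed.

Lemma vo0r F k : vo 0 F k = 0.
Proof. by rewrite -[0](scale0r (0 : X)) voZr mul0r. Qed.

Lemma voice_vo f g k : L2 f -> L2 g -> G k ->
  voice g f k = vo (to_l2 leb g) (to_l2 leb f) k.
Proof.
move=> Lf Lg Gk; rewrite (voE _ _ Gk) /voice (inner_l2 Lf (L2_quasireg (ok Gk) Lg)).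
by rewrite (qpi_to_l2 (ok Gk) Lg).
Qed.

Lemma vo_lim (u : nat -> X) psi F k : hlim ip u psi ->
  cmod2 (vo (u m) F k) @[m --> \oo] --> cmod2 (vo psi F k).
Proof.
move=> ul; have [Gk|Gk] := pselect (G k); last first.
  by under eq_fun do rewrite vo_out//; rewrite vo_out//; exact: cvg_cst.
have h1 := hlim_bl (qpi_bl (ok Gk)) ul.
have h2 := hlim_bl (@mulI_bl R n) h1.
rewrite (voE _ _ Gk) {2}/cmod2/= (_ : (fun m => _) = fun m => ip (pi k (u m)) F * ip (pi k (u m)) F +
   ip (J (pi k (u m))) F * ip (J (pi k (u m))) F); last first.
  by apply/funext => m; rewrite (voE _ _ Gk) /cmod2/= !expr2 !(hipC hX F).
rewrite !expr2 !(hipC hX F).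
have p1 := hlim_ip hX (y := F) h1.
have p2 := hlim_ip hX (y := F) h2.
exact: (cvgD (cvgM p1 p1) (cvgM p2 p2)).
Qed.

End tc_voices.
End voices.

(** * Haar measure of a translation complete subgroup *)

Lemma pullback_form_operator (R : realType) (X Y : lmodType R) (ip : X -> X -> R) (ipY : Y -> Y -> R)
    (A A' : X -> Y) (C C' : R) : hilbert ip -> hilbert ipY ->
  (forall (a : R) x y, A (a *: x + y) = a *: A x + A y) ->
  (forall (a : R) x y, A' (a *: x + y) = a *: A' x + A' y) ->
  (forall x, hnorm ipY (A x) <= C * hnorm ip x) ->
  (forall x, hnorm ipY (A' x) <= C' * hnorm ip x) ->
  exists2 T, bounded_linear ip T & forall x y, ip (T x) y = ipY (A x) (A' y).
Proof.
move=> hX hY lA lA' bA bA'; apply: form_operator => //.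
- by move=> a x y z; rewrite lA !(hipE hY).
- by move=> a x y z; rewrite lA' !(hipE hY).
exists (C * C') => x y; apply: le_trans (hcauchy_schwarz hY _ _) _.
by rewrite mulrACA; apply: ler_pM => //; exact: sqrtr_ge0.
Qed.

Section haar_voices.
Variables (R : realType) (n : nat).
Local Notation Rn := (borel 'cV[R]_n).
Local Notation E := (aWH_type R n).
Local Notation leb := (@leb R n).
Local Notation X := (l2 leb).
Local Notation ip := (@l2_ip _ _ _ leb).
Local Notation J := (@l2_mulI _ _ _ leb).
Local Notation pi := (@qpi R n).
Local Notation hX := (@l2_hilbert _ _ _ leb).
Variables (V : {vspace 'cV[R]_n}) (H : set 'M[R]_n).
Hypothesis tc : translation_complete V H.
Local Notation G := (tc_group V H).
Local Notation ok := (tc_ok tc).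
Local Notation vo := (vo V H).
Variable mu : {measure set (borel E) -> \bar R}.
Hypothesis hmu : left_haar G mu.
Implicit Types (F K psi : X).

Let mG := measurable_tc_group tc.

Lemma haar_ae (P : E -> Prop) : (forall k, G k -> P k) -> {ae mu, forall k, P k}.
Proof.
move=> h; exists (~` G); split; first exact: measurableC.
  exact: haar_supp hmu.
by move=> k; apply: contra_not; exact: h.
Qed.

Lemma csq_left_translate h (f : borel E -> R[i]) : G h -> cmeasurable setT f ->
  csq mu (fun k => f (aWH_mul h k)) = csq mu f.
Proof.
move=> Gh mf.
apply: (integral_left_invariant (measurable_group_tc tc) (haar_left_invariant tc hmu) Gh (measurable_ecmod2 mf)).
by move=> k; rewrite lee_fin cmod2_ge0.
Qed.

Lemma measurable_right_translate h : measurable_fun setT (fun k : borel E => aWH_mul k h : borel E).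
Proof. by apply: (measurable_aWH_mul (f := id) (g := fun=> h)). Qed.

(** c is the value at h of the modular function, in the convention for which the voices of pi(h) psi
    have c times the squared norm of those of psi. *)
Definition right_scaling h (c : R) := 0 < c /\
  forall A : set (borel E), measurable A -> mu ((fun k => aWH_mul k h) @^-1` A) = (c%:E * mu A)%E.

Lemma csq_right_translate h c psi F : G h -> right_scaling h c ->
  csq mu (vo (pi h psi) F) = (c%:E * csq mu (vo psi F))%E.
Proof.
move=> Gh [c0 hc].
have mv : cmeasurable setT (fun k : borel E => vo psi F (aWH_mul k h)).
  have [m1 m2] := cmeas_vo tc psi F.
  by split; [exact: measurableT_comp m1 (measurable_right_translate h)|exact: measurableT_comp m2 (measurable_right_translate h)].
have e : csq mu (vo (pi h psi) F) = csq mu (fun k => vo psi F (aWH_mul k h)).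
  apply: (csq_ae (cmeas_vo tc (pi h psi) F) mv).
  by apply: haar_ae => k Gk _; exact: (vo_qpi tc psi F Gh Gk).
apply: etrans e _.
apply: (scaled_measure_integral (f := fun k => (cmod2 (vo psi F k))%:E) (ltW c0) (measurable_right_translate h) hc).
  by apply: measurable_ecmod2; exact: cmeas_vo.
by move=> k; rewrite lee_fin cmod2_ge0.
Qed.

Lemma haar_finite_set : exists A : set (borel E), [/\ measurable A, mu A != 0%E & (mu A < +oo)%E].
Proof.
have [F FT /all_and2[mF Foo]] := haar_sigma_finite tc hmu.
have [[i Fi]|F0] := pselect (exists i, mu (F i) != 0%E); first by exists (F i); split.
have muT : mu setT = 0%E.
  have : mu.-negligible (\bigcup_i F i).
    apply: negligible_bigcup => i; exists (F i); split => //.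
    by apply/eqP; apply: contra_notT F0 => Fi; exists i.
  by rewrite -FT => /negligibleP; apply.
have := haar_neq0 hmu; rewrite (_ : mu G = 0%E) ?ltxx//.
exact: (@subset_measure0 _ _ _ mu G setT).
Qed.

Lemma haar_setT_neq0 : mu setT != 0%E.
Proof.
rewrite gt_eqF//; apply: lt_le_trans (haar_neq0 hmu) _.
by apply: le_measure; rewrite ?inE.
Qed.

(** Right translation commutes with left translations, so the translated measure is left invariant
    and [haar_unique] makes it a multiple of mu. The multiple is nonzero since mu is. *)
Lemma right_scaling_exists h : G h -> exists c, right_scaling h c.
Proof.
move=> Gh; have Gh' := tc_groupV tc Gh.
have mr := measurable_right_translate h.
have mr' := measurable_right_translate (aWH_inv h).
have mpre k (A : set (borel E)) (mA : measurable A) := measurable_preimage_fun (measurable_right_translate k) mA.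
have ml k (A : set (borel E)) (mA : measurable A) := measurable_preimage_fun (measurable_mull (measurable_group_tc tc) k) mA.
have [nu nuE] := pushforward_measure mu mr.
have [m1 m1E] := as_sigma_finite_measure (haar_sigma_finite tc hmu).
have sfnu : sigma_finite setT nu.
  have [F FT /all_and2[mF Foo]] := haar_sigma_finite tc hmu.
  exists (fun i => (fun k => aWH_mul k (aWH_inv h)) @^-1` F i).
    by rewrite -preimage_bigcup -FT preimage_setT.
  move=> i; split; first exact: mpre.
  rewrite nuE (haar_null_congr tc hmu (B := F i)) ?Foo//.
    by apply: (mpre); exact: mpre.
  by apply/seteqP; split => k [/= + Gk]; rewrite (aWH_mulgK (ok Gk) (ok Gh)).
have [nu1 nu1E] := as_sigma_finite_measure sfnu.
have [l0 l1] := haar_left_invariant tc hmu.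
have lm1 : left_invariant (G : set (borel E)) (@aWH_mul R n) m1.
  by rewrite /left_invariant m1E.
have lnu1 : left_invariant (G : set (borel E)) (@aWH_mul R n) nu1.
  split=> [|g Gg A mA]; rewrite nu1E.
    rewrite nuE (haar_null_congr tc hmu (B := set0)) ?measure0//.
      by apply: mpre; exact: measurableC.
    apply/seteqP; split => k; last by case.
    by case=> nG Gk; exfalso; apply: nG; exact: tc_groupM.
  rewrite !nuE -[RHS](l1 _ Gg); last exact: mpre.
  apply: (haar_null_congr tc hmu); [by apply: mpre; exact: ml|by apply: ml; exact: mpre|].
  by apply/seteqP; split => k [/= + Gk]; rewrite (aWH_mulA _ (ok Gg) (ok Gk)).
have m1T : m1 setT != 0%E by rewrite m1E; exact: haar_setT_neq0.
have [B [mB nuB m1B m1Boo hB]] := haar_unique (measurable_group_tc tc) lnu1 lm1 m1T.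
rewrite m1E in m1B m1Boo hB.
have m1Bf : mu B \is a fin_num by rewrite ge0_fin_numE.
have nuBf : nu1 B \is a fin_num by rewrite ge0_fin_numE.
have b0 : 0 < fine (mu B) by rewrite fine_gt0// lt0e m1B measure_ge0 m1Boo.
exists (fine (nu1 B) / fine (mu B)).
have hA (A : set (borel E)) : measurable A ->
    mu ((fun k => aWH_mul k h) @^-1` A) = ((fine (nu1 B) / fine (mu B))%:E * mu A)%E.
  move=> mA; have := hB A mA; rewrite nu1E nuE => e.
  rewrite [in RHS]mulrC EFinM -muleA -nu1E (fineK nuBf) nu1E -e muleA -{2}(fineK m1Bf) -EFinM mulVf ?mul1e//.
  exact: lt0r_neq0.
split => //; rewrite lt0r; apply/andP; split; last by rewrite divr_ge0 ?fine_ge0.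
apply/eqP => c0; have := hA setT measurableT; rewrite c0 mul0e preimage_setT => /eqP.
by rewrite (negbTE haar_setT_neq0).
Qed.

Lemma right_scalingM h l c d : G h -> G l -> right_scaling h c -> right_scaling l d ->
  right_scaling (aWH_mul h l) (c * d).
Proof.
move=> Gh Gl [c0 hc] [d0 hd]; split; first exact: mulr_gt0.
have mpre k (A : set (borel E)) (mA : measurable A) := measurable_preimage_fun (measurable_right_translate k) mA.
move=> A mA; rewrite EFinM -muleA -hd// -hc; last exact: mpre.
apply: (haar_null_congr tc hmu); [exact: mpre|by apply: (mpre); exact: mpre|].
by apply/seteqP; split => k [/= + Gk]; rewrite (aWH_mulA _ (ok Gk) (ok Gh)).
Qed.

Lemma right_scaling1 c : right_scaling (aWH1 R n) c -> c = 1.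
Proof.
move=> [c0 hc]; have [A [mA A0 Aoo]] := haar_finite_set.
have Af : mu A \is a fin_num by rewrite ge0_fin_numE.
have := hc A mA; rewrite (haar_null_congr tc hmu (B := A))//; last first.
- by apply/seteqP; split => k [/= + Gk]; rewrite aWH_mulg1.
- exact: (measurable_preimage_fun (measurable_right_translate _) mA).
rewrite -{1 2}(fineK Af) -EFinM => -[e].
have a0 : fine (mu A) != 0 by rewrite fine_eq0.
by apply: (mulIf a0); rewrite mul1r -e.
Qed.

(** If every factor were 1, mu itself would be right invariant. A factor different from 1 becomes
    larger than 1 at h or at its inverse, and powers make it arbitrarily large by Bernoulli's
    inequality. *)
Lemma nonunimodular_scaling (M : R) : ~ unimodular G ->
  exists h c, [/\ G h, right_scaling h c & M < c].
Proof.
move=> nuni.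
have [h [c [Gh hc c1]]] : exists h c, [/\ G h, right_scaling h c & c != 1].
  apply: contrapT => ne; apply: nuni; exists mu; split => // g A Gg mA AG.
  have Gg' := tc_groupV tc Gg.
  have [c hc] := right_scaling_exists Gg'.
  have c1 : c = 1 by apply/eqP; apply: contra_notT ne => c1; exists (aWH_inv g), c.
  have [_ /(_ A mA)] := hc; rewrite c1 mul1e => <-.
  have mp := measurable_preimage_fun (measurable_right_translate (aWH_inv g)) mA.
  have e : [set aWH_mul a g | a in A] = ((fun k => aWH_mul k (aWH_inv g)) @^-1` A) `&` G.
    apply/seteqP; split => [_ [a Aa <-]|k [Ak Gk]].
      have Ga := AG _ Aa; split; last exact: tc_groupM.
      by rewrite /= (aWH_mulgK (ok Ga) (ok Gg)).
    by exists (aWH_mul k (aWH_inv g)) => //; exact: (aWH_mulgVK (ok Gk) (ok Gg)).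
  rewrite e; apply: (haar_null_congr tc hmu) => //; first exact: measurableI.
  by rewrite -setIA setIid.
have {h c Gh hc c1}[h [c [Gh hc c1]]] : exists h c, [/\ G h, right_scaling h c & 1 < c].
  have [c_gt1|c_le1] := ltP 1 c; first by exists h, c; split.
  have Gh' := tc_groupV tc Gh; have [d hd] := right_scaling_exists Gh'.
  exists (aWH_inv h), d; split => //.
  have := right_scalingM Gh Gh' hc hd; rewrite aWH_mulgV; last exact: ok.
  move=> /right_scaling1 cd; have c_lt1 : c < 1 by rewrite lt_neqAle c1.
  by rewrite -cd gtr_pMl//; exact: hd.1.
have pw m : exists2 k, G k & right_scaling k (c ^+ m).
  elim: m => [|m [k Gk hk]].
    exists (aWH1 R n); first exact: tc_group1.
    have [d hd] := right_scaling_exists (tc_group1 tc).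
    by rewrite expr0 -(right_scaling1 hd).
  by exists (aWH_mul h k); [exact: tc_groupM|rewrite exprS; exact: right_scalingM].
have [m cm] : exists m, M < c ^+ m.
  have cc : 0 < c - 1 by rewrite subr_gt0.
  exists (Num.bound `|M / (c - 1)|).
  have bern m : 1 + m%:R * (c - 1) <= c ^+ m.
    elim: m => [|m ih]; first by rewrite expr0 mul0r addr0.
    rewrite exprS; apply: le_trans (ler_wpM2l _ ih); last exact: ltW (lt_trans ltr01 c1).
    have : 0 <= m%:R * (c - 1) * (c - 1) by rewrite !mulr_ge0// ltW.
    rewrite -natr1; nra.
  apply: lt_le_trans (bern _).
  have : M / (c - 1) < (Num.bound `|M / (c - 1)|)%:R.
    by apply: le_lt_trans (ler_norm _) (archi_boundP (normr_ge0 _)).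
  by rewrite ltr_pdivrMr// => /lt_le_trans; apply; rewrite lerDr.
by have [k Gk hk] := pw m; exists k, (c ^+ m).
Qed.

Definition bounded_voice psi (C : R) := 0 <= C /\ forall F, (csq mu (vo psi F) <= (C * ip F F)%:E)%E.

Lemma L2_vo psi C F : bounded_voice psi C -> L2 mu setT (vo psi F).
Proof.
move=> [_ /(_ F) h]; apply/L2P; split; first exact: cmeas_vo.
by apply: le_lt_trans h _; rewrite ltry.
Qed.

Lemma bounded_voice_qpi psi C h c : G h -> right_scaling h c -> bounded_voice psi C ->
  bounded_voice (pi h psi) (c * C).
Proof.
move=> Gh hc [C0 bC]; have c0 := hc.1; split=> [|F]; first by rewrite mulr_ge0// ltW.
rewrite (csq_right_translate _ _ Gh hc) -mulrA EFinM lee_pmul2l//.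
Qed.

Lemma vo_linear psi C (a : R) F K : bounded_voice psi C ->
  to_l2 mu (vo psi (a *: F + K)) = a *: to_l2 mu (vo psi F) + to_l2 mu (vo psi K).
Proof.
move=> bp; have LF := L2_vo F bp; have LK := L2_vo K bp.
have La : L2 mu setT (fun k => real_complex R a * vo psi F k) by exact: L2Z.
rewrite -(to_l2Z a LF) -(to_l2D La LK).
by congr to_l2; apply/funext => k; rewrite (voPl tc).
Qed.

Lemma hnorm_vo psi C F : bounded_voice psi C ->
  hnorm (@l2_ip _ _ _ mu) (to_l2 mu (vo psi F)) <= Num.sqrt C * hnorm ip F.
Proof.
move=> bD; rewrite /hnorm -sqrtrM; last exact: bD.1.
apply: ler_wsqrtr; rewrite -lee_fin (l2_ip_csq (L2_vo F bD)); exact: bD.2.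
Qed.

Lemma cip_left_translate h (f g : borel E -> R[i]) : G h -> L2 mu setT f -> L2 mu setT g ->
  cip mu (fun k => f (aWH_mul h k)) (fun k => g (aWH_mul h k)) = cip mu f g.
Proof.
move=> Gh Lf Lg; have hM := @l2_hilbert _ _ _ mu.
have ct (f' : borel E -> R[i]) : L2 mu setT f' -> L2 mu setT (fun k => f' (aWH_mul h k)).
  move=> /L2P[mf fin]; apply/L2P; rewrite csq_left_translate//; split => //.
  have ml := measurable_mull (measurable_group_tc tc) h.
  by split; [exact: measurableT_comp mf.1 ml|exact: measurableT_comp mf.2 ml].
have ce (f' g' : borel E -> R[i]) : L2 mu setT f' -> L2 mu setT g' ->
    (cip mu f' g') = (fine (csq mu (fun k => f' k + g' k)%R) - fine (csq mu f') - fine (csq mu g')) / 2.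
  move=> Lf' Lg'; rewrite -(l2_ip_csq Lf') -(l2_ip_csq Lg') -(l2_ip_csq (L2D Lf' Lg')) /= (to_l2D Lf' Lg').
  by rewrite -(l2_ipE Lf' Lg') !(hipE hM) (hipC hM (to_l2 mu g')); field.
rewrite (ce _ _ (ct _ Lf) (ct _ Lg)) (ce _ _ Lf Lg).
rewrite (csq_left_translate Gh (L2_meas Lf)) (csq_left_translate Gh (L2_meas Lg)).
by rewrite (@csq_left_translate h (fun k => f k + g k) Gh (L2_meas (L2D Lf Lg))).
Qed.

Lemma form_commuting (T U U' : X -> X) (B : X -> X -> R) :
  (forall F K, ip (T F) K = B F K) -> (forall F K, ip (U F) (U K) = ip F K) ->
  (forall F, U (U' F) = F) -> (forall F K, B (U F) (U K) = B F K) -> commuting T U.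
Proof.
move=> TB Ui UU' BU F; apply: (hip_ext hX) => K.
by rewrite -(UU' K) TB BU Ui TB.
Qed.

(** T is the adjoint of the transform of psi' composed with that of psi. It commutes with pi(h)
    because voice transforms turn pi(h) into a left translation, under which mu is invariant, and
    with J because they are complex linear. *)
Lemma voice_operator psi psi' C C' : bounded_voice psi C -> bounded_voice psi' C' ->
  exists T, [/\ bounded_linear ip T,
    forall F K, ip (T F) K = cip mu (vo psi F) (vo psi' K),
    commuting T J & forall h, G h -> commuting T (pi h)].
Proof.
move=> bp bp'; have hM := @l2_hilbert _ _ _ mu.
have [||||T bT TB] := @pullback_form_operator _ _ _ _ _ (fun F => to_l2 mu (vo psi F))
  (fun F => to_l2 mu (vo psi' F)) (Num.sqrt C) (Num.sqrt C') hX hM.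
- by move=> a F K; exact: vo_linear bp.
- by move=> a F K; exact: vo_linear bp'.
- by move=> F; exact: hnorm_vo bp.
- by move=> F; exact: hnorm_vo bp'.
pose B F K := cip mu (vo psi F) (vo psi' K).
have {}TB F K : ip (T F) K = B F K by apply: etrans (TB F K) _; exact: (l2_ipE (L2_vo F bp) (L2_vo K bp')).
exists T; split => //.
  apply: (@form_commuting _ J (fun F => - J F) B TB).
  - exact: l2_ip_mulI.
  - by move=> F; rewrite (blN (@mulI_bl R n)) l2_mulI_mulI opprK.
  move=> F K; apply: eq_Rintegral => k _; rewrite !(vo_mulI tc).
  by case: (vo psi F k) (vo psi' K k) => a b [c e]; rewrite /cdot !complex_iM/=; ring.
move=> h Gh; have Gh' := tc_groupV tc Gh.
apply: (@form_commuting _ (pi h) (pi (aWH_inv h)) B TB).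
- by move=> F K; rewrite (qpi_isometry _ _ (ok Gh)).
- by move=> F; rewrite -(qpi_mul _ (ok Gh) (ok Gh')) (aWH_mulgV (ok Gh)) qpi1.
move=> F K; apply: etrans (cip_left_translate Gh' (L2_vo F bp) (L2_vo K bp')).
by apply: eq_Rintegral => k _; rewrite !(vo_translate tc _ _ _ Gh).
Qed.

End haar_voices.

(** * The commutant of the translations *)

(* Commutativity comes from a transposition: if the adjoint T' of every T in the commutant
   satisfies T' J0 = J0 T, then J0 T A = A' T' J0 = A' J0 T = J0 A T. For translations, C i
   is convolution with the indicator function e i, and J0 f (y) = conj (f (- y)). *)
Section abelian_commutant.
Variables (R : realType) (X : lmodType R) (ip : X -> X -> R) (I : Type).
Variables (J J0 : X -> X) (C : I -> X -> X) (e : I -> X).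
Hypothesis hX : hilbert ip.
Hypothesis bJ : bounded_linear ip J.
Hypothesis J_skew : forall x y, ip (J x) y = - ip x (J y).
Hypotheses (J0_sym : adjoint_pair ip J0 J0) (J0K : forall x, J0 (J0 x) = x).
Hypothesis J0J : forall x, J0 (J x) = - J (J0 x).
Hypothesis CJ0 : forall i x y, ip (C i x) (J0 y) = ip x (J0 (C i y)).
Hypothesis Ce : forall i j, C i (e j) = C j (e i).
Hypothesis e_total : forall v, (forall i, ip v (e i) = 0) -> (forall i, ip (J v) (e i) = 0) -> v = 0.
Hypothesis Ce_total : forall v, (forall i j, ip v (C i (e j)) = 0) ->
  (forall i j, ip (J v) (C i (e j)) = 0) -> v = 0.

Definition in_commutant T := [/\ bounded_linear ip T, commuting T J & forall i, commuting T (C i)].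

Lemma in_commutant_J T : in_commutant T -> (forall i, commuting J (C i)) -> in_commutant (J \o T).
Proof.
move=> [bT TJ TC] JC; split; first exact: bl_comp.
  by move=> x /=; rewrite TJ.
by move=> i x /=; rewrite TC JC.
Qed.

(** Since T commutes with C, a factor C_l can be moved across the pairing, and [Ce] exchanges its
    index with that of the vector it meets. Three such exchanges permute i, j, k into the other
    side. *)
Lemma transpose_symmetric T i j k : in_commutant T ->
  ip (T (C i (e j))) (J0 (e k)) = ip (T (e k)) (J0 (C i (e j))).
Proof.
move=> [bT TJ TC].
have s a b l : ip (T (C l a)) (J0 b) = ip (T a) (J0 (C l b)) by rewrite TC CJ0.
by rewrite [in LHS]Ce s [in LHS](Ce j) -s [in LHS](Ce k i) s.
Qed.

(** Put Z = T' J0 - J0 T. The symmetry above makes Z e_k orthogonal to every C_i e_j, and the same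
    argument for J T does so for J Z e_k; by totality Z e_k = 0. As Z is skew, Z x is then
    orthogonal to every e_k, and so is J Z x. *)
Lemma transpose_commutant T T' : (forall i, commuting J (C i)) -> in_commutant T ->
  bounded_linear ip T' -> adjoint_pair ip T T' -> forall x, T' (J0 x) = J0 (T x).
Proof.
move=> JC hT bT' aT x; have [bT TJ TC] := hT.
have aT' := adjoint_sym hX aT.
have T'J y : T' (J y) = J (T' y).
  by apply: (hip_ext hX) => z; rewrite aT' J_skew -TJ -aT' -[RHS]opprK -J_skew opprK.
pose Z y := T' (J0 y) - J0 (T y).
have ZJ y : Z (J y) = - J (Z y).
  by rewrite /Z J0J TJ J0J (blN bT') T'J (blB bJ) opprB opprK addrC.
have Ze k : Z (e k) = 0.
  have base S S' : in_commutant S -> adjoint_pair ip S S' -> forall i j,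
      ip (S' (J0 (e k)) - J0 (S (e k))) (C i (e j)) = 0.
    move=> hS aS i j; rewrite !(hipE hX) (adjoint_sym hX aS) (hipC hX) (transpose_symmetric _ _ _ hS).
    by rewrite J0_sym subrr.
  apply: Ce_total => i j; first exact: (base T).
  have aJT : adjoint_pair ip (J \o T) (fun y => - T' (J y)).
    by move=> y z /=; rewrite J_skew aT !(hipE hX).
  have := base _ _ (in_commutant_J hT JC) aJT i j => /=.
  by rewrite T'J J0J opprK /Z (blB bJ) !(hipE hX) => h; lra.
have Zadj u v : ip (Z u) v = - ip u (Z v).
  by rewrite /Z !(hipE hX) aT' J0_sym J0_sym aT opprB; ring.
apply/eqP; rewrite -subr_eq0; apply/eqP; apply: e_total => k.
  by rewrite -/(Z x) Zadj Ze (hip0r hX) oppr0.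
by rewrite -/(Z x) J_skew Zadj ZJ Ze (bl0 bJ) oppr0 (hip0r hX) !oppr0.
Qed.

Theorem abelian_commutant T A : (forall i, commuting J (C i)) -> in_commutant T -> in_commutant A -> commuting T A.
Proof.
move=> JC hT hA x; have [bT TJ TC] := hT; have [bA AJ AC] := hA.
have [T' bT' aT] := has_adjoint hX bT; have [A' bA' aA] := has_adjoint hX bA.
have hTA : in_commutant (T \o A).
  split; first exact: bl_comp.
    by move=> y /=; rewrite AJ TJ.
  by move=> i y /=; rewrite AC TC.
have aTA : adjoint_pair ip (T \o A) (A' \o T') by move=> y z /=; rewrite aT aA.
have h := transpose_commutant JC hTA (bl_comp bA' bT') aTA x.
by rewrite -[LHS]J0K -[RHS]J0K; congr J0; rewrite -h /= (transpose_commutant JC hT bT' aT) (transpose_commutant JC hA bA' aA).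
Qed.

End abelian_commutant.

(** * Functions with vanishing integrals *)

Section finite_sets.
Context d (T : measurableType d) (R : realType).

Lemma ae0_of_finite_sets (mu : {sigma_finite_measure set T -> \bar R}) (f : T -> R) :
  measurable_fun setT f ->
  (forall P, measurable P -> (mu P < +oo)%E ->
     mu.-integrable P (EFin \o f) /\ Rintegral mu P f = 0) ->
  {ae mu, forall x, f x = 0}.
Proof.
move=> mf h; have [F FT /all_and2[mF Foo]] := sigma_finiteT mu.
have hk k : {ae mu, forall x, F k x -> f x = 0}.
  have hint P : measurable P -> P `<=` F k -> (mu P < +oo)%E.
    by move=> mP PB; apply: le_lt_trans (Foo k); apply: le_measure; rewrite ?inE.
  have [ik _] := h _ (mF k) (Foo k).
  have hh : ae_eq mu (F k) (EFin \o f) (fun=> 0%E).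
    apply: (integral_ae_eq (mF k) ik (measurable_cst _)) => S SB mS.
    have [iS S0] := h _ mS (hint _ mS SB).
    rewrite integral0; apply/eqP; rewrite -(fineK (integrable_fin_num mS iS)).
    by rewrite eqe; apply/eqP.
  by apply: filterS hh => x hx Bx; have [] := hx Bx.
have hh : {ae mu, forall x, forall k : nat, F k x -> f x = 0}.
  by apply/ae_foralln => k; exact: hk.
apply: filterS hh => x hx; have : [set: T] x by [].
by rewrite FT => -[k _ /hx].
Qed.

Lemma density_measure (mu : {measure set T -> \bar R}) (f : T -> R) :
  measurable_fun setT f -> (forall x, 0 <= f x) ->
  exists m : {measure set T -> \bar R}, forall A, measurable A -> m A = (\int[mu]_(x in A) (f x)%:E)%E.
Proof.
move=> mf f0; have mEf : measurable_fun setT (EFin \o f) by exact/measurable_EFinP.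
pose nu (A : set T) := (\int[mu]_(x in A) (f x)%:E)%E.
have nu0 : nu set0 = 0%E by rewrite /nu integral_set0.
have nu_ge0 A : (0 <= nu A)%E by apply: integral_ge0 => x _; rewrite lee_fin.
have nu_add : semi_sigma_additive nu.
  move=> F mF tF mUF; rewrite /nu ge0_integral_bigcup//.
  - by apply: is_cvg_ereal_nneg_natsum_cond => k _ _; exact: nu_ge0.
  - by apply: measurable_funS mEf.
  - by move=> x _; rewrite lee_fin.
pose m : {measure set T -> \bar R} := HB.pack nu (isMeasure.Build _ _ _ nu nu0 nu_ge0 nu_add).
by exists m.
Qed.

(* Uniqueness of measures applied to the densities max(f, 0) and max(- f, 0). *)
Lemma ae0_of_pi_system (mu : {sigma_finite_measure set T -> \bar R}) (f : T -> R)
    (Q : set (set T)) (g : nat -> set T) :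
  measurable_fun setT f ->
  (forall P, measurable P -> (mu P < +oo)%E -> mu.-integrable P (EFin \o f)) ->
  @measurable _ T = <<s Q >> -> setI_closed Q -> (forall i, Q (g i)) -> \bigcup_i g i = setT ->
  (forall A, Q A -> (mu A < +oo)%E) ->
  (forall A, Q A -> Rintegral mu A f = 0) ->
  {ae mu, forall x, f x = 0}.
Proof.
move=> mf fint mQ QI Qg gT Qfin Q0.
have QM A : Q A -> measurable A by move=> QA; rewrite mQ; exact: sub_sigma_algebra.
pose fp x := Num.max (f x) 0; pose fn x := Num.max (- f x) 0.
have mfp : measurable_fun setT fp by exact: measurable_maxr.
have mfn : measurable_fun setT fn by apply: measurable_maxr => //; exact: measurableT_comp.
have max0 (r : R) : 0 <= Num.max r 0 by rewrite le_max lexx orbT.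
have [m1 m1E] := density_measure mu mfp (fun x => max0 _).
have [m2 m2E] := density_measure mu mfn (fun x => max0 _).
have split_int P : measurable P -> (mu P < +oo)%E ->
    [/\ m1 P \is a fin_num, m2 P \is a fin_num & Rintegral mu P f = fine (m1 P) - fine (m2 P)].
  move=> mP Pfin; have iP := fint _ mP Pfin.
  have e1 : m1 P = (\int[mu]_(x in P) (EFin \o f)^\+ x)%E.
    by rewrite m1E//; apply: eq_integral => x _; rewrite funeposE /fp EFin_max.
  have e2 : m2 P = (\int[mu]_(x in P) (EFin \o f)^\- x)%E.
    by rewrite m2E//; apply: eq_integral => x _; rewrite funenegE /fn EFin_max.
  have f1 : m1 P \is a fin_num by rewrite e1; exact: integrable_pos_fin_num.
  have f2 : m2 P \is a fin_num by rewrite e2; exact: integrable_neg_fin_num.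
  by split => //; rewrite /Rintegral integralE -e1 -e2 fineB.
apply: ae0_of_finite_sets => // P mP Pfin; split; first exact: fint.
have [f1 f2 ->] := split_int _ mP Pfin.
rewrite (measure_unique Q g mQ QI Qg gT m1 m2 _ _ P mP) ?subrr// => [A QA|k].
  have [g1 g2 e] := split_int _ (QM _ QA) (Qfin _ QA).
  rewrite -(fineK g1) -(fineK g2); congr (_%:E).
  by apply/eqP; rewrite -subr_eq0 -e Q0.
have [g1 _ _] := split_int _ (QM _ (Qg k)) (Qfin _ (Qg k)).
by rewrite -ge0_fin_numE.
Qed.

End finite_sets.

(** * Translations and the reflection at the origin *)

Section translations.
Variables (R : realType) (n : nat).
Local Notation Rn := (borel 'cV[R]_n).
Local Notation E := (aWH_type R n).
Local Notation leb := (@leb R n).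
Local Notation L2 := (L2 leb setT).
Local Notation X := (l2 leb).
Local Notation ip := (@l2_ip _ _ _ leb).
Local Notation J := (@l2_mulI _ _ _ leb).
Local Notation pi := (@qpi R n).
Local Notation hX := (@l2_hilbert _ _ _ leb).
Implicit Types (F K : X) (P Q : set Rn).

Definition transl (x : 'cV[R]_n) : E := (1, x, 0, 1%:M).
Definition reflection : E := (1, 0, 0, - 1%:M).

Lemma transl_ok x : aWH_ok (transl x).
Proof. by split; [rewrite /cmod2/= expr1n expr0n addr0|exact: unitmx1]. Qed.

Lemma unitmxN1 : (- 1%:M : 'M[R]_n) \in unitmx.
Proof. by rewrite -scaleN1r unitmxZ ?unitmx1// unitrN1. Qed.

Lemma invmxN1 : invmx (- 1%:M : 'M[R]_n) = - 1%:M.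
Proof.
apply: (can_inj (mulKmx unitmxN1)); rewrite mulmxV ?unitmxN1//.
by rewrite mulNmx mulmxN opprK mul1mx.
Qed.

Lemma detN1 : `|\det (- 1%:M : 'M[R]_n)| = 1.
Proof. by rewrite -scaleN1r detZ det1 mulr1 normrX normrN1 expr1n. Qed.

Lemma reflection_ok : aWH_ok reflection.
Proof. by split; [rewrite /cmod2/= expr1n expr0n addr0|exact: unitmxN1]. Qed.

Lemma quasireg_transl x (f : Rn -> R[i]) : quasireg (transl x) f = fun y => f (y - x).
Proof.
apply/funext => y; rewrite quasiregE chi0r invmx1 !mul1mx det1 normr1 sqrtr1 invr1.
by rewrite (_ : real_complex R 1 = 1)// !mul1r.
Qed.

Lemma quasireg_reflection (f : Rn -> R[i]) : quasireg reflection f = fun y => f (- y).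
Proof.
apply/funext => y; rewrite quasiregE chi0r invmxN1 mulmx0 oppr0 addr0 detN1 sqrtr1 invr1.
by rewrite (_ : real_complex R 1 = 1)// !mul1r mulNmx mul1mx.
Qed.

Lemma integral_leb_reflect (y : 'cV[R]_n) (f : Rn -> \bar R) : measurable_fun setT f ->
  (forall x, 0 <= f x)%E -> (\int[leb]_x f (y - x)%R = \int[leb]_x f x)%E.
Proof.
move=> mf f0; have := integral_leb_affine y unitmxN1 mf f0.
rewrite detN1 invr1 mul1e => <-; apply: eq_integral => x _.
by rewrite mulNmx mul1mx addrC.
Qed.

Lemma measurable_ball0 r : measurable (ball (0 : 'cV[R]_n) r : set Rn).
Proof. by apply: sub_sigma_algebra; exact: ball_open. Qed.

Lemma ball0_cover : \bigcup_k (ball (0 : 'cV[R]_n) k%:R) = [set: 'cV[R]_n].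
Proof.
apply/seteqP; split => // x _; exists (Num.bound `|x|) => //=.
by rewrite -ball_normE/= sub0r normrN archi_boundP.
Qed.

Lemma leb_sub_ball (k : nat) P : measurable P -> P `<=` ball (0 : 'cV[R]_n) k%:R -> (leb P < +oo)%E.
Proof.
move=> mP PB; apply: le_lt_trans (@leb_ball_fin R n k%:R).
by apply: le_measure; rewrite ?inE//; exact: measurable_ball0.
Qed.

Lemma measurable_open_cV (O : set 'cV[R]_n) : open O -> measurable (O : set Rn).
Proof. by move=> oO; apply: sub_sigma_algebra. Qed.

End translations.

Section finite_set_vectors.
Variables (R : realType) (n : nat).
Local Notation Rn := (borel 'cV[R]_n).
Local Notation leb := (@leb R n).
Local Notation L2 := (L2 leb setT).
Local Notation X := (l2 leb).
Local Notation ip := (@l2_ip _ _ _ leb).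
Local Notation J := (@l2_mulI _ _ _ leb).
Local Notation pi := (@qpi R n).
Local Notation hX := (@l2_hilbert _ _ _ leb).
Implicit Types (F K : X) (f : Rn -> R[i]) (P Q A : set Rn).

Definition fin_set := {A : set Rn | measurable A /\ (leb A < +oo)%E}.
Implicit Types (p q b : fin_set).

Lemma fin_set_measurable p : measurable (sval p). Proof. by case: p => A []. Qed.
Lemma fin_set_fin p : (leb (sval p) < +oo)%E. Proof. by case: p => A []. Qed.

Definition rind A (y : Rn) : R[i] := real_complex R (\1_A y).

Lemma cmeas_rind A : measurable A -> cmeasurable setT (rind A).
Proof.
move=> mA; split => /=; last exact: measurable_cst.
exact: measurable_indic.
Qed.

Lemma L2_rind p : L2 (rind (sval p)).
Proof.
have mp := fin_set_measurable p; apply/L2P; split; first exact: cmeas_rind.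
rewrite /csq (_ : (fun x => _) = (fun x => (\1_(sval p) x)%:E)).
  by rewrite integral_indic// setIT; exact: fin_set_fin.
apply/funext => x; rewrite cmod2_real indicE; congr (_%:E).
by case: (x \in _); rewrite ?expr1n ?expr0n.
Qed.

Definition ind_vec p : X := to_l2 leb (rind (sval p)).

Lemma cdot_rind A (z : R[i]) y : cdot (rind A y) z = ((fun y => complex.Re z) \_ A) y.
Proof.
rewrite /cdot/= mul0r addr0 patchE indicE.
by case: (y \in A); rewrite ?mul1r ?mul0r.
Qed.

Lemma integrable_Re p f : L2 f -> leb.-integrable (sval p) (fun y => (complex.Re (f y))%:E).
Proof.
move=> Lf; apply/(integrable_mkcond _ (fin_set_measurable p)).
have := integrable_cdot (L2_rind p) Lf; congr (leb.-integrable _ _).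
apply/funext => y; rewrite (cdot_rind (sval p) (f y) y) !patchE.
by case: ifP.
Qed.

Lemma ip_ind_vec p f : L2 f -> ip (ind_vec p) (to_l2 leb f) = Rintegral leb (sval p) (fun y => complex.Re (f y)).
Proof.
move=> Lf; rewrite /ind_vec (l2_ipE (L2_rind p) Lf) [RHS]Rintegral_mkcond.
by apply: eq_Rintegral => y _; rewrite (cdot_rind (sval p) (f y) y) !patchE.
Qed.

(** Finite intersections of basic open sets, cut by a ball to have finite measure: a countable
    pi-system generating the Borel sets. *)
Definition qset (C : nat -> set 'cV[R]_n) (s : seq nat) (k : nat) : set 'cV[R]_n :=
  foldr (fun i A => C i `&` A) (ball (0 : 'cV[R]_n) k%:R) s.

Lemma qset_open C s k : (forall i, open (C i)) -> open (qset C s k).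
Proof. by move=> oC; elim: s => [|i s ih] /=; [exact: ball_open|exact: openI]. Qed.

Lemma qsetP C s k x : qset C s k x <-> ball (0 : 'cV[R]_n) k%:R x /\ forall i, i \in s -> C i x.
Proof.
elim: s => [|i s ih] /=; first by split => [?|[]].
split=> [[Cx /ih[Bx Csx]]|[Bx Csx]].
  by split => // j; rewrite inE => /orP[/eqP->|/Csx].
by split; [apply: Csx; rewrite mem_head|apply/ih; split => // j js; apply: Csx; rewrite inE js orbT].
Qed.

Lemma qsetI C s k t l : qset C s k `&` qset C t l = qset C (s ++ t) (minn k l).
Proof.
apply/seteqP; split => x.
  move=> [/qsetP[Bk Cs] /qsetP[Bl Ct]]; apply/qsetP; split.
    by rewrite /minn; case: ifP.
  by move=> i; rewrite mem_cat => /orP[/Cs|/Ct].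
move=> /qsetP[Bkl Cst].
split; apply/qsetP; split; try by move=> i si; apply: Cst; rewrite mem_cat si ?orbT.
  by apply: le_ball Bkl; rewrite ler_nat geq_minl.
by apply: le_ball Bkl; rewrite ler_nat geq_minr.
Qed.

Lemma qset_sub C s k : qset C s k `<=` ball (0 : 'cV[R]_n) k%:R.
Proof. by move=> x /qsetP[]. Qed.

Lemma qset_generates C : countable_base C ->
  @measurable _ Rn = <<s [set A | exists s k, A = qset C s k] >>.
Proof.
move=> [oC bC]; apply/seteqP; split => A.
  apply: smallest_sub; first exact: smallest_sigma_algebra.
  move=> O /= oO.
  have -> : O = \bigcup_(ik in [set ik : nat * nat | C ik.1 `<=` O]) qset C [:: ik.1] ik.2.
    apply/seteqP; split => [x Ox|x [[i k] /= CO [Cx _]]]; last exact: CO.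
    have [i [Cx CO]] := bC _ _ oO Ox.
    have : [set: 'cV[R]_n] x by []; rewrite -ball0_cover => -[k _ Bx].
    by exists (i, k).
  rewrite bigcup_mkcond.
  apply: (@countable_bigcupT_measurable _ (g_sigma_algebraType [set A | exists s k, A = qset C s k])) => // ik.
  case: ifP => _; last exact: measurable0.
  by apply: sub_sigma_algebra; exists [:: ik.1], ik.2.
apply: smallest_sub; first exact: sigma_algebra_measurable.
by move=> _ [s [k ->]]; apply: measurable_open_cV; exact: qset_open.
Qed.

Lemma qset_fin C s k : (forall i, open (C i)) ->
  measurable (qset C s k : set Rn) /\ (leb (qset C s k) < +oo)%E.
Proof.
move=> oC; have mq := measurable_open_cV (@qset_open C s k oC); split => //.
by apply: (leb_sub_ball (k := k)) => //; exact: qset_sub.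
Qed.

Definition qfin C (oC : forall i, open (C i)) s k : fin_set := exist _ _ (@qset_fin C s k oC).

(** The real parts of f and of i f integrate to 0 over a generating pi-system, so f = 0 almost
    everywhere. Only countably many test sets occur, which [conv_ind_total] relies on. *)
Lemma ind_vec_total C (bC : countable_base C) F :
  (forall s k, ip (ind_vec (qfin bC.1 s k)) F = 0) ->
  (forall s k, ip (ind_vec (qfin bC.1 s k)) (J F) = 0) -> F = 0.
Proof.
elim/l2_ind: F => f Lf h1 h2.
have LJ : L2 (fun y => Complex 0 1 * f y) by exact: L2Z.
have key g : L2 g -> (forall s k, ip (ind_vec (qfin bC.1 s k)) (to_l2 leb g) = 0) ->
    {ae leb, forall y, complex.Re (g y) = 0}.
  move=> Lg hg.
  apply: (@ae0_of_pi_system _ _ _ leb _ [set A | exists s k, A = qset C s k] (fun k => qset C [::] k)).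
  - exact: (L2_meas Lg).1.
  - by move=> P mP Pfin; exact: (integrable_Re (exist _ P (conj mP Pfin)) Lg).
  - exact: qset_generates.
  - by move=> _ _ [s [k ->]] [t [l ->]]; rewrite qsetI; exists (s ++ t), (minn k l).
  - by move=> i; exists [::], i.
  - exact: ball0_cover.
  - by move=> _ [s [k ->]]; exact: (@qset_fin C s k bC.1).2.
  - by move=> _ [s [k ->]]; rewrite -(ip_ind_vec (qfin bC.1 s k) Lg).
have k1 := key _ Lf h1.
have k2 : {ae leb, forall y, complex.Re (Complex 0 1 * f y) = 0}.
  by apply: key => // s k; rewrite -(to_l2_cscale _ Lf); exact: h2.
apply: etrans (to_l2_0 leb); apply: eq_to_l2 => //; first exact: L2_0.
apply: filterS2 k1 k2 => y; case: (f y) => a c /= -> + _.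
by rewrite mul0r mul1r sub0r => /eqP; rewrite oppr_eq0 => /eqP ->.
Qed.

Lemma fin_set_total F : (forall p, ip F (ind_vec p) = 0) -> (forall p, ip (J F) (ind_vec p) = 0) -> F = 0.
Proof.
move=> h1 h2; have [C bC] := second_countable_mx R n 1.
by apply: (ind_vec_total (bC := bC)) => s k; rewrite (hipC hX).
Qed.

End finite_set_vectors.

Section average_operator.
Context d (T : measurableType d) (R : realType) (X : lmodType R) (ip : X -> X -> R).
Hypothesis hX : hilbert ip.
Variables (nu : {measure set T -> \bar R}) (P : set T) (tau : T -> X -> X).
Hypotheses (mP : measurable P) (Pfin : (nu P < +oo)%E).
Hypothesis tauP : forall x (a : R) u v, tau x (a *: u + v) = a *: tau x u + tau x v.
Hypothesis tau_norm : forall x u, hnorm ip (tau x u) <= hnorm ip u.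
Hypothesis mtau : forall u v, measurable_fun setT (fun x => ip (tau x u) v).

Lemma average_kernel_le x u v : `|ip (tau x u) v| <= hnorm ip u * hnorm ip v.
Proof.
apply: le_trans (hcauchy_schwarz hX _ _) _.
by rewrite ler_wpM2r// sqrtr_ge0.
Qed.

Lemma average_integrable u v : nu.-integrable P (EFin \o (fun x => ip (tau x u) v)).
Proof.
apply: measurable_bounded_integrable => //; first exact: measurable_funS (mtau u v).
exists (hnorm ip u * hnorm ip v); split; first exact: num_real.
by move=> y My x _; apply: le_trans (average_kernel_le x u v) (ltW My).
Qed.

(** The operator-valued integral of tau over P, taken weakly, so that measurability of the matrix
    coefficients suffices. *)
Lemma average_operator : exists2 C, bounded_linear ip C &
  forall u v, ip (C u) v = Rintegral nu P (fun x => ip (tau x u) v).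
Proof.
apply: (form_operator hX).
- move=> a x y z; rewrite -RintegralZl//; last exact: average_integrable.
  rewrite -RintegralD//; last 2 first.
  + have := integrableZl mP a (average_integrable x z).
    by congr (nu.-integrable _ _).
  + exact: average_integrable.
  by apply: eq_Rintegral => t _; rewrite tauP !(hipE hX).
- move=> a x y z; rewrite -RintegralZl//; last exact: average_integrable.
  rewrite -RintegralD//; last 2 first.
  + have := integrableZl mP a (average_integrable z x).
    by congr (nu.-integrable _ _).
  + exact: average_integrable.
  by apply: eq_Rintegral => t _; rewrite !(hipE hX).
exists (fine (nu P)) => x y; apply: le_trans (le_normr_Rintegral mP (average_integrable x y)) _.
rewrite mulrC -(Rintegral_cst nu mP); apply: le_Rintegral => //.
- by have := integrable_norm (average_integrable x y).
- apply: measurable_bounded_integrable => //; exact: bounded_cst.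
- by move=> t _; exact: average_kernel_le.
Qed.

End average_operator.

Section integral_facts.
Context d (T : measurableType d) (R : realType) (mu : {measure set T -> \bar R}).

Lemma EFin_Rintegral P (f : T -> R) : measurable P -> mu.-integrable P (EFin \o f) ->
  (Rintegral mu P f)%:E = (\int[mu]_(x in P) (f x)%:E)%E.
Proof. by move=> mP fi; exact: (fineK (integrable_fin_num mP fi)). Qed.

Lemma Rintegral_eq0 P (f : T -> R) : (forall x, P x -> f x = 0) -> Rintegral mu P f = 0.
Proof. by move=> f0; rewrite /Rintegral integral0_eq// => x Px; rewrite f0. Qed.

Lemma ae_exists2 (P Q : T -> Prop) : mu setT != 0%E ->
  {ae mu, forall x, P x} -> {ae mu, forall x, Q x} -> exists x, P x /\ Q x.
Proof.
move=> muT hP hQ; apply: contrapT => nx.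
have [N [mN N0 NP]] : {ae mu, forall x : T, False}.
  by apply: filterS2 hP hQ => x x1 x2; apply: nx; exists x.
move: muT; rewrite (_ : setT = N) ?N0 ?eqxx//.
by apply/seteqP; split => // x _; apply: NP.
Qed.

End integral_facts.

(** * Convolution with indicator functions *)

Section convolution.
Variables (R : realType) (n : nat).
Local Notation Rn := (borel 'cV[R]_n).
Local Notation E := (aWH_type R n).
Local Notation leb := (@leb R n).
Local Notation L2 := (L2 leb setT).
Local Notation X := (l2 leb).
Local Notation ip := (@l2_ip _ _ _ leb).
Local Notation J := (@l2_mulI _ _ _ leb).
Local Notation hX := (@l2_hilbert _ _ _ leb).
Implicit Types (F K : X) (f : Rn -> R[i]) (P Q A : set Rn) (p q b : fin_set R n).
Local Notation tau x := (qpi (@transl R n x)).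
Local Notation ok x := (@transl_ok R n x).
Local Notation e := (@ind_vec R n).

Lemma tau_to_l2 x f : L2 f -> tau x (to_l2 leb f) = to_l2 leb (fun y => f (y - x)).
Proof. by move=> Lf; rewrite (qpi_to_l2 (ok x) Lf) quasireg_transl. Qed.

Lemma L2_shift x f : L2 f -> L2 (fun y => f (y - x)).
Proof. by move=> Lf; rewrite -(quasireg_transl x f); exact: (L2_quasireg (ok x) Lf). Qed.

Lemma tauN x F : tau (- x) (tau x F) = F.
Proof.
elim/l2_ind: F => f Lf; rewrite (tau_to_l2 x Lf) (tau_to_l2 (- x) (L2_shift x Lf)).
by congr to_l2; apply/funext => y; rewrite opprK addrK.
Qed.

Lemma tauK x F : tau x (tau (- x) F) = F.
Proof. by rewrite -{1}(opprK x) tauN. Qed.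

Lemma ip_tau x F K : ip (tau x F) K = ip F (tau (- x) K).
Proof. by rewrite -(qpi_isometry _ _ (ok (- x))) tauN. Qed.

Lemma measurable_transl : measurable_fun setT (fun x : Rn => transl x : borel E).
Proof.
apply: measurable_to_aWH.
- exact: (@measurable_cst _ _ _ _ setT (1 : R)).
- exact: (@measurable_cst _ _ _ _ setT (0 : R)).
- exact: measurable_id.
- exact: (@measurable_cst _ _ _ _ setT (0 : Rn)).
- exact: (@measurable_cst _ _ _ _ setT (1%:M : borel 'M[R]_n)).
Qed.

Lemma measurable_ip_tau F K : measurable_fun setT (fun x : Rn => ip (tau x F) K).
Proof.
have LF := l2_L2 F; have LK := l2_L2 K.
have -> : (fun x : Rn => ip (tau x F) K) = (fun x => cip leb K (quasireg (transl x) F)).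
  apply/funext => x; rewrite (hipC hX) -[in LHS](l2funK K).
  exact: (l2_ipE LK (L2_quasireg (ok x) LF)).
exact: (measurableT_comp (measurable_cip_quasireg (L2_meas LK) (L2_meas LF)) measurable_transl).
Qed.

Lemma conv_op_exists p : exists2 C, bounded_linear ip C &
  forall F K, ip (C F) K = Rintegral leb (sval p) (fun x => ip (tau x F) K).
Proof.
apply: (average_operator hX (fin_set_measurable p) (fin_set_fin p) (tau := fun x : Rn => tau x)).
- by move=> x; exact: qpi_linear (ok x).
- by move=> x F; rewrite (qpi_hnorm F (ok x)).
- exact: measurable_ip_tau.
Qed.

Definition conv_op p : X -> X := s2val (cid2 (conv_op_exists p)).

Lemma conv_opE p F K : ip (conv_op p F) K = Rintegral leb (sval p) (fun x => ip (tau x F) K).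
Proof. exact: (s2valP' (cid2 (conv_op_exists p))). Qed.

Lemma ip_tau_integrable p F K : leb.-integrable (sval p) (EFin \o (fun x => ip (tau x F) K)).
Proof.
apply: (average_integrable hX (fin_set_measurable p) (fin_set_fin p) (tau := fun x : Rn => tau x)).
- by move=> x G; rewrite (qpi_hnorm G (ok x)).
- exact: measurable_ip_tau.
Qed.

Lemma conv_op_commuting T p : bounded_linear ip T -> (forall x, commuting T (tau x)) ->
  commuting T (conv_op p).
Proof.
move=> bT Tt F; have [T' bT' aT] := has_adjoint hX bT.
apply: (hip_ext hX) => K; rewrite aT !conv_opE; apply: eq_Rintegral => x _.
by rewrite -aT Tt.
Qed.

Definition refl_conj F : X := to_l2 leb (fun y => conjc (quasireg (reflection R n) F y)).

Lemma L2_conj f : L2 f -> L2 (fun y => conjc (f y)).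
Proof.
move=> /L2P[mf fin]; apply/L2P; split; first exact: cmeas_conj.
by rewrite /csq; under eq_integral do rewrite cmod2_conj.
Qed.

Lemma L2_refl f : L2 f -> L2 (fun y => f (- y)).
Proof. by move=> Lf; rewrite -(quasireg_reflection f); exact: (L2_quasireg (reflection_ok R n) Lf). Qed.

Lemma refl_conj_to_l2 f : L2 f -> refl_conj (to_l2 leb f) = to_l2 leb (fun y => conjc (f (- y))).
Proof.
move=> Lf; have ae := aeq_quasireg (reflection_ok R n) (l2_L2 (to_l2 leb f)) Lf (to_l2_ae Lf).
apply: eq_to_l2; first by apply: L2_conj; exact: (L2_quasireg (reflection_ok R n) (l2_L2 _)).
  by apply: L2_conj; exact: L2_refl.
by rewrite (quasireg_reflection f) in ae; exact: (aeq_op1 (fun z => conjc z) ae).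
Qed.

Lemma refl_conjK F : refl_conj (refl_conj F) = F.
Proof.
elim/l2_ind: F => f Lf; rewrite (refl_conj_to_l2 Lf) (refl_conj_to_l2 (L2_conj (L2_refl Lf))).
by congr to_l2; apply/funext => y; rewrite conjcK opprK.
Qed.

Lemma refl_conj_isometry F K : ip (refl_conj F) (refl_conj K) = ip F K.
Proof.
rewrite -(qpi_isometry F K (reflection_ok R n)).
have LF := L2_quasireg (reflection_ok R n) (l2_L2 F).
have LK := L2_quasireg (reflection_ok R n) (l2_L2 K).
rewrite /refl_conj (l2_ipE (L2_conj LF) (L2_conj LK)).
apply: etrans (esym (l2_ipE LF LK)).
by apply: eq_Rintegral => y _; rewrite /cdot; case: (quasireg _ F y) => a c; case: (quasireg _ K y) => a' c' /=; rewrite mulrNN.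
Qed.

Lemma refl_conj_sym : adjoint_pair ip refl_conj refl_conj.
Proof. by move=> F K; rewrite -(refl_conj_isometry (refl_conj F)) refl_conjK. Qed.

Lemma refl_conj_mulI F : refl_conj (J F) = - J (refl_conj F).
Proof.
elim/l2_ind: F => f Lf; have Lf' := L2_conj (L2_refl Lf).
rewrite (l2_mulI_to_l2 Lf) (refl_conj_to_l2 Lf) (l2_mulI_to_l2 Lf').
rewrite (refl_conj_to_l2 (L2Z _ Lf)) -(to_l2N (L2Z _ Lf')).
congr to_l2; apply/funext => y; case: (f (- y)) => a c.
by congr Complex => /=; ring.
Qed.

Lemma refl_conj_tau x F : refl_conj (tau x F) = tau (- x) (refl_conj F).
Proof.
elim/l2_ind: F => f Lf.
rewrite (tau_to_l2 x Lf) (refl_conj_to_l2 (L2_shift x Lf)) (refl_conj_to_l2 Lf).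
rewrite (tau_to_l2 (- x) (L2_conj (L2_refl Lf))).
by congr to_l2; apply/funext => y; rewrite opprK opprD.
Qed.

Lemma conv_op_refl_conj p F K :
  ip (conv_op p F) (refl_conj K) = ip F (refl_conj (conv_op p K)).
Proof.
rewrite -[RHS]refl_conj_sym (hipC hX (refl_conj F)) !conv_opE; apply: eq_Rintegral => x _.
by rewrite ip_tau -refl_conj_tau -refl_conj_sym (hipC hX).
Qed.

Definition triple p q b (x y : Rn) : R := \1_(sval p) x * \1_(sval q) (y - x) * \1_(sval b) y.

Lemma ip_tau_ind q b (x : Rn) :
  (ip (tau x (e q)) (e b))%:E = (\int[leb]_y (\1_(sval q) (y - x)%R * \1_(sval b) y)%:E)%E.
Proof.
have Lq := L2_rind q; have Lb := L2_rind b; have Lqx := L2_shift x Lq.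
rewrite (tau_to_l2 x Lq) (l2_ipE Lqx Lb) EFin_Rintegral//; last exact: (integrable_cdot Lqx Lb).
by apply: eq_integral => y _; rewrite /cdot/= mul0r addr0.
Qed.

Lemma ip_tau_indJ q b (x : Rn) : ip (tau x (e q)) (J (e b)) = 0.
Proof.
have Lq := L2_rind q; have Lb := L2_rind b; have Lqx := L2_shift x Lq.
rewrite (tau_to_l2 x Lq) (l2_mulI_to_l2 Lb) (l2_ipE Lqx (L2Z _ Lb)) /cip.
by apply: Rintegral_eq0 => y _; rewrite /cdot/=; ring.
Qed.

Lemma ip_conv_ind p q b :
  (ip (conv_op p (e q)) (e b))%:E = (\int[leb]_x \int[leb]_y (triple p q b x y)%:E)%E.
Proof.
rewrite conv_opE (EFin_Rintegral (fin_set_measurable p) (ip_tau_integrable p (e q) (e b))).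
rewrite integral_mkcond; apply: eq_integral => x _; rewrite patchE /triple indicE.
case: ifP => _.
  by rewrite ip_tau_ind; apply: eq_integral => y _; rewrite mul1r.
by rewrite integral0_eq// => y _; rewrite !mul0r.
Qed.

Lemma measurable_triple p q b :
  measurable_fun setT (fun z : Rn * Rn => (triple p q b z.1 z.2)%:E).
Proof.
have m1 : measurable_fun setT (fun z : Rn * Rn => z.1) := measurable_fst.
have m2 : measurable_fun setT (fun z : Rn * Rn => z.2) := measurable_snd.
have m3 : measurable_fun setT (fun z : Rn * Rn => z.2 - z.1 : Rn).
  exact: (measurable_addmx_fun m2 (measurable_oppmx_fun m1)).
have mI p' : measurable_fun setT (\1_(sval p') : Rn -> R).
  by apply: measurable_indic; exact: fin_set_measurable.
apply/measurable_EFinP; apply: measurable_funM; last exact: measurableT_comp (mI b) m2.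
by apply: measurable_funM; [exact: measurableT_comp (mI p) m1|exact: measurableT_comp (mI q) m3].
Qed.

Lemma triple_ge0 p q b x y : (0 <= (triple p q b x y)%:E)%E.
Proof. by rewrite lee_fin !mulr_ge0. Qed.

(** Commutativity of convolution: Tonelli, then the substitution of y - x for x at fixed y. *)
Lemma triple_swap p q b :
  (\int[leb]_x \int[leb]_y (triple p q b x y)%:E = \int[leb]_x \int[leb]_y (triple q p b x y)%:E)%E.
Proof.
have ft p' q' := @fubini_tonelli _ _ _ _ _ leb leb _ (measurable_triple p' q' b) (fun z => triple_ge0 p' q' b z.1 z.2).
rewrite (ft p q) (ft q p); apply: eq_integral => y _.
have mpair : measurable_fun setT (fun x : Rn => (x, y) : Rn * Rn) by exact: measurable_pair2.
have mt : measurable_fun setT (fun x : Rn => (triple p q b x y)%:E).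
  exact: (measurableT_comp (measurable_triple p q b) mpair).
apply: etrans (esym (integral_leb_reflect y mt (fun x => triple_ge0 p q b x y))) _.
apply: eq_integral => x _; rewrite /triple; congr (_%:E).
by rewrite subKr mulrC [RHS]mulrC; congr (_ * _); exact: mulrC.
Qed.

Lemma conv_op_ind p q : conv_op p (e q) = conv_op q (e p).
Proof.
apply/eqP; rewrite -subr_eq0; apply/eqP; apply: fin_set_total => b.
  have h := ip_conv_ind p q b; rewrite triple_swap -ip_conv_ind in h.
  by rewrite !(hipE hX); move: h => [->]; rewrite subrr.
rewrite mulI_skew !(hipE hX) !conv_opE.
have z p' q' : Rintegral leb (sval p') (fun x => ip (tau x (e q')) (J (e b))) = 0.
  by apply: Rintegral_eq0 => x _; exact: ip_tau_indJ.
by rewrite !z subrr oppr0.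
Qed.

(** For fixed q the function x |-> <tau_x e_q, F> has integral 0 over every set of finite measure,
    hence vanishes for almost every x. With countably many q, a single x serves them all and for J F
    too; then F translated by - x is orthogonal to a total family. *)
Lemma conv_ind_total F : (forall p q, ip F (conv_op p (e q)) = 0) ->
  (forall p q, ip (J F) (conv_op p (e q)) = 0) -> F = 0.
Proof.
move=> h1 h2; have [C bC] := second_countable_mx R n 1.
(* An enumeration of the test sets; a number that codes none of them gets an arbitrary one. *)
pose Q (m : nat) := if unpickle m is Some (s, k) then qfin bC.1 s k else qfin bC.1 [::] 0.
have key G : (forall p q, ip G (conv_op p (e q)) = 0) ->
    {ae leb, forall x, forall m, ip (tau x (e (Q m))) G = 0}.
  move=> hG; apply/ae_foralln => m.
  apply: (@ae0_of_finite_sets _ _ _ leb (fun x => ip (tau x (e (Q m))) G)).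
    exact: measurable_ip_tau.
  move=> P mP Pfin; pose p : fin_set R n := exist _ P (conj mP Pfin).
  split; first exact: (ip_tau_integrable p).
  by rewrite -(conv_opE p (e (Q m)) G) (hipC hX).
have [x [x1 x2]] : exists x, (forall m, ip (tau x (e (Q m))) F = 0) /\ (forall m, ip (tau x (e (Q m))) (J F) = 0).
  exact: (ae_exists2 (leb_setT_neq0 R n) (key _ h1) (key _ h2)).
rewrite -(tauK x F); suff -> : tau (- x) F = 0 by rewrite (bl0 (qpi_bl (ok x))).
apply: (ind_vec_total (bC := bC)) => s k.
  by have := x1 (pickle (s, k)); rewrite /Q pickleK ip_tau.
by have := x2 (pickle (s, k)); rewrite /Q pickleK ip_tau (qpi_mulI _ (ok (- x))).
Qed.

Theorem translations_commutant_abelian (T A : X -> X) : bounded_linear ip T -> bounded_linear ip A ->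
  commuting T J -> commuting A J -> (forall x, commuting T (tau x)) ->
  (forall x, commuting A (tau x)) -> commuting T A.
Proof.
move=> bT bA TJ AJ Tt At.
apply: (abelian_commutant hX (@mulI_bl R n) (@mulI_skew R n) refl_conj_sym refl_conjK
  refl_conj_mulI conv_op_refl_conj conv_op_ind (@fin_set_total R n) conv_ind_total).
- have Jt x : commuting J (tau x) by move=> F; rewrite (qpi_mulI _ (ok x)).
  by move=> p; exact: conv_op_commuting (@mulI_bl R n) Jt.
- by split => // p; exact: conv_op_commuting.
- by split => // p; exact: conv_op_commuting.
Qed.

End convolution.

(** * Construction of the admissible vector *)

Section restriction.
Context d (T : measurableType d) (R : realType) (mu : {measure set T -> \bar R}) (D : set T).
Hypothesis mD : measurable D.
Implicit Types f g : T -> R[i].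

(** The statement measures voices on G, the quotient space is built over the whole type; extension
    by 0 translates between the two. *)
Definition cut_off f (x : T) : R[i] := if x \in D then f x else 0.

Lemma L2norm_cut_off f : L2norm mu D f = L2norm mu setT (cut_off f).
Proof.
rewrite /L2norm; congr (Lnorm _ _ _); apply/funext => x.
by rewrite !patchE in_setT /cut_off; case: ifP => // _; rewrite Normc.normc0.
Qed.

Lemma L2_cut_off f : L2 mu D f <-> L2 mu setT (cut_off f).
Proof.
have e (p : R[i] -> R) : p 0 = 0 -> (fun x => p (cut_off f x)) = (fun x => p (f x)) \_ D.
  by move=> p0; apply/funext => x; rewrite patchE /cut_off; case: ifP.
by rewrite /L2 L2norm_cut_off /cmeasurable !e// -!measurable_restrictT.
Qed.

Lemma ae_cut_off f g : ae_eq_on mu D f g <-> ae_eq_on mu setT (cut_off f) (cut_off g).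
Proof.
split; apply: filterS => x h.
  by move=> _; rewrite /cut_off; case: ifPn => //; rewrite inE => /h.
by move=> Dx; have := h I; rewrite /cut_off mem_set.
Qed.

End restriction.

Lemma cvg_half_series (R : realType) : cvgn (series (fun k => 2^-1 ^+ k : R)).
Proof.
rewrite (_ : (fun k => _) = geometric 1 (2^-1 : R)); last first.
  by apply/funext => k; rewrite /geometric/= mul1r.
by apply: is_cvg_geometric_series; rewrite ger0_norm ?invr_ge0// invf_lt1// ltr1n.
Qed.

Lemma cvg_sqrt0 (R : realType) (a : nat -> R) :
  a m @[m --> \oo] --> (0 : R) -> Num.sqrt (a m) @[m --> \oo] --> (0 : R).
Proof. by rewrite -{2}(sqrtr0 R) => a0; apply: continuous_cvg => //; exact: sqrt_continuous. Qed.

Section orthogonal_series.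
Variables (R : realType) (X : lmodType R) (ip : X -> X -> R).
Hypothesis hX : hilbert ip.

Lemma orthogonal_sum_norm (y : nat -> X) m k :
  (forall i j, i != j -> ip (y i) (y j) = 0) ->
  ip (\sum_(m <= i < k) y i) (\sum_(m <= i < k) y i) = \sum_(m <= i < k) ip (y i) (y i).
Proof.
move=> yo; elim: k => [|k ih]; first by rewrite !(big_geq (leq0n m)) (hip0l hX).
have [mk|km] := leqP m k; last by rewrite !(big_geq km) (hip0l hX).
have o : ip (\sum_(m <= i < k) y i) (y k) = 0.
  rewrite (hip_suml hX) big_nat_cond big1// => i /andP[/andP[_ ik] _].
  by rewrite yo// neq_ltn ik.
by rewrite !(big_nat_recr _ _ _ mk)/= !(hipDl hX) !(hipDr hX) (hipC hX (y k)) o ih addr0 add0r.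
Qed.

Lemma sum_tail_le (t : nat -> R) (l : R) : (forall k, 0 <= t k) ->
  \sum_(k < m) t k @[m --> \oo] --> l -> forall m k, (m <= k)%N ->
  \sum_(m <= i < k) t i <= l - \sum_(i < m) t i.
Proof.
move=> t0 tl m k mk; rewrite lerBrDl -!(big_mkord xpredT t) -big_cat_nat//=.
have nd : nondecreasing_seq (fun m => \sum_(i < m) t i).
  by apply/nondecreasing_seqP => j; rewrite big_ord_recr/= lerDl.
rewrite -(cvg_lim (@Rhausdorff R) tl) big_mkord.
by apply: (nondecreasing_cvgn_le nd); apply/cvg_ex; exists l.
Qed.

End orthogonal_series.

(** * Orthogonal pieces and their sum, for an abstract invariant closed subspace *)

Section admissibility.
Variables (R : realType) (n : nat).
Local Notation Rn := (borel 'cV[R]_n).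
Local Notation E := (aWH_type R n).
Local Notation leb := (@leb R n).
Local Notation X := (l2 leb).
Local Notation ip := (@l2_ip _ _ _ leb).
Local Notation J := (@l2_mulI _ _ _ leb).
Local Notation pi := (@qpi R n).
Local Notation hX := (@l2_hilbert _ _ _ leb).
Variables (V : {vspace 'cV[R]_n}) (H : set 'M[R]_n).
Hypothesis tc : translation_complete V H.
Local Notation G := (tc_group V H).
Local Notation ok := (tc_ok tc).
Local Notation vo := (vo V H).
Variable mu : {measure set (borel E) -> \bar R}.
Hypothesis hmu : left_haar G mu.
Hypothesis nuni : ~ unimodular G.
Local Notation hM := (@l2_hilbert _ _ _ mu).
Local Notation ipM := (@l2_ip _ _ _ mu).
Implicit Types (F K : X).
Variables (W : set X) (Psi : X) (C : R).
Hypotheses (cW : closed_subspace_of ip W) (WJ : forall F, W F -> W (J F)).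
Hypothesis Wpi : forall h F, G h -> W F -> W (pi h F).
Hypothesis WPsi : W Psi.
Hypothesis bW : forall F, W F -> (csq mu (vo Psi F) <= ((C ^+ 2) * ip F F)%:E)%E.
Hypothesis injW : forall F, W F -> csq mu (vo Psi F) = 0%E -> F = 0.

Lemma transl_G x : G (transl x).
Proof.
by split; [rewrite normr1|exact: mem0v|exact: sub_GL1 tc.1].
Qed.

Lemma mulI_adjoint : adjoint_pair ip J (fun F => - J F).
Proof. by move=> F K; rewrite mulI_skew !(hipE hX). Qed.

Lemma mulIN_bl : bounded_linear ip (fun F => - J F).
Proof.
have [C' bC] := bl_bound (@mulI_bl R n); split; last by exists C' => F; rewrite (hnormN hX).
by move=> a F K; rewrite l2_mulI_linear opprD scalerN.
Qed.

Lemma WN F : W F -> W (- F).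
Proof.
by move=> WF; have [W0 WD _] := cW; rewrite -[- F]addr0 -scaleN1r; exact: WD.
Qed.

Lemma exists_projection : exists P, [/\ bounded_linear ip P, adjoint_pair ip P P,
  forall F, W (P F), forall F, W F -> P F = F &
  commuting P J /\ forall h, G h -> commuting P (pi h)].
Proof.
have [P [bP sP WP PW Pc]] := projection hX cW; exists P; split => //; split.
  have c := Pc _ _ (@mulI_bl R n) mulIN_bl mulI_adjoint WJ (fun F WF => WN (WJ WF)).
  by move=> F; exact: esym (c F).
move=> h Gh; have Gh' := tc_groupV tc Gh.
have c := Pc _ _ (qpi_bl (ok Gh)) (qpi_bl (ok Gh')) (fun F K => qpi_adjoint F K (ok Gh))
  (fun F => Wpi Gh) (fun F => Wpi Gh').
by move=> F; exact: esym (c F).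
Qed.

Section with_projection.
Variable P : X -> X.
Hypotheses (bP : bounded_linear ip P) (sP : adjoint_pair ip P P).
Hypotheses (WP : forall F, W (P F)) (PW : forall F, W F -> P F = F).
Hypotheses (PJ : commuting P J) (Ppi : forall h, G h -> commuting P (pi h)).

Lemma vo_projection F k : vo Psi (P F) k = vo Psi F k.
Proof. by rewrite -(vo_selfadjoint tc Psi F k sP PJ Ppi) (PW WPsi). Qed.

(** P fixes Psi, so the voice of Psi does not distinguish F from P F, which lies in W and is no
    longer than F. *)
Lemma bounded_voice_W : bounded_voice V H mu Psi (C ^+ 2).
Proof.
split=> [|F]; first exact: sqr_ge0.
have e : vo Psi F = vo Psi (P F) by apply/funext => k; rewrite vo_projection.
rewrite e; apply: le_trans (bW (WP F)) _; rewrite lee_fin ler_wpM2l ?sqr_ge0//.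
have h1 : 0 <= ip (F - P F) (F - P F) by exact: (hip_ge0 hX).
have h2 : ip (P F) (P F) = ip (P F) F by rewrite (sP F (P F)) (PW (WP F)) (hipC hX).
move: h1; rewrite !(hipDl hX, hipDr hX) !(hipNl hX, hipNr hX) (hipC hX F (P F)) -h2.
by rewrite opprK; lra.
Qed.

Lemma exists_decomposition : exists B : nat -> X -> X,
  [/\ forall k, [/\ adjoint_pair ip (B k) (B k), commuting (B k) J,
        forall h, G h -> commuting (B k) (pi h) & W (B k Psi)],
      forall k l T, k != l -> bounded_linear ip T -> commuting T J ->
        (forall h, G h -> commuting T (pi h)) -> forall F, ip (T (B k F)) (B l F) = 0 &
      forall F, W F -> \sum_(k < m) cip mu (vo Psi (B k F)) (vo Psi (B k F)) @[m --> \oo] --> ip F F].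
Proof.
have bv := bounded_voice_W.
have [S [bS SE SJ Spi]] := voice_operator tc hmu bv bv.
have sS : adjoint_pair ip S S.
  by move=> F K; rewrite SE (hipC hX F) SE; exact: cipC.
(* Translation completeness enters here: G contains every translation, so both operators lie in
   their commutant. *)
have ctr T A (bT : bounded_linear ip T) (bA : bounded_linear ip A) (TJ : commuting T J) (AJ : commuting A J)
    (Tpi : forall h, G h -> commuting T (pi h)) (Api : forall h, G h -> commuting A (pi h)) : commuting T A.
  apply: translations_commutant_abelian => //.
    by move=> x; apply: Tpi; exact: transl_G.
  by move=> x; apply: Api; exact: transl_G.
have S0 F : 0 <= ip (S F) F.
  by rewrite SE -lee_fin (cip_csq (L2_vo tc F bv)); exact: csq_ge0.
have PS : commuting P S by exact: ctr.
have Sinj F : P F = F -> ip (S F) F = 0 -> F = 0.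
  move=> PF SF; apply: injW; first by rewrite -PF.
  by rewrite -(cip_csq (L2_vo tc F bv)) -SE SF.
have [B [hB BB BS]] := spectral_resolution hX bS sS S0 bP sP PS Sinj.
exists B; split.
- move=> k; have [bB sB cB] := hB k.
  have BJ : commuting (B k) J.
    have c := cB _ _ (@mulI_bl R n) mulIN_bl mulI_adjoint (fun F => esym (SJ F)).
    by move=> F; exact: esym (c F).
  have Bpi h (Gh : G h) : commuting (B k) (pi h).
    have Gh' := tc_groupV tc Gh.
    have c := cB _ _ (qpi_bl (ok Gh)) (qpi_bl (ok Gh')) (fun F K => qpi_adjoint F K (ok Gh))
      (fun F => esym (Spi _ Gh F)).
    by move=> F; exact: esym (c F).
  split => //; have PB : P (B k Psi) = B k (P Psi) := cB _ _ bP bP sP PS Psi.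
  by rewrite -(PW WPsi) -PB; exact: WP.
- move=> k l T kl bT TJ Tpi F; have [T' bT' aT] := has_adjoint hX bT.
  have [_ sB cB] := hB k; have [bl_l sl _] := hB l.
  have TS : commuting T S by exact: ctr.
  have TB : T (B k F) = B k (T F) := cB _ _ bT bT' aT TS F.
  by rewrite TB sB (BB _ _ _ kl) (hip0r hX).
- move=> F WF; have := BS F (PW WF).
  by under eq_fun do under eq_bigr do rewrite SE.
Qed.

End with_projection.

(** Take c > 4^k |B_k Psi|^2 and w = c^(-1/2). The voice of w pi(h) B_k Psi keeps the norm of that
    of B_k Psi, while the vector gets shorter than 2^-k. *)
Lemma scaled_choice (B : nat -> X -> X) : exists (h : nat -> E) (w : nat -> R),
  forall k, [/\ G (h k), exists2 c, right_scaling mu (h k) c & w k ^+ 2 * c = 1 &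
    `|w k| * hnorm ip (B k Psi) <= 2^-1 ^+ k].
Proof.
suff /choice[hw hwP] : forall k, exists hw : E * R, [/\ G hw.1,
    exists2 c, right_scaling mu hw.1 c & hw.2 ^+ 2 * c = 1 & `|hw.2| * hnorm ip (B k Psi) <= 2^-1 ^+ k].
  by exists (fun k => (hw k).1), (fun k => (hw k).2).
move=> k; pose a := ip (B k Psi) (B k Psi).
have a0 : 0 <= a by exact: (hip_ge0 hX).
have [h [c [Gh hc ac]]] := nonunimodular_scaling tc hmu (4 ^+ k * a) nuni.
have c0 := hc.1; have ci : 0 <= c^-1 by rewrite invr_ge0 ltW.
exists (h, Num.sqrt c^-1); split => //=.
  by exists c => //; rewrite sqr_sqrtr// mulVf// lt0r_neq0.
rewrite ger0_norm ?sqrtr_ge0// /hnorm -(sqrtrM _ ci) -/a.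
have -> : 2^-1 ^+ k = Num.sqrt (4^-1 ^+ k) :> R.
  rewrite (_ : 4^-1 ^+ k = (2^-1 ^+ k) ^+ 2); last first.
    by rewrite exprAC; congr (_ ^+ k); field.
  by rewrite sqrtr_sqr ger0_norm// exprn_ge0// invr_ge0.
apply: ler_wsqrtr; rewrite mulrC ler_pdivrMr// exprVn mulrC ler_pdivlMr ?exprn_gt0//.
by rewrite mulrC; exact: ltW.
Qed.

Section with_decomposition.
Variables (B : nat -> X -> X) (h : nat -> E) (w : nat -> R).
Hypothesis bv : bounded_voice V H mu Psi (C ^+ 2).
Hypothesis hB : forall k, [/\ adjoint_pair ip (B k) (B k), commuting (B k) J,
        forall h, G h -> commuting (B k) (pi h) & W (B k Psi)].
Hypothesis Borth : forall k l T, k != l -> bounded_linear ip T -> commuting T J ->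
        (forall h, G h -> commuting T (pi h)) -> forall F, ip (T (B k F)) (B l F) = 0.
Hypothesis Bsum : forall F, W F ->
  \sum_(k < m) cip mu (vo Psi (B k F)) (vo Psi (B k F)) @[m --> \oo] --> ip F F.
Hypothesis hw : forall k, [/\ G (h k), exists2 c, right_scaling mu (h k) c & w k ^+ 2 * c = 1 &
    `|w k| * hnorm ip (B k Psi) <= 2^-1 ^+ k].

Let u k : X := w k *: pi (h k) (B k Psi).
Let Gh k : G (h k). Proof. by have [] := hw k. Qed.

Lemma W_term k : W (u k).
Proof.
have [W0 WD _] := cW; have [_ _ _ WB] := hB k.
by rewrite -[u k]addr0; apply: WD => //; exact: Wpi.
Qed.

Lemma norm_term k : hnorm ip (u k) <= 2^-1 ^+ k.
Proof. by rewrite (hnormZ hX) (qpi_hnorm _ (ok (Gh k))); have [] := hw k. Qed.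

Lemma bounded_translate k : exists D, bounded_voice V H mu (pi (h k) Psi) D.
Proof.
by have [_ [c hc _] _] := hw k; exists (c * C ^+ 2); exact: bounded_voice_qpi.
Qed.

Lemma vo_term k F x : vo (u k) F x = real_complex R (w k) * vo (pi (h k) Psi) (B k F) x.
Proof.
have [sB BJ Bpi _] := hB k.
by rewrite (voZr tc) -(Bpi _ (Gh k)) (vo_selfadjoint tc _ F x sB BJ Bpi).
Qed.

Lemma L2_term k F : L2 mu setT (vo (u k) F).
Proof.
have [D bD] := bounded_translate k.
rewrite (_ : vo (u k) F = fun x => real_complex R (w k) * vo (pi (h k) Psi) (B k F) x).
  by apply: L2Z; exact: L2_vo bD.
by apply/funext => x; exact: vo_term.
Qed.

Lemma to_l2_term k F : to_l2 mu (vo (u k) F) = w k *: to_l2 mu (vo (pi (h k) Psi) (B k F)).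
Proof.
have [D bD] := bounded_translate k.
rewrite -(to_l2Z _ (L2_vo tc (B k F) bD)); congr to_l2; apply/funext => x; exact: vo_term.
Qed.

(** By [vo_term] the product is a multiple of <T B_k F, B_l F>, where T belongs to the two
    translates pi(h_k) Psi and pi(h_l) Psi; the translations only change T. *)
Lemma term_orthogonal k l F : k != l -> ipM (to_l2 mu (vo (u k) F)) (to_l2 mu (vo (u l) F)) = 0.
Proof.
move=> kl.
have [D bD] := bounded_translate k; have [D' bD'] := bounded_translate l.
have [T [bT TE TJ Tpi]] := voice_operator tc hmu bD bD'.
have scale0 (a b : R) (x y : l2 mu) : ipM x y = 0 -> ipM (a *: x) (b *: y) = 0.
  by move=> xy; rewrite (hipZl hM) (hipZr hM) xy !mulr0.
apply: etrans (congr2 ipM (to_l2_term k F) (to_l2_term l F)) _; apply: scale0.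
apply: etrans (l2_ipE (L2_vo tc (B k F) bD) (L2_vo tc (B l F) bD')) _.
apply: etrans (esym (TE _ _)) _; exact: Borth kl bT TJ Tpi F.
Qed.

Lemma term_norm k F : ipM (to_l2 mu (vo (u k) F)) (to_l2 mu (vo (u k) F)) =
  cip mu (vo Psi (B k F)) (vo Psi (B k F)).
Proof.
have [D bD] := bounded_translate k; have [_ [c hc wc] _] := hw k.
apply: EFin_inj; rewrite to_l2_term (hipZl hM) (hipZr hM) mulrA -expr2 EFinM.
rewrite (l2_ip_csq (L2_vo tc (B k F) bD)) (csq_right_translate tc hmu _ _ (Gh k) hc).
by rewrite muleA -EFinM wc mul1e (cip_csq (L2_vo tc (B k F) bv)).
Qed.

Let t F k := cip mu (vo Psi (B k F)) (vo Psi (B k F)).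

Lemma term_ge0 F k : 0 <= t F k.
Proof. by rewrite /t -term_norm; exact: (hip_ge0 hM). Qed.

Lemma L2_vo_sum F m k : L2 mu setT (vo (\sum_(m <= i < k) u i) F) /\
  to_l2 mu (vo (\sum_(m <= i < k) u i) F) = \sum_(m <= i < k) to_l2 mu (vo (u i) F).
Proof.
have e0 : vo (0 : X) F = fun=> 0 by apply/funext => x; rewrite (vo0r tc).
elim: k => [|k [ihL ih]]; first by rewrite !(big_geq (leq0n m)) e0; split; [exact: L2_0|exact: to_l2_0].
have [mk|km] := leqP m k; last by rewrite !(big_geq km) e0; split; [exact: L2_0|exact: to_l2_0].
rewrite !(big_nat_recr _ _ _ mk)/=.
have e : vo (\sum_(m <= i < k) u i + u k) F = fun x => vo (\sum_(m <= i < k) u i) F x + vo (u k) F x.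
  by apply/funext => x; rewrite (voDr tc).
split; first exact: (eq_ind_r (L2 mu setT) (L2D ihL (L2_term k F)) e).
apply: etrans (congr1 (to_l2 mu) e) _; apply: etrans (to_l2D ihL (L2_term k F)) _.
exact: (congr1 (fun z => z + to_l2 mu (vo (u k) F)) ih).
Qed.

Lemma csq_vo_sum F m k : csq mu (vo (\sum_(m <= i < k) u i) F) = (\sum_(m <= i < k) t F i)%:E.
Proof.
have [L e] := L2_vo_sum F m k; rewrite -(l2_ip_csq L) e (orthogonal_sum_norm hM).
  by congr (_%:E); apply: eq_bigr => i _; exact: term_norm.
by move=> i j; exact: term_orthogonal.
Qed.

Lemma series_exists : exists Psi', hlim ip (fun m => \sum_(0 <= k < m) u k) Psi'.
Proof.
have [l hl] := hsummable hX norm_term (@cvg_half_series R).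
by exists l; apply: eq_hlim hl => m; rewrite big_mkord.
Qed.

Section with_limit.
Variable Psi' : X.
Hypothesis hPsi' : hlim ip (fun m => \sum_(0 <= k < m) u k) Psi'.

Lemma W_limit : W Psi'.
Proof.
have [W0 WD Wlim] := cW; apply: Wlim hPsi'; elim=> [|m ih]; first by rewrite (big_geq (leq0n 0%N)).
by rewrite (big_nat_recr _ _ _ (leq0n m))/= -[X in X + _]scale1r; apply: WD => //; exact: W_term.
Qed.

(** Convergence of the series of vectors gives only pointwise convergence of the voices. Fatou turns
    it into a norm bound, the norms of the partial tails being known from orthogonality. *)
Lemma csq_vo_tail F m : W F ->
  (csq mu (vo (Psi' - \sum_(0 <= k < m) u k)%R F) <= (ip F F - \sum_(0 <= i < m) t F i)%R%:E)%E.
Proof.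
move=> WF; set s := \sum_(0 <= k < m) u k.
have tl : hlim ip (fun k => \sum_(m <= i < (m + k)%N) u i) (Psi' - s).
  have h1 : hlim ip (fun k => \sum_(0 <= i < (m + k)%N) u i) Psi'.
    elim: (m) => [//|m' ih]; apply: eq_hlim (hlim_shift ih) => k.
    by rewrite addnS addSn.
  apply: eq_hlim (hlimD hX h1 (hlim_cst hX (- s))) => k.
  by rewrite (big_cat_nat (leq0n m) (leq_addr k m))/= -/s addrAC subrr add0r.
apply: (fatou_bound (f := fun k x => cmod2 (vo (\sum_(m <= i < (m + k)%N) u i) F x))).
- by move=> k; apply: measurable_cmod2; exact: cmeas_vo.
- by move=> k x; exact: cmod2_ge0.
- by move=> x; exact: (@vo_lim _ _ _ _ tc _ _ F x tl).
move=> k; have := csq_vo_sum F m (m + k)%N; rewrite /csq => ->; rewrite lee_fin big_mkord.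
exact: (sum_tail_le (term_ge0 F) (Bsum WF) (leq_addr k m)).
Qed.

Lemma L2_vo_limit F : W F -> L2 mu setT (vo Psi' F).
Proof.
move=> WF; apply/L2P; split; first exact: cmeas_vo.
have := csq_vo_tail 0 WF; rewrite (big_geq (leq0n 0%N)) subr0 => hle.
by apply: le_lt_trans hle _; rewrite ltry.
Qed.

Lemma vo_limit_isometry F : W F -> csq mu (vo Psi' F) = (ip F F)%:E.
Proof.
move=> WF; have L' := L2_vo_limit WF.
pose v m := to_l2 mu (vo (\sum_(0 <= k < m) u k) F).
(* The tail bound tends to 0, so the partial voices converge in norm and the squared norm of the
   limit is the full sum, <F, F>. *)
have vl : hlim ipM v (to_l2 mu (vo Psi' F)).
  have sq : ip F F - \sum_(0 <= i < m) t F i @[m --> \oo] --> (0 : R).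
    have : ip F F - \sum_(i < m) t F i @[m --> \oo] --> ip F F - ip F F.
      by apply: cvgB; [exact: cvg_cst|exact: Bsum].
    by rewrite subrr; under eq_fun do rewrite -(big_mkord xpredT (t F)).
  have sq2 : Num.sqrt (ip F F - \sum_(0 <= i < m) t F i) @[m --> \oo] --> (0 : R).
    exact: cvg_sqrt0 sq.
  apply: (@squeeze_cvgr _ _ _ _ (fun=> 0)) sq2; last exact: cvg_cst.
  apply: nearW => m; rewrite sqrtr_ge0/= (hnormBC hM) /hnorm; apply: ler_wsqrtr.
  have [Ls _] := L2_vo_sum F 0 m.
  rewrite /v -(to_l2B L' Ls) -lee_fin (l2_ip_csq (L2B L' Ls)).
  apply: le_trans (csq_vo_tail m WF); rewrite le_eqVlt; apply/orP; left; apply/eqP.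
  apply: eq_integral => x _; congr ((cmod2 _)%:E).
  have e : Psi' = (Psi' - \sum_(0 <= k < m) u k) + \sum_(0 <= k < m) u k by rewrite subrK.
  by rewrite {1}e (voDr tc) addrK.
rewrite -(l2_ip_csq L'); congr (_%:E).
have h1 := hlim_norm2 hM vl.
have e m : ipM (v m) (v m) = \sum_(k < m) t F k.
  by have [L _] := L2_vo_sum F 0 m; apply: EFin_inj; rewrite (l2_ip_csq L) csq_vo_sum big_mkord.
have h2 : ipM (v m) (v m) @[m --> \oo] --> ip F F by under eq_fun do rewrite e; exact: Bsum.
exact: (cvg_unique (@Rhausdorff R) h1 h2).
Qed.

End with_limit.
End with_decomposition.

Theorem exists_isometric_voice : exists2 Psi', W Psi' &
  forall F, W F -> L2 mu setT (vo Psi' F) /\ csq mu (vo Psi' F) = (ip F F)%:E.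
Proof.
have [P [bP sP WP PW [PJ Ppi]]] := exists_projection.
have bv := bounded_voice_W sP WP PW PJ Ppi.
have [B [hB Borth Bsum]] := exists_decomposition bP sP WP PW PJ Ppi.
have [h [w hw]] := scaled_choice B.
have [Psi' hPsi'] := series_exists hw.
exists Psi'; first exact: (W_limit hB hw hPsi').
move=> F WF; split; first exact: (L2_vo_limit bv hB Borth Bsum hw hPsi' WF).
exact: (vo_limit_isometry bv hB Borth Bsum hw hPsi' WF).
Qed.

End admissibility.

(** * Transfer between functions and classes, and the two implications *)

Section main.
Variables (R : realType) (n : nat).
Local Notation Rn := (borel 'cV[R]_n).
Local Notation E := (aWH_type R n).
Local Notation leb := (@leb R n).
Local Notation L2 := (Defs.L2 leb setT).
Local Notation X := (l2 leb).
Local Notation ip := (@l2_ip _ _ _ leb).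
Local Notation J := (@l2_mulI _ _ _ leb).
Local Notation hX := (@l2_hilbert _ _ _ leb).
Variables (V : {vspace 'cV[R]_n}) (H : set 'M[R]_n).
Hypothesis tc : translation_complete V H.
Local Notation G := (tc_group V H : set (borel E)).
Local Notation ok := (tc_ok tc).
Local Notation vo := (vo V H).
Variable mu : {measure set (borel E) -> \bar R}.
Hypothesis hmu : left_haar G mu.
Variable W : set (Rn -> R[i]).
Hypotheses (cW : closed_subspace leb W) (iW : invariant_under G W).
Local Notation L2M := (@Defs.L2 _ (borel E) R mu).
Local Notation ipM := (@l2_ip _ _ _ mu).
Local Notation hM := (@l2_hilbert _ _ _ mu).
Implicit Types f g psi : Rn -> R[i].

Let mG : measurable G := measurable_tc_group tc.

Let WL f : W f -> L2 f. Proof. by case: cW => h _ _ _; exact: h. Qed.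

Let W_to_l2 f : W f -> W (to_l2 leb f).
Proof.
move=> Wf; apply: (closed_subspace_ae cW (l2_L2 _) Wf).
by apply: aeq_sym; apply: to_l2_ae; exact: WL.
Qed.

Lemma cut_off_voice psi f : L2 f -> L2 psi ->
  cut_off G (voice psi f) = vo (to_l2 leb psi) (to_l2 leb f).
Proof.
move=> Lf Lpsi; apply/funext => k; rewrite /cut_off; case: ifPn => [|].
  by rewrite inE => Gk; exact: (voice_vo tc Lf Lpsi Gk).
by rewrite notin_setE => Gk; rewrite vo_out.
Qed.

Lemma cut_off0 psi : L2 psi -> cut_off G (voice psi (fun=> 0)) = fun=> 0.
Proof.
move=> Lpsi; rewrite (cut_off_voice (L2_0 leb) Lpsi); apply/funext => k.
exact: vo0l.
Qed.

Lemma hnorm_cscale (a : R[i]) (x : l2 mu) :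
  hnorm ipM (l2_cscale a x) = Num.sqrt (cmod2 a) * hnorm ipM x.
Proof.
elim/l2_ind: x => f Lf; rewrite (to_l2_cscale a Lf) /hnorm -sqrtrM ?cmod2_ge0//.
congr Num.sqrt; apply: EFin_inj; rewrite EFinM (l2_ip_csq (L2Z a Lf)) (l2_ip_csq Lf).
exact: (csqZ mu a (L2_meas Lf)).
Qed.

Lemma cscaleK (a : R[i]) (x : l2 mu) : a != 0 -> l2_cscale a^-1 (l2_cscale a x) = x.
Proof.
move=> a0; elim/l2_ind: x => f Lf; rewrite (to_l2_cscale a Lf) (to_l2_cscale _ (L2Z a Lf)).
by congr to_l2; apply/funext => x; rewrite mulrA mulVf// mul1r.
Qed.

(** [isometry_op] asks for preserved distances, not for linearity, so the bound on norms needs the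
    value of the isometry at 0. Injectivity follows by cancelling c. *)
Lemma admissible_weakly_admissible : admissible G mu W -> weakly_admissible G mu W.
Proof.
move=> [psi [Wpsi Lpsi [c [c0 [Jm [[LJ Jiso] VJ]]]]]]; exists psi.
have [_ W0 WD _] := cW.
pose v f := to_l2 mu (cut_off G (voice psi f)).
pose j f := to_l2 mu (cut_off G (Jm f)).
have Lv f : W f -> L2M setT (cut_off G (voice psi f)) by move=> Wf; apply/(L2_cut_off mu mG); exact: Lpsi.
have Lj f : W f -> L2M setT (cut_off G (Jm f)) by move=> Wf; apply/(L2_cut_off mu mG); exact: LJ.
have vj f : W f -> v f = l2_cscale c (j f).
  move=> Wf; apply: etrans (esym (to_l2_cscale c (Lj f Wf))).
  apply: (eq_to_l2 (Lv f Wf) (L2Z c (Lj f Wf))).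
  have /(ae_cut_off mu G) := VJ f Wf.
  apply: filterS => x hx _; rewrite (hx I) /cut_off; case: ifP => // _.
  by rewrite mulr0.
have jiso f g : W f -> W g -> hnorm ipM (j f - j g) = hnorm ip (to_l2 leb f - to_l2 leb g).
  move=> Wf Wg; apply: EFin_inj; have := Jiso f g Wf Wg.
  rewrite L2norm_cut_off (L2norm_l2 (L2B (WL Wf) (WL Wg))) (to_l2B (WL Wf) (WL Wg)) => <-.
  rewrite /j -(to_l2B (Lj f Wf) (Lj g Wg)) -(L2norm_l2 (L2B (Lj f Wf) (Lj g Wg))).
  congr L2norm; apply/funext => x; rewrite /cut_off; case: ifP => // _.
  by rewrite subrr.
(* The voice of the zero function is 0 and equals c times its image under the isometry, and c is
   nonzero. *)
have j0 : j (fun=> 0) = 0.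
  rewrite -(cscaleK (j (fun=> 0)) c0) -(vj _ W0) /v (cut_off0 (WL Wpsi)) (to_l2_cscale _ (L2_0 mu)).
  by rewrite -(to_l2_0 mu); congr to_l2; apply/funext => x; rewrite mulr0.
split => //.
  exists (Num.sqrt (cmod2 c)) => f Wf.
  rewrite L2norm_cut_off (L2norm_l2 (Lv f Wf)) (L2norm_l2 (WL Wf)) -/(v f) (vj f Wf) hnorm_cscale.
  rewrite -EFinM lee_fin -[j f]subr0 -j0 (jiso _ _ Wf W0) (to_l2_0 leb) subr0//.
move=> f g Wf Wg fg; apply: (to_l2_inj (WL Wf) (WL Wg)).
apply/eqP; rewrite -subr_eq0; apply/eqP; apply: (hnorm_eq0 hX); rewrite -(jiso _ _ Wf Wg).
suff -> : j f = j g by rewrite subrr (hnorm0 hM).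
rewrite -(cscaleK (j f) c0) -(cscaleK (j g) c0) -(vj _ Wf) -(vj _ Wg); congr l2_cscale.
by apply: (eq_to_l2 (Lv f Wf) (Lv g Wg)); apply/(ae_cut_off mu G).
Qed.

Lemma weakly_admissible_admissible : ~ unimodular (tc_group V H) ->
  weakly_admissible G mu W -> admissible G mu W.
Proof.
move=> nuni [psi [Wpsi Lpsi [C bC] inj]].
have [_ W0 WD _] := cW; pose W' := [set F : X | W F].
have cW' : closed_subspace_of ip W' := l2_closed_subspace cW.
have W'J F : W' F -> W' (J F).
  move=> WF; rewrite -(l2funK F) (l2_mulI_to_l2 (l2_L2 F)); apply: W_to_l2.
  have := WD (Complex 0 1) _ _ WF W0; congr W; apply/funext => y; exact: addr0.
have W'pi h F : G h -> W' F -> W' (qpi h F).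
  move=> Gh WF; rewrite -(l2funK F) (qpi_to_l2 (ok Gh) (l2_L2 F)); apply: W_to_l2.
  exact: iW.
have voE F : W' F -> cut_off G (voice psi F) = vo (to_l2 leb psi) F.
  by move=> WF; rewrite (cut_off_voice (l2_L2 F) (WL Wpsi)) l2funK.
have W'b F : W' F -> (csq mu (vo (to_l2 leb psi) F) <= ((C ^+ 2) * ip F F)%:E)%E.
  move=> WF; have L : L2M setT (vo (to_l2 leb psi) F).
    by rewrite -(voE _ WF); apply/(L2_cut_off mu mG); exact: Lpsi.
  have := bC F WF; rewrite L2norm_cut_off (voE _ WF) (L2norm_l2 L) (L2norm_l2 (l2_L2 F)) l2funK -EFinM lee_fin => h.
  rewrite -(l2_ip_csq L) lee_fin -(hnorm_sqr hM) -(hnorm_sqr hX) -exprMn.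
  by rewrite ler_pXn2r// nnegrE ?sqrtr_ge0//; apply: le_trans h; exact: sqrtr_ge0.
have W'inj F : W' F -> csq mu (vo (to_l2 leb psi) F) = 0%E -> F = 0.
  move=> WF F0; have ae := csq_eq0 (cmeas_vo tc (to_l2 leb psi) F) F0.
  have : ae_eq_on leb setT F (fun=> 0).
    apply: inj => //; apply/(ae_cut_off mu G).
    by rewrite (voE _ WF) (cut_off0 (WL Wpsi)).
  by move=> Fz; rewrite -(l2funK F) (eq_to_l2 (l2_L2 F) (L2_0 leb) Fz); exact: to_l2_0.
have [Psi' WPsi' hP] := exists_isometric_voice tc hmu nuni cW' W'J W'pi (W_to_l2 Wpsi) W'b W'inj.
have voE' f : W f -> cut_off G (voice Psi' f) = vo Psi' (to_l2 leb f).
  by move=> Wf; rewrite (cut_off_voice (WL Wf) (l2_L2 Psi')) l2funK.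
have L' f : W f -> L2M G (voice Psi' f).
  move=> Wf; apply/(L2_cut_off mu mG); rewrite (voE' _ Wf).
  exact: (hP _ (W_to_l2 Wf)).1.
(* The isometry is the voice transform itself; by linearity its distances are the norms of voices of
   differences f - g. *)
exists Psi'; split => //; exists 1; split; first exact: oner_neq0.
exists (voice Psi'); split; last by move=> f Wf; apply/aeW => x _; rewrite mul1r.
split => // f g Wf Wg.
have WB : W' (- 1 *: to_l2 leb g + to_l2 leb f).
  by have [_ h _] := cW'; apply: h; exact: W_to_l2.
have e : cut_off G (fun x => voice Psi' f x - voice Psi' g x) = vo Psi' (- 1 *: to_l2 leb g + to_l2 leb f).
  apply/funext => x; rewrite (voPl tc) -(voE' _ Wf) -(voE' _ Wg) /cut_off.
  case: ifP => _; last by rewrite mulr0 addr0.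
  by rewrite rmorphN rmorph1 mulN1r addrC.
have [LB hB] := hP _ WB.
rewrite L2norm_cut_off e (L2norm_l2 LB) (L2norm_l2 (L2B (WL Wf) (WL Wg))) (to_l2B (WL Wf) (WL Wg)).
congr (_%:E); rewrite /hnorm; congr Num.sqrt; apply: EFin_inj.
apply: etrans (l2_ip_csq LB) _; apply: etrans hB _.
have e2 : - 1 *: to_l2 leb g + to_l2 leb f = to_l2 leb f - to_l2 leb g.
  by rewrite scaleN1r addrC.
exact: (congr1 (fun z => (ip z z)%:E) e2).
Qed.

End main.

Theorem theorem4p13 (R : realType) (n : nat)
    (V : {vspace 'cV[R]_n}) (H : set 'M[R]_n) (U : set (borel 'cV[R]_n))
    (mu : {measure set (borel (aWH_type R n)) -> \bar R}) :
  translation_complete V H ->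
  left_haar (tc_group V H) mu ->
  ~ unimodular (tc_group V H) ->
  measurable U ->
  dual_invariant V H U ->
  closed_subspace (@leb R n) (bandlimited U) ->
  invariant_under (tc_group V H) (bandlimited U) ->
  admissible (tc_group V H) mu (bandlimited U) <->
  weakly_admissible (tc_group V H) mu (bandlimited U).
Proof.
move=> tc hmu nuni _ _ cU iU; split; first exact: (admissible_weakly_admissible tc cU).
exact: (weakly_admissible_admissible tc hmu cU iU nuni).
Qed.
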